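(* Let $\Omega\subset\mathbb R^d$ be a bounded convex body and let $P(D)=D^2+q$ with a constant $q\in\mathbb R$. Then $$R_n\big(W^{P(D)}_\infty(\Omega)\big)= \frac14\left(\frac{\Theta(d)\,\mu_d(\Omega)}{\nu_d\, n}\right)^{2/d}(1+o(1))\qquad (n\to\infty),$$ i.e. $\lim_{n\to\infty} n^{2/d}R_n\big(W^{P(D)}_\infty(\Omega)\big)= \frac14\left(\frac{\Theta(d)\mu_d(\Omega)}{\nu_d}\right)^{2/d}$.
   Context: A convex body is a compact convex set with non-empty interior. $\mu_d$ is Lebesgue measure on $\mathbb R^d$, $\nu_d$ the volume of the unit ball of $\mathbb R^d$. Function class: for a convex body $\Omega$ and $P(D)=D^2+pD+q$, $W^{P(D)}_\infty(\Omega)$ is the set of $f:\Omega\to\mathbb R$ such that $f\in C^1(\Omega)$ and, for every unit vector $u\in\mathbb R^d$, the second directional derivative $\partial^2 f/\partial u^2$ exists in the generalized sense (for almost every line parallel to $u$ meeting the interior of $\Omega$, the restriction of $\partial f/\partial u$ to that line is locally absolutely continuous), and $\operatorname{ess\,sup}_{x\in\Omega}\big|\frac{\partial^2 f}{\partial u^2}(x)+p\frac{\partial f}{\partial u}(x)+qf(x)\big|\le1$. (Here $p=0$.) Recovery: for a finite set $\xi\subset\Omega$, the information is $I_\xi(f)=\{(f(x),\nabla f(x)):x\in\xi\}$. An algorithm is any map $\phi$ from the information to $C(\Omega)$. $R(W^{P(D)}_\infty(\Omega),\xi)=\inf_\phi\sup_{f\in W^{P(D)}_\infty(\Omega)}\|f-\phi(I_\xi(f))\|_\infty$,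 and $R_n(W^{P(D)}_\infty(\Omega))=\inf\{R(W^{P(D)}_\infty(\Omega),\xi):\xi\subset\Omega,\ \operatorname{card}\xi\le n\}$. Covering density: a covering of $\mathbb R^d$ is a countable family $\mathcal M$ of balls of equal radius whose union is $\mathbb R^d$; $\operatorname{dens}\mathcal M=\liminf_{R\to\infty}\sum_{B\in\mathcal M}\mu_d(B\cap[-R,R]^d)/\mu_d([-R,R]^d)$, and $\Theta(d)=\inf\{\operatorname{dens}\mathcal M:\mathcal M\text{ covers }\mathbb R^d\}$. *)

(* Defs.v *)
From HB Require Import structures.
From mathcomp Require Import all_boot all_order all_algebra.
From mathcomp Require Import all_classical all_reals all_analysis.
Set Implicit Arguments. Unset Strict Implicit. Unset Printing Implicit Defensive.
Import Order.TTheory GRing.Theory Num.Theory.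
Import numFieldNormedType.Exports.
Local Open Scope classical_set_scope.
Local Open Scope ring_scope.

Section Defs.
Variables (R : realType) (d : nat).
Notation V := 'rV[R]_d.

Definition dotE (x y : V) : R := \sum_(i < d) x 0 i * y 0 i.
Definition enorm (x : V) : R := Num.sqrt (dotE x x).

Definition eball (c : V) (r : R) : set V := [set x | enorm (x - c) <= r].

Definition box (a b : V) : set V := [set x | forall i, a 0 i <= x 0 i <= b 0 i].
Definition box_vol (a b : V) : R := \prod_(i < d) Num.max 0 (b 0 i - a 0 i).

(* Lebesgue (outer) measure on R^d: infimum of total volumes of countable
   covers by boxes. It coincides with mu_d on Lebesgue measurable sets. *)
Definition leb_outer (A : set V) : \bar R :=
  ereal_inf [set s : \bar R | exists a b : nat -> V,
      A `<=` \bigcup_k box (a k) (b k) /\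
      s = (\sum_(k <oo) (box_vol (a k) (b k))%:E)%E].

Definition negligible (A : set V) : Prop := leb_outer A = 0%E.

Definition nu : R := fine (leb_outer (eball 0 1)).

Definition convex_set (K : set V) : Prop :=
  forall x y t, K x -> K y -> 0 <= t <= 1 -> K ((1 - t) *: x + t *: y).
Definition convex_body (K : set V) : Prop :=
  compact K /\ convex_set K /\ (interior K !=set0).

Definition cube (r : R) : set V := [set x | forall i, - r <= x 0 i <= r].

Definition is_ball_covering (c : nat -> V) (r : R) : Prop :=
  0 < r /\ \bigcup_k eball (c k) r = setT.

Definition dens_at (c : nat -> V) (r : R) (T : R) : \bar R :=
  ((\sum_(k <oo) leb_outer (eball (c k) r `&` cube T)) *
     ((((2 * T) ^+ d)^-1)%:E))%E.

Definition dens (c : nat -> V) (r : R) : \bar R :=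
  ereal_sup [set ereal_inf [set dens_at c r T | T in [set T | M <= T]]
            | M in [set: R]].

Definition Theta : \bar R :=
  ereal_inf [set t : \bar R | exists (c : nat -> V) (r : R),
                                is_ball_covering c r /\ t = dens c r].

Definition abs_cont_on (g : R -> R) (a b : R) : Prop :=
  forall eps, 0 < eps -> exists2 delta, 0 < delta &
    forall (n : nat) (s t : nat -> R),
      (forall k, (k < n)%N -> a <= s k /\ s k <= t k /\ t k <= b) ->
      (forall k, (k.+1 < n)%N -> t k <= s k.+1) ->
      \sum_(k < n) (t k - s k) < delta ->
      \sum_(k < n) `|g (t k) - g (s k)| < eps.

Definition loc_abs_cont_on (g : R -> R) (I : set R) : Prop :=
  forall a b, a <= b -> `[a, b] `<=` I -> abs_cont_on g a b.

Definition C1_on (Om : set V) (f : V -> R) (G : V -> V) : Prop :=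
  {within Om, continuous f} /\ {within Om, continuous G} /\
  forall x, interior Om x ->
    differentiable f x /\ forall v, 'd f x v = dotE (G x) v.

(* W^{P(D)}_oo(Omega) for P(D) = D^2 + q (p = 0); elements are pairs (f, grad f) *)
Definition W_class (q : R) (Om : set V) (f : V -> R) (G : V -> V) : Prop :=
  C1_on Om f G /\
  forall u : V, enorm u = 1 ->
    (* for almost every line parallel to u meeting the interior of Om, the
       restriction of df/du to that line is locally absolutely continuous *)
    negligible [set x | interior Om x /\
      ~ loc_abs_cont_on (fun t => dotE (G (x + t *: u)) u)
                        [set t | interior Om (x + t *: u)]] /\
    (* ess sup over Omega of |d^2 f/du^2 + q f| is <= 1 *)
    negligible [set x | Om x /\
      ~ exists D, is_derive (0 : R) 1 (fun t => dotE (G (x + t *: u)) u) D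
                  /\ `|D + q * f x| <= 1].

Definition info (xi : seq V) (f : V -> R) (G : V -> V) : seq (R * V) :=
  [seq (f x, G x) | x <- xi].

Definition alg_error (q : R) (Om : set V) (xi : seq V)
  (phi : seq (R * V) -> V -> R) : \bar R :=
  ereal_sup [set e : \bar R | exists (f : V -> R) (G : V -> V) (x : V),
      W_class q Om f G /\ Om x /\ e = (`|f x - phi (info xi f G) x|)%:E].

Definition R_xi (q : R) (Om : set V) (xi : seq V) : \bar R :=
  ereal_inf [set alg_error q Om xi phi | phi in
     [set phi : seq (R * V) -> V -> R |
        forall I, {within Om, continuous (phi I)}]].

Definition R_n (q : R) (Om : set V) (n : nat) : \bar R :=
  ereal_inf [set R_xi q Om xi | xi in
     [set xi : seq V | (size xi <= n)%N /\ {subset xi <= Om}]].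

End Defs.

(* Main.v *)
(** Let h be the covering radius of the nodes.
    Upper bound: if f and g share their data on the nodes, F = (f - g)/2 and -F lie in the
    class, and the constraint |D^2 F + q F| <= 1 makes F + C|.|^2/2 and -F + C|.|^2/2 convex
    with C = 1 + |q| max|F|.  Let |F| be maximal at x, y a node within h of x and m the midpoint
    of [x, y].  Comparing m with x (an interior maximum) and with y (where F and its gradient
    vanish) gives |F(x)| <= C h^2/4.  At boundary points only the comparison with y is available,
    which costs a factor 2; covering a neighbourhood of the boundary with radius h/2 repairs this and
    takes only o(h^-d) extra nodes.  The Chebyshev centre of the set of functions with given data is then
    an almost optimal continuous reconstruction.
    Lower bound: if some point c of the body has distance > h to all nodes, the radial function
    with profile h^2/4 - r^2/2 for r <= h/2, (h - r)^2/2 for h/2 <= r <= h and 0 afterwards is,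
    after division by 1 + |q| h^2/4, in the class and has zero data.
    Counting: a convex body is h-covered by (kappa vol + o(1)) h^-d balls and not by fewer, where
    kappa is the covering constant of cubes, and Theta = nu kappa. *)

Require Import Defs.
From HB Require Import structures.
From mathcomp Require Import all_boot all_order all_algebra.
From mathcomp Require Import all_classical all_reals all_analysis.
From mathcomp Require Import measurable_realfun.
From mathcomp Require Import ring lra zify.
Import Order.TTheory GRing.Theory Num.Theory.
Import numFieldNormedType.Exports.
Set Implicit Arguments. Unset Strict Implicit. Unset Printing Implicit Defensive.
Local Open Scope classical_set_scope.
Local Open Scope ring_scope.

(** * The Euclidean norm and the box outer measure *)

(** The class controls second derivatives on almost every line only, and measure is the outer
    measure by boxes, so nothing is integrated over ['rV[R]_d]: averages over fine grids play the
    role of Fubini and produce, near any segment, a parallel one that meets the exceptional set in a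
    null set. Semiconvexity is proved there and reaches all segments of the body by continuity. The
    constant [C = 1 + |q| max|F|] contains the quantity to be bounded, so [max|F| <= C h^2/4] is
    solved for [max|F|]; the answer is [(h^2/4) / (1 - |q| h^2/4)], against
    [(h^2/4) / (1 + |q| h^2/4)] from the fooling function. Both are [h^2/4] to leading order, which
    is why [q] leaves no trace in the limit. Differentiability is known in the interior alone, hence
    the nodes are placed there. The profile of the fooling function is a combination of two Huber
    functions, whose gradients are projections onto balls; its smoothness then follows from
    convexity instead of a computation at the break points. Taking [h^d] a little above or below
    [kappa vol / n] turns the two covering estimates into the two bounds for [R_n]. *)

Section Euclid.
Variables (R : realType) (d : nat).
Implicit Types (x y z u v : 'rV[R]_d).

Lemma dotEC x y : dotE x y = dotE y x.
Proof. by apply: eq_bigr => i _; rewrite mulrC. Qed.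

Lemma dotEDl x y z : dotE (x + y) z = dotE x z + dotE y z.
Proof. by rewrite -big_split; apply: eq_bigr => i _; rewrite mxE mulrDl. Qed.

Lemma dotEZl (a : R) x y : dotE (a *: x) y = a * dotE x y.
Proof. by rewrite mulr_sumr; apply: eq_bigr => i _; rewrite mxE mulrA. Qed.

Lemma dotENl x y : dotE (- x) y = - dotE x y.
Proof. by rewrite -scaleN1r dotEZl mulN1r. Qed.

Lemma dotEBl x y z : dotE (x - y) z = dotE x z - dotE y z.
Proof. by rewrite dotEDl dotENl. Qed.

Lemma dotEDr x y z : dotE z (x + y) = dotE z x + dotE z y.
Proof. by rewrite !(dotEC z) dotEDl. Qed.

Lemma dotEZr (a : R) x y : dotE x (a *: y) = a * dotE x y.
Proof. by rewrite !(dotEC x) dotEZl. Qed.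

Lemma dotEBr x y z : dotE z (x - y) = dotE z x - dotE z y.
Proof. by rewrite !(dotEC z) dotEBl. Qed.

Lemma dotE0l x : dotE 0 x = 0.
Proof. by rewrite -(scale0r x) dotEZl mul0r. Qed.

Lemma dotE_ge0 x : 0 <= dotE x x.
Proof. by apply: sumr_ge0 => i _; rewrite -expr2 sqr_ge0. Qed.

Lemma enorm_ge0 x : 0 <= enorm x.
Proof. exact: sqrtr_ge0. Qed.

Lemma enorm_sqr x : enorm x ^+ 2 = dotE x x.
Proof. by rewrite sqr_sqrtr // dotE_ge0. Qed.

Lemma enorm_eq0 x : enorm x = 0 -> x = 0.
Proof.
move=> x0; have : dotE x x = 0 by rewrite -enorm_sqr x0 expr0n.
move=> /psumr_eq0P xx0; apply/rowP => i; rewrite mxE.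
by apply/eqP; rewrite -sqrf_eq0 expr2 xx0 // => j _; rewrite -expr2 sqr_ge0.
Qed.

Lemma enorm0 : enorm (0 : 'rV[R]_d) = 0.
Proof. by rewrite /enorm dotE0l sqrtr0. Qed.

Lemma enormZ (a : R) x : enorm (a *: x) = `|a| * enorm x.
Proof.
by rewrite /enorm dotEZl dotEZr mulrA -expr2 sqrtrM ?sqr_ge0// sqrtr_sqr.
Qed.

Lemma enormN x : enorm (- x) = enorm x.
Proof. by rewrite -scaleN1r enormZ normrN1 mul1r. Qed.

Lemma enormB x y : enorm (x - y) = enorm (y - x).
Proof. by rewrite -enormN opprB. Qed.

Lemma cauchy_schwarz x y : dotE x y <= enorm x * enorm y.
Proof.
have [y0|/eqP y0] := eqVneq (enorm y) 0.
  by rewrite y0 (enorm_eq0 y0) dotEC dotE0l mulr0.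
have yp : 0 < enorm y by rewrite lt_neqAle enorm_ge0 eq_sym; apply/andP; split => //; apply/eqP.
have [x0|/eqP x0] := eqVneq (enorm x) 0.
  by rewrite x0 (enorm_eq0 x0) dotE0l mul0r.
have xp : 0 < enorm x by rewrite lt_neqAle enorm_ge0 eq_sym; apply/andP; split => //; apply/eqP.
have := dotE_ge0 (enorm y *: x - enorm x *: y).
rewrite dotEBl !dotEBr !dotEZl !dotEZr -!enorm_sqr (dotEC y x).
set a := enorm x in xp *; set b := enorm y in yp *; set p := dotE x y => h.
have : 0 <= (2 * a * b) * (a * b - p) by lra.
by rewrite pmulr_rge0 ?subr_ge0// !mulr_gt0.
Qed.

Lemma enormD x y : enorm (x + y) <= enorm x + enorm y.
Proof.
rewrite -(@ler_pXn2r _ 2) ?nnegrE ?addr_ge0 ?enorm_ge0//.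
rewrite enorm_sqr dotEDl !dotEDr sqrrD !enorm_sqr (dotEC y x).
by have := cauchy_schwarz x y; lra.
Qed.

Lemma enorm_tri y x z : enorm (x - z) <= enorm (x - y) + enorm (y - z).
Proof. by have := enormD (x - y) (y - z); rewrite addrA subrK. Qed.

Lemma abs_dotE_le x y : `|dotE x y| <= enorm x * enorm y.
Proof.
rewrite ler_norml cauchy_schwarz andbT lerNl -dotENl.
by rewrite -(enormN x) cauchy_schwarz.
Qed.

Lemma coord_le_enorm x i : `|x 0 i| <= enorm x.
Proof.
rewrite -sqrtr_sqr ler_wsqrtr // /dotE (bigD1 i) //= -expr2 lerDl.
by apply: sumr_ge0 => j _; rewrite -expr2 sqr_ge0.
Qed.

Lemma enorm_le_coord x (c : R) : 0 <= c -> (forall i, `|x 0 i| <= c) ->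
  enorm x <= Num.sqrt d%:R * c.
Proof.
move=> c0 xc; have -> : Num.sqrt d%:R * c = Num.sqrt (d%:R * c ^+ 2).
  by rewrite sqrtrM ?ler0n// sqrtr_sqr ger0_norm.
apply: ler_wsqrtr.
rewrite mulr_natl -[X in _ *+ X]card_ord -sumr_const ler_sum // => i _.
by rewrite -expr2 -real_normK ?num_real// lerXn2r ?nnegrE.
Qed.

Lemma mx_norm_coord x i : `|x 0 i| <= `|x|.
Proof.
rewrite [leRHS]/Num.norm /= mx_normrE; apply/bigmax_geP; right => /=.
by exists (0, i).
Qed.

Lemma mx_norm_le_enorm x : `|x| <= enorm x.
Proof.
rewrite [leLHS]/Num.norm /= mx_normrE; apply/bigmax_leP; split.
  exact: enorm_ge0.
by move=> [i j] _ /=; rewrite (ord1 i) coord_le_enorm.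
Qed.

Lemma enorm_le_mx_norm x : enorm x <= Num.sqrt d%:R * `|x|.
Proof. by apply: enorm_le_coord => // i; exact: mx_norm_coord. Qed.

(** The topology of ['rV[R]_d] comes from the sup norm; [mx_norm_le_enorm] and [enorm_le_mx_norm]
    make Euclidean balls a basis of it. *)
Lemma nbhs_eball (x : 'rV[R]_d) (A : set 'rV[R]_d) :
  nbhs x A <-> exists2 r : R, 0 < r & eball x r `<=` A.
Proof.
split.
  move=> /nbhs_ballP[r /= r0 rA]; exists (r / 2); first by rewrite divr_gt0.
  move=> y yr; apply: rA; rewrite -ball_normE /ball_ /= distrC.
  apply: le_lt_trans (mx_norm_le_enorm _) _; apply: le_lt_trans yr _; lra.
move=> [r r0 rA]; apply/nbhs_ballP.
(* The [+ 1] keeps the divisor positive for [d = 0] as well. *)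
have s1 : 0 < Num.sqrt d%:R + 1 :> R by rewrite ltr_wpDl ?sqrtr_ge0.
exists (r / (Num.sqrt d%:R + 1)); first by rewrite /= divr_gt0.
move=> y; rewrite -ball_normE /ball_ /= distrC ltr_pdivlMr // => yr.
apply: rA; apply: le_trans (enorm_le_mx_norm _) _; apply: le_trans (ltW yr).
by rewrite mulrC ler_wpM2l ?lerDl.
Qed.

Lemma interior_eball (A : set 'rV[R]_d) x :
  interior A x <-> exists2 r : R, 0 < r & eball x r `<=` A.
Proof. exact: nbhs_eball. Qed.

Lemma eball_center x (r : R) : 0 <= r -> eball x r x.
Proof. by move=> r0; rewrite /eball /= subrr enorm0. Qed.

Lemma near_translate (A : set 'rV[R]_d) z w : nbhs (z + w) A ->
  \forall z' \near z, A (z' + w).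
Proof.
move=> /nbhs_eball[r r0 rA]; apply/nbhs_eball; exists r => // z' zr.
by apply: rA; rewrite /eball /= opprD addrACA subrr addr0.
Qed.

Lemma near_line (A : set 'rV[R]_d) z u (t : R) : nbhs (z + t *: u) A ->
  \forall s \near t, A (z + s *: u).
Proof.
move=> /nbhs_eball[r r0 rA]; apply/nbhs_ballP.
have u1 : 0 < enorm u + 1 by rewrite ltr_wpDl ?enorm_ge0.
exists (r / (enorm u + 1)); first by rewrite /= divr_gt0.
move=> s; rewrite -ball_normE /ball_ /= distrC ltr_pdivlMr // => sr; apply: rA.
rewrite /eball /= opprD addrACA subrr add0r -scalerBl enormZ.
by apply: le_trans (ltW sr); rewrite ler_wpM2l // lerDl.
Qed.

End Euclid.

(** * Covers by boxes with real-valued volume bounds *)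

Section BoxCover.
Variables (R : realType) (d : nat).
Implicit Types (x y z w : 'rV[R]_d) (A B : set 'rV[R]_d).

Lemma box_vol_ge0 x y : 0 <= box_vol x y.
Proof. by apply: prodr_ge0 => i _; rewrite le_max lexx. Qed.

(** A form of [leb_outer A <= v] with real partial sums only. The way back, [leb_boxcover], asks for
    a strict inequality because the infimum need not be attained. *)
Definition boxcover A (v : R) := exists a b : nat -> 'rV[R]_d,
  A `<=` \bigcup_k box (a k) (b k) /\
  forall n, \sum_(k < n) box_vol (a k) (b k) <= v.

Lemma boxcover_leb A v : boxcover A v -> (leb_outer A <= v%:E)%E.
Proof.
move=> [a [b [Aab abv]]]; apply: (@le_trans _ _ (\sum_(k <oo) (box_vol (a k) (b k))%:E)%E).
  by apply: ereal_inf_lbound; exists a, b.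
apply: lime_le.
  by apply: is_cvg_nneseries => n _ _; rewrite lee_fin box_vol_ge0.
by apply: nearW => n; rewrite big_mkord sumEFin lee_fin.
Qed.

Lemma leb_outer_ge0 A : (0 <= leb_outer A)%E.
Proof.
apply: le_ereal_inf_tmp => _ [a [b [_ ->]]].
by apply: nneseries_ge0 => n _ _; rewrite lee_fin box_vol_ge0.
Qed.

Lemma leb_boxcover A (v : R) : (leb_outer A < v%:E)%E -> boxcover A v.
Proof.
move=> /ereal_inf_lt[_ [a [b [Aab ->]]]] /ltW abv.
exists a, b; split => // n; rewrite -lee_fin; apply: le_trans abv.
rewrite -sumEFin -(big_mkord xpredT (fun k => (box_vol (a k) (b k))%:E)).
by apply: nneseries_lim_ge => k _ _; rewrite lee_fin box_vol_ge0.
Qed.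

Lemma leb_outerS A B : A `<=` B -> (leb_outer A <= leb_outer B)%E.
Proof.
move=> AB; apply: le_ereal_inf_tmp => _ [a [b [Bab ->]]].
by apply: ereal_inf_lbound; exists a, b; split => //; exact: subset_trans Bab.
Qed.

Lemma boxcoverS A B (v : R) : A `<=` B -> boxcover B v -> boxcover A v.
Proof.
by move=> AB [a [b [Bab abv]]]; exists a, b; split => //; exact: subset_trans Bab.
Qed.

Lemma boxcover_le A (v w : R) : v <= w -> boxcover A v -> boxcover A w.
Proof.
by move=> vw [a [b [Aab abv]]]; exists a, b; split => // n; exact: le_trans vw.
Qed.

Lemma boxcoverU A B (v w : R) : boxcover A v -> boxcover B w -> boxcover (A `|` B) (v + w).
Proof.
move=> [a [b [Aab abv]]] [a' [b' [Bab abw]]].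
pose i (T : Type) (f g : nat -> T) k := if odd k then g k./2 else f k./2.
exists (i _ a a'), (i _ b b'); split.
  move=> x [/Aab[k _ kx]|/Bab[k _ kx]].
    by exists k.*2 => //; rewrite /i odd_double doubleK.
  by exists k.*2.+1 => //; rewrite /i /= odd_double/= uphalf_double.
have sE n : \sum_(k < n.*2) box_vol (i _ a a' k) (i _ b b' k) =
    \sum_(k < n) box_vol (a k) (b k) + \sum_(k < n) box_vol (a' k) (b' k).
  elim: n => [|n IH]; first by rewrite !big_ord0 addr0.
  rewrite doubleS !big_ord_recr /= IH /i /= odd_double /= uphalf_double doubleK.
  by rewrite addrACA addrA.
(* The first [n] interleaved boxes are among the first [n.*2], which are [n] boxes of each cover. *)
move=> n; apply: (@le_trans _ _ (\sum_(k < n.*2) box_vol (i _ a a' k) (i _ b b' k))).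
  rewrite -!(big_mkord xpredT (fun k => box_vol (i _ a a' k) (i _ b b' k))).
  rewrite [leRHS](big_cat_nat (n := n)) //= ?lerDl; last by rewrite -addnn leq_addr.
  by apply: sumr_ge0 => k _; exact: box_vol_ge0.
by rewrite sE lerD.
Qed.

Hypothesis d0 : (0 < d)%N.

(** Finite covers are padded to sequences with degenerate boxes. For [d = 0] the empty product would
    give these volume 1, whence [0 < d]. *)
Lemma box_vol_diag x : box_vol x x = 0.
Proof. by rewrite /box_vol (bigD1 (Ordinal d0)) //= subrr maxxx mul0r. Qed.

Lemma boxcover_box x y : boxcover (box x y) (box_vol x y).
Proof.
exists (fun k => if k == 0%N then x else 0), (fun k => if k == 0%N then y else 0).
split; first by move=> z xyz; exists 0%N.
move=> [|n]; first by rewrite big_ord0 box_vol_ge0.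
rewrite big_ord_recl /= big1 ?addr0 // => i _; exact: box_vol_diag.
Qed.

Lemma boxcover_set0 : boxcover (set0 : set 'rV[R]_d) 0.
Proof.
exists (fun=> 0), (fun=> 0); split => // n.
by rewrite big1 // => i _; exact: box_vol_diag.
Qed.

Lemma boxcover_bigsetU (I : Type) (r : seq I) (P : pred I) (F : I -> set 'rV[R]_d)
    (v : I -> R) : (forall i, P i -> boxcover (F i) (v i)) ->
  boxcover (\big[setU/set0]_(i <- r | P i) F i) (\sum_(i <- r | P i) v i).
Proof.
move=> Fv; elim/big_ind2 : _ => //; first exact: boxcover_set0.
by move=> *; exact: boxcoverU.
Qed.

Lemma box_vol_affine (l : R) x y w : 0 < l ->
  box_vol (l *: x + w) (l *: y + w) = l ^+ d * box_vol x y.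
Proof.
move=> l0; rewrite -[in l ^+ d](card_ord d) -prodr_const -big_split /=.
apply: eq_bigr => i _; rewrite !mxE opprD addrACA subrr addr0 -mulrBr.
by rewrite -{1}(mulr0 l) -maxr_pMr// ltW.
Qed.

Lemma boxcover_affine A (l : R) w (v : R) : 0 < l -> boxcover A v ->
  boxcover [set l *: x + w | x in A] (l ^+ d * v).
Proof.
move=> l0 [a [b [Aab abv]]].
exists (fun k => l *: a k + w), (fun k => l *: b k + w); split.
  move=> _ [x /Aab[k _ kx] <-]; exists k => // i.
  by rewrite !mxE !lerD2r !ler_pM2l //; exact: kx.
move=> n; under eq_bigr do rewrite box_vol_affine //.
by rewrite -mulr_sumr ler_wpM2l // exprn_ge0 // ltW.
Qed.

(** [fine] sends infinity to 0, so the lemmas on [lebR] take some [boxcover A v] as a certificate of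
    finiteness. *)
Definition lebR A : R := fine (leb_outer A).

Lemma lebR_ge0 A : 0 <= lebR A.
Proof. exact/fine_ge0/leb_outer_ge0. Qed.

Lemma boxcover_fin A v : boxcover A v -> leb_outer A = (lebR A)%:E.
Proof.
move=> /boxcover_leb Av; rewrite fineK // ge0_fin_numE ?leb_outer_ge0//.
exact: le_lt_trans Av (ltry _).
Qed.

Lemma boxcover_lebR A (v e : R) : boxcover A v -> 0 < e -> boxcover A (lebR A + e).
Proof.
by move=> Av e0; apply: leb_boxcover; rewrite (boxcover_fin Av) lte_fin ltrDl.
Qed.

Lemma lebR_le A v : boxcover A v -> lebR A <= v.
Proof. by move=> Av; rewrite -lee_fin -(boxcover_fin Av) boxcover_leb. Qed.

Lemma lebRS A B v : boxcover B v -> A `<=` B -> lebR A <= lebR B.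
Proof.
move=> Bv AB; have Av := boxcoverS AB Bv.
by rewrite -lee_fin -(boxcover_fin Av) -(boxcover_fin Bv) leb_outerS.
Qed.

Lemma lebRU A B (v w : R) : boxcover A v -> boxcover B w ->
  lebR (A `|` B) <= lebR A + lebR B.
Proof.
move=> Av Bw; apply/ler_addgt0Pr => e e0; have e2 : 0 < e / 2 by rewrite divr_gt0.
apply: le_trans (lebR_le (boxcoverU (boxcover_lebR Av e2) (boxcover_lebR Bw e2))) _.
lra.
Qed.

Lemma lebR_affine_le A (l : R) w (v : R) : 0 < l -> boxcover A v ->
  lebR [set l *: x + w | x in A] <= l ^+ d * lebR A.
Proof.
move=> l0 Av; apply/ler_addgt0Pr => e e0.
have ld : 0 < l ^+ d by rewrite exprn_gt0.
apply: le_trans (lebR_le (boxcover_affine w l0 (boxcover_lebR Av (divr_gt0 e0 ld)))) _.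
by rewrite mulrDr mulrCA divff ?gt_eqF // mulr1.
Qed.

Lemma lebR_affine A (l : R) w (v : R) : 0 < l -> boxcover A v ->
  lebR [set l *: x + w | x in A] = l ^+ d * lebR A.
Proof.
move=> l0 Av; apply/eqP; rewrite eq_le (lebR_affine_le _ _ Av) //=.
(* The reverse inequality is the same estimate for the inverse affine map. *)
have := @lebR_affine_le _ l^-1 (- (l^-1 *: w)) _ _ (boxcover_affine w l0 Av).
rewrite invr_gt0 => /(_ l0).
have -> : [set l^-1 *: x - l^-1 *: w | x in [set l *: x + w | x in A]] = A.
  apply/seteqP; split => [_ [_ [x Ax <-] <-]|x Ax].
    by rewrite scalerDr addrK scalerA mulVf ?gt_eqF // scale1r.
  exists (l *: x + w); first by exists x.
  by rewrite scalerDr addrK scalerA mulVf ?gt_eqF // scale1r.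
by rewrite exprVn mulrC ler_pdivlMr ?exprn_gt0// mulrC.
Qed.

Lemma leb_nullP A : Defs.negligible A <-> forall e, 0 < e -> boxcover A e.
Proof.
split=> [A0 e e0|Ae]; first by apply: leb_boxcover; rewrite A0 lte_fin.
apply/eqP; rewrite eq_le leb_outer_ge0 andbT.
by apply/lee_addgt0Pr => e e0; rewrite add0e; exact/boxcover_leb/Ae.
Qed.

Lemma leb_null_subset A B : A `<=` B -> Defs.negligible B -> Defs.negligible A.
Proof. by move=> AB /leb_nullP Be; apply/leb_nullP => e /Be; exact: boxcoverS. Qed.

Lemma leb_null_setU A B : Defs.negligible A -> Defs.negligible B ->
  Defs.negligible (A `|` B).
Proof.
move=> /leb_nullP Ae /leb_nullP Be; apply/leb_nullP => e e0.
have e2 : 0 < e / 2 by rewrite divr_gt0.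
by rewrite (splitr e); apply: boxcoverU; [exact: Ae|exact: Be].
Qed.

End BoxCover.

(** * Grid averages and null sets on lines *)

Section GridCount.
Variables (R : realType).

Lemma near_right0_ex (P : R -> Prop) : (\forall e \near 0^'+, P e) ->
  exists2 e, 0 < e & forall x, 0 < x < e -> P x.
Proof.
move=> [e /= e0 eP]; exists e => // x /andP[x0 xe]; apply: eP => //=.
by rewrite sub0r normrN gtr0_norm.
Qed.

Lemma count_progression (P : nat) (c e a b : R) : 0 < e ->
  \sum_(j < P) ((a <= c + e * j%:R <= b)%R)%:R <= Num.max 0 (b - a) / e + 1 :> R.
Proof.
move=> e0.
have M0 : 0 <= Num.max 0 (b - a) / e by rewrite divr_ge0 ?le_max ?lexx // ltW.
set A := finset (fun j : 'I_P => a <= c + e * j%:R <= b).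
have -> : \sum_(j < P) ((a <= c + e * j%:R <= b)%R)%:R = #|A|%:R :> R.
  rewrite -sum1_card natr_sum [RHS]big_mkcond /=.
  by apply: eq_bigr => j _; rewrite inE; case: ifP.
have [->|/set0Pn[j1 j1A]] := eqVneq A finset.set0.
  by rewrite cards0 addr_ge0.
(* Counted from the first hit [j0], every hit has offset at most [K], the integer part of length
   over [e]; so there are at most [K.+1] hits. *)
case: (arg_minnP (fun j : 'I_P => val j) j1A) => j0 j0A jmin; have {}j0A : j0 \in A by [].
have /andP[] := truncn_itv M0; set K := Num.truncn _ => K0 K1.
suff AK : (#|A| <= K.+1)%N.
  by apply: le_trans (_ : K.+1%:R <= _); rewrite ?ler_nat// -natr1 lerD2r.
have jK (j : 'I_P) : j \in A -> (j - j0 < K.+1)%N.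
  move=> jA; rewrite -(ltr_nat R); apply: le_lt_trans K1.
  rewrite ler_pdivlMr // le_max natrB ?jmin //.
  move: jA j0A; rewrite !inE => /andP [_ jb] /andP [ja _].
  apply/orP; right; lra.
rewrite -(card_ord K.+1) -(@card_in_imset _ _ (fun j : 'I_P => inord (j - j0) : 'I_K.+1) A).
  exact: max_card.
move=> j j' jA j'A /(congr1 val) /=; rewrite !inordK ?jK // => jj'.
by apply/val_inj => /=; rewrite -(subnK (jmin _ jA)) jj' subnK ?jmin.
Qed.

Variable d : nat.
Implicit Types (x y z a b : 'rV[R]_d).

Definition gridpt z (e : R) P (j : {ffun 'I_d -> 'I_P}) : 'rV[R]_d :=
  \row_i (z 0 i + e * (j i)%:R).

Lemma grid_count P z (e : R) a b : 0 < e ->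
  \sum_(j : {ffun 'I_d -> 'I_P}) (`[< box a b (gridpt z e j) >])%:R <=
  \prod_i (Num.max 0 (b 0 i - a 0 i) / e + 1).
Proof.
move=> e0.
have -> : \sum_(j : {ffun 'I_d -> 'I_P}) (`[< box a b (gridpt z e j) >])%:R =
  \prod_(i < d) \sum_(j < P) ((a 0 i <= z 0 i + e * j%:R <= b 0 i)%R)%:R :> R.
  rewrite bigA_distr_bigA /=; apply: eq_bigr => j _.
  have -> : `[< box a b (gridpt z e j) >] = [forall i, a 0 i <= gridpt z e j 0 i <= b 0 i].
    by apply/idP/idP => [/asboolP h|/forallP h]; [apply/forallP|apply/asboolP] => i;
      exact: h.
  case: (boolP [forall i, a 0 i <= gridpt z e j 0 i <= b 0 i]) => [/forallP abj|/forallPn[i nabj]].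
    by rewrite big1 // => i _; have := abj i; rewrite mxE => ->.
  by move: nabj; rewrite mxE (bigD1 i) //= => /negbTE ->; rewrite mul0r.
apply: ler_prod => i _; rewrite sumr_ge0 /=; last by move=> *; rewrite ler0n.
exact: count_progression.
Qed.

(** [e ^+ d] times the count bound of [grid_count]: the [+ 1] in each direction becomes a
    lengthening of the side by [e]. *)
Definition fat_vol (e : R) a b := \prod_(i < d) (Num.max 0 (b 0 i - a 0 i) + e).

(** Being a polynomial in [e], [fat_vol] tends to its value [box_vol] at 0. *)
Lemma fat_volE e a b : fat_vol e a b =
  (\prod_(i < d) ((Num.max 0 (b 0 i - a 0 i))%:P + 'X)).[e].
Proof. by rewrite horner_prod; apply: eq_bigr => i _; rewrite !hornerE. Qed.

Lemma fat_vol0 a b : fat_vol 0 a b = box_vol a b.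
Proof. by apply: eq_bigr => i _; rewrite addr0. Qed.

Lemma fat_vol_near (I : Type) (r : seq I) (a b : I -> 'rV[R]_d) (eta : R) : 0 < eta ->
  \forall e \near 0^'+, \sum_(k <- r) fat_vol e (a k) (b k) <=
    \sum_(k <- r) box_vol (a k) (b k) + eta.
Proof.
move=> eta0.
pose p k := \prod_(i < d) ((Num.max 0 (b k 0 i - a k 0 i))%:P + 'X).
have c : (fun e => \sum_(k <- r) fat_vol e (a k) (b k)) @ 0^'+ -->
    \sum_(k <- r) box_vol (a k) (b k).
  have pE t : \sum_(k <- r) fat_vol t (a k) (b k) = (\sum_(k <- r) p k).[t].
    by rewrite horner_sum; apply: eq_bigr => k _; exact: fat_volE.
  under eq_bigr do rewrite -fat_vol0.
  rewrite pE (funext pE); apply: cvg_at_right_filter; exact: continuous_horner.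
have /cvgrPdist_le/(_ _ eta0) := c; apply: filterS => e.
by rewrite distrC => /ler_normlW; lra.
Qed.

(** With mesh [L / P] the grid fills a cube of side [L], and the left side is a Riemann sum for the
    fraction of that cube inside the box. *)
Lemma grid_average P z (L : R) a b : (0 < P)%N -> 0 < L ->
  (P%:R ^- d) * \sum_(j : {ffun 'I_d -> 'I_P})
     (`[< box a b (gridpt z (L / P%:R) j) >])%:R <=
  L ^- d * fat_vol (L / P%:R) a b.
Proof.
move=> P0 L0; have Pp : 0 < P%:R :> R by rewrite ltr0n.
have e0 : 0 < L / P%:R by rewrite divr_gt0.
rewrite ler_pdivrMl ?exprn_gt0//.
apply: le_trans (grid_count _ _ _ _ e0) _.
rewrite mulrA -expr_div_n -{7}(card_ord d) -prodr_const /fat_vol -big_split /=.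
apply: ler_prod => i _.
have m0 : 0 <= Num.max 0 (b 0 i - a 0 i) by rewrite le_max lexx.
apply/andP; split; first by rewrite addr_ge0 ?divr_ge0 // ltW.
suff -> : Num.max 0 (b 0 i - a 0 i) / (L / P%:R) + 1 =
  P%:R / L * (Num.max 0 (b 0 i - a 0 i) + L / P%:R) by [].
by field; rewrite !gt_eqF.
Qed.

(* Averages over the finitely many points of a grid replace integrals over
   'rV[R]_d, for which only the outer measure [leb_outer] is at hand. *)
Lemma grid_average_near (I : Type) (r : seq I) (a b : I -> 'rV[R]_d) (L eta : R) :
  0 < L -> 0 < eta -> exists2 P : nat, (0 < P)%N & forall z (w : 'rV[R]_d),
  (P%:R ^- d) * \sum_(k <- r) \sum_(j : {ffun 'I_d -> 'I_P})
     (`[< box (a k - w) (b k - w) (gridpt z (L / P%:R) j) >])%:R <=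
  L ^- d * (\sum_(k <- r) box_vol (a k) (b k) + eta).
Proof.
move=> L0 eta0.
have [e e0 he] := near_right0_ex (fat_vol_near r a b eta0).
have [P] : exists P : nat, L / e < P%:R.
  by exists (Num.truncn (L / e)).+1; exact: truncnS_gt.
have Le0 : 0 < L / e by rewrite divr_gt0.
move=> LP; have Pp : 0 < P%:R :> R by exact: lt_trans LP.
have P0 : (0 < P)%N by rewrite -(ltr0n R).
exists P => // z w; rewrite mulr_sumr.
apply: (@le_trans _ _ (L ^- d * \sum_(k <- r) fat_vol (L / P%:R) (a k) (b k))).
  rewrite mulr_sumr; apply: ler_sum => k _.
  apply: le_trans (grid_average _ _ _ P0 L0) _.
  (* Only side lengths enter the bound, so one [P] serves all translates [w]. *)
  rewrite /fat_vol; under eq_bigr do rewrite !mxE opprB addrA subrK.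
  exact: lexx.
rewrite ler_wpM2l ?invr_ge0 ?exprn_ge0 //; first exact: ltW.
have /= hLP := he (L / P%:R).
apply: hLP; rewrite divr_gt0 //=.
by rewrite ltr_pdivrMr // mulrC -ltr_pdivrMr.
Qed.

End GridCount.

Section Slices.
Variables (R : realType).

Lemma nested_compact (T : ptopologicalType) (K : set T) (F : nat -> set T) :
  compact K -> (forall n, closed (F n)) -> (forall n m, (n <= m)%N -> F m `<=` F n) ->
  (forall n, exists2 x, K x & F n x) -> exists2 x, K x & forall n, F n x.
Proof.
move=> cK cF dF KF.
have /choice[u uP] n : exists x, K x /\ F n x by have [x] := KF n; exists x.
have [x [Kx clx]] : K `&` cluster (u n @[n --> \oo]) !=set0.
  apply: (cK (u n @[n --> \oo]) (fmap_proper_filter u _)).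
  by exists 0%N => // n _; have [] := uP n.
exists x => // n; apply: cF => B Bx.
have [] := clx (F n) B _ Bx; last by move=> y [Fy By]; exists y.
by exists n => // m /= nm; apply: dF nm _ _; have [] := uP m.
Qed.

Lemma closed_lsc (T : topologicalType) (f : T -> R) (c : R) :
  (forall z delta, 0 < delta -> \forall z' \near z, f z <= f z' + delta) ->
  closed [set z | f z <= c].
Proof.
move=> lsc; rewrite -openC.
have -> : ~` [set z | f z <= c] = [set z | c < f z].
  by apply/seteqP; split => z /=; rewrite ltNge => /negP.
rewrite openE => z /= cz.
have dz : 0 < (f z - c) / 2 by rewrite divr_gt0 // subr_gt0.
apply: filterS (lsc z _ dz) => z' /=; lra.
Qed.

Lemma lsc_sum (T : topologicalType) (I : Type) (r : seq I) (f : I -> T -> R) :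
  (forall i z delta, 0 < delta -> \forall z' \near z, f i z <= f i z' + delta) ->
  forall z delta, 0 < delta ->
    \forall z' \near z, \sum_(i <- r) f i z <= \sum_(i <- r) f i z' + delta.
Proof.
move=> lsc z; elim: r => [|i r IH] delta delta0.
  by apply: nearW => z'; rewrite !big_nil add0r ltW.
have d2 : 0 < delta / 2 by rewrite divr_gt0.
apply: filterS2 (lsc i z _ d2) (IH _ d2) => z'; rewrite !big_cons; lra.
Qed.

Variable d : nat.
Implicit Types (x y z u a b : 'rV[R]_d).

Definition obox a b : set 'rV[R]_d := [set x | forall i, a 0 i < x 0 i < b 0 i].

Lemma obox_near a b x : obox a b x -> \forall y \near x, obox a b y.
Proof.
move=> abx.
apply: (@filter_forall _ _ (fun i (y : 'rV[R]_d) => a 0 i < y 0 i < b 0 i) (nbhs x) _) => i.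
apply: (@coord_continuous R 1 d 0 i x [set t | a 0 i < t < b 0 i]).
by apply: near_in_itvoo; rewrite in_itv /= abx.
Qed.

Lemma obox_sub a b : obox a b `<=` box a b.
Proof. by move=> x abx i; have /andP[/ltW-> /ltW->] := abx i. Qed.

Lemma compact_box a b : compact (box a b).
Proof.
have -> : box a b = [set v | forall i, `[a 0 i, b 0 i]%classic (v ord0 i)].
  by apply/seteqP; split => x xab i; have := xab i; rewrite /= in_itv.
apply: (@rV_compact _ _ (fun i => `[a 0 i, b 0 i]%classic)) => i.
exact: segment_compact.
Qed.

Lemma fatten_box (a b : nat -> 'rV[R]_d) (eta : R) : 0 < eta ->
  exists a' b' : nat -> 'rV[R]_d, (forall k, box (a k) (b k) `<=` obox (a' k) (b' k)) /\
  forall n, \sum_(k < n) box_vol (a' k) (b' k) <= \sum_(k < n) box_vol (a k) (b k) + eta.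
Proof.
move=> eta0.
have ek k : exists e : R, 0 < e /\ box_vol (a k - const_mx e) (b k + const_mx e) <=
    box_vol (a k) (b k) + eta / 2 ^+ k.+1.
  have ek0 : 0 < eta / 2 ^+ k.+1 by rewrite divr_gt0 // exprn_gt0.
  have [e e0 he] := near_right0_ex (fat_vol_near [:: tt] (fun=> a k) (fun=> b k) ek0).
  (* Moving both faces by [e / 4] lengthens each side by [e / 2], which is strictly inside the range
     where [he] applies. *)
  exists (e / 4); split; first by rewrite divr_gt0.
  have e2 : 0 < e / 2 < e by apply/andP; split; lra.
  have := he (e / 2) e2; rewrite !big_seq1; apply: le_trans.
  apply: ler_prod => i _; rewrite le_max lexx /= !mxE ge_max.
  have : b k 0 i - a k 0 i <= Num.max 0 (b k 0 i - a k 0 i) by rewrite le_max lexx orbT.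
  have : 0 <= Num.max 0 (b k 0 i - a k 0 i) by rewrite le_max lexx.
  by move=> *; apply/andP; split; lra.
have [e eP] := choice ek.
exists (fun k => a k - const_mx (e k)), (fun k => b k + const_mx (e k)); split.
  move=> k x xab i; have [e0 _] := eP k; have /andP[] := xab i; rewrite !mxE => *.
  by apply/andP; split; lra.
have geo n : \sum_(k < n) eta / 2 ^+ k.+1 = eta * (1 - (2 ^+ n)^-1).
  elim: n => [|n IH]; first by rewrite big_ord0 expr0 invr1 subrr mulr0.
  by rewrite big_ord_recr /= IH exprS; field; rewrite expf_neq0 // pnatr_eq0.
move=> n; apply: le_trans (_ : \sum_(k < n) (box_vol (a k) (b k) + eta / 2 ^+ k.+1) <= _).
  by apply: ler_sum => k _; have [] := eP k.
rewrite big_split /= lerD2l geo ger_pMr // gerBl invr_ge0 exprn_ge0 //.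
Qed.

Lemma gridpt_box z (L : R) P (j : {ffun 'I_d -> 'I_P}) : 0 <= L -> (0 < P)%N ->
  box z (z + const_mx L) (gridpt z (L / P%:R) j).
Proof.
move=> L0 P0 i; rewrite !mxE lerD2l lerDl mulr_ge0 ?divr_ge0 ?ler0n //=.
rewrite mulrAC ler_pdivrMr ?ltr0n // ler_wpM2l // ler_nat ltnW //.
Qed.

(** After fattening to open boxes, finitely many cover the cube by compactness; counting grid points
    then compares volumes. All lower bounds on [leb_outer] rest on this one. *)
Lemma cube_le_boxcover z (L v : R) : 0 < L ->
  boxcover (box z (z + const_mx L)) v -> L ^+ d <= v.
Proof.
move=> L0 [a0 [b0 [Qab0 ab0v]]]; rewrite leNgt; apply/negP => vL.
(* [eta0] is lost twice, in fattening and in the grid average, and [v + 2 * eta0] is still below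
   [L ^+ d]. *)
have eta0 : 0 < (L ^+ d - v) / 4 by rewrite divr_gt0 // subr_gt0.
have [a [b [ab0 abv]]] := fatten_box a0 b0 eta0.
pose F n := ~` (\bigcup_(k in `I_n) obox (a k) (b k)).
have [||n m nm x Fx [k /= kn abx]|n|x Qx Fx] := @nested_compact _ (box z (z + const_mx L)) F.
- exact: compact_box.
- move=> n; rewrite closedC; apply: bigcup_open => k _; rewrite openE => x.
  exact: obox_near.
- by apply: Fx; exists k => //=; exact: leq_trans nm.
(* Here the first [n] open boxes cover the cube, so each of the [P ^ d] grid points is counted at
   least once, while their average is below 1. *)
- apply: contrapT => nF.
  have Qn x : box z (z + const_mx L) x -> exists2 k, (k < n)%N & box (a k) (b k) x.
    move=> Qx; apply: contrapT => nk; apply: nF; exists x => // -[k /= kn abx].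
    by apply: nk; exists k => //; exact: obox_sub.
  have [P P0 /(_ z 0)] := grid_average_near (index_enum 'I_n) a b L0 eta0.
  apply/negP; rewrite -ltNge.
  apply: (@lt_le_trans _ _ 1).
    rewrite ltr_pdivrMl ?exprn_gt0 // mulr1.
    have := abv n; have := ab0v n; lra.
  rewrite exchange_big /= -ler_pdivrMl ?invr_gt0 ?exprn_gt0 ?ltr0n // invrK mulr1.
  have -> : P%:R ^+ d = \sum_(j : {ffun 'I_d -> 'I_P}) 1 :> R.
    by rewrite sumr_const card_ffun !card_ord natrX.
  apply: ler_sum => j _.
  have [k kn kx] := Qn _ (gridpt_box z j (ltW L0) P0).
  rewrite (bigD1 (Ordinal kn)) //= !subr0.
  rewrite (introT (asboolP _) kx) lerDl.
  by apply: sumr_ge0 => *; rewrite ler0n.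
- have [k _ xk] := Qab0 x Qx; apply: (Fx k.+1); exists k => //=.
  exact: ab0.
Qed.

End Slices.

(** * Null sets on parallel segments *)

Section NullSlices.
Variables (R : realType) (d : nat) (u : 'rV[R]_d) (L : R).
Hypothesis L0 : 0 < L.
Implicit Types (x y z a b : 'rV[R]_d).
Notation mu := (@lebesgue_measure R).

(** The open window exceeds [[0, L]] on both sides: slices become open sets of finite length that
    still contain every parameter of interest. *)
Definition slice a b z : set R := [set t | -1 < t < L + 1 /\ obox a b (z + t *: u)].

Definition slen a b z : R := fine (mu (slice a b z)).

Lemma slice_interval a b z : is_interval (slice a b z).
Proof.
move=> s t [/andP[s1 s2] sab] [/andP[t1 t2] tab] r /andP[sr rt]; split.
  by apply/andP; split; lra.
move=> i; have /andP[sa sb] := sab i; have /andP[ta tb] := tab i.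
move: sa sb ta tb; rewrite !mxE => sa sb ta tb.
have [u0|u0] := leP 0 (u 0 i).
  have h1 : s * u 0 i <= r * u 0 i by rewrite ler_wpM2r.
  have h2 : r * u 0 i <= t * u 0 i by rewrite ler_wpM2r.
  by apply/andP; split; lra.
have h1 : r * u 0 i <= s * u 0 i by rewrite ler_wnM2r // ltW.
have h2 : t * u 0 i <= r * u 0 i by rewrite ler_wnM2r // ltW.
by apply/andP; split; lra.
Qed.

Lemma slice_measurable a b z : measurable (slice a b z).
Proof. by apply: is_interval_measurable; exact: slice_interval. Qed.

Lemma mu_itvoo : mu `]-1, L + 1[%classic = (L + 2)%:E.
Proof.
rewrite lebesgue_measure_itv /= lte_fin ifT; last by have := L0; lra.
by rewrite -EFinB; congr EFin; lra.
Qed.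

Lemma slice_sub a b z : slice a b z `<=` `]-1, L + 1[%classic.
Proof. by move=> t [tL _]; rewrite /= in_itv. Qed.

Lemma slenE a b z : mu (slice a b z) = (slen a b z)%:E.
Proof.
rewrite fineK // ge0_fin_numE //; apply: (@le_lt_trans _ _ (L + 2)%:E); last exact: ltry.
rewrite -mu_itvoo; apply: le_measure; rewrite ?inE //; first exact: slice_measurable.
exact: slice_sub.
Qed.

Lemma slen_ge0 a b z : 0 <= slen a b z.
Proof. exact/fine_ge0. Qed.

Lemma mu_itvcc (s t : R) : s <= t -> mu `[s, t]%classic = (t - s)%:E.
Proof.
rewrite lebesgue_measure_itv /= lte_fin le_eqVlt => /predU1P[->|->] //.
by rewrite ltxx subrr.
Qed.

Lemma slen_ge a b z s t : slice a b z s -> slice a b z t -> s <= t ->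
  t - s <= slen a b z.
Proof.
move=> sz tz st; rewrite -lee_fin -slenE -mu_itvcc //.
apply: le_measure; rewrite ?inE; [exact: measurable_itv|exact: slice_measurable|].
move=> r; rewrite /= in_itv /=; exact: (slice_interval sz tz).
Qed.

Lemma slice_near a b z t : slice a b z t -> \forall z' \near z, slice a b z' t.
Proof.
move=> [tL tab].
have h := @near_translate R d (obox a b) z (t *: u) (obox_near tab).
by apply: filterS h => z' ?; split.
Qed.

(** Two parameters close to the ends of the slice at [z] stay in the slice at nearby [z'], which is
    an interval and so contains all that lies between them. *)
Lemma slen_lsc a b z delta : 0 < delta ->
  \forall z' \near z, slen a b z <= slen a b z' + delta.
Proof.
move=> d0; have [E0|/set0P E0] := eqVneq (slice a b z) set0.
  apply/nbhs_eball; exists 1 => // z' _ /=; rewrite {1}/slen E0 measure0 /=.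
  by rewrite addr_ge0 ?slen_ge0 // ltW.
have bl : has_lbound (slice a b z) by exists (-1) => t [/andP[/ltW]].
have bu : has_ubound (slice a b z) by exists (L + 1) => t [/andP[_ /ltW]].
have d2 : 0 < delta / 2 by rewrite divr_gt0.
have [s sz si] := inf_adherent d2 (conj E0 bl).
have [t tz ts] := sup_adherent d2 (conj E0 bu).
have iz : inf (slice a b z) <= sup (slice a b z).
  by case: E0 => r rz; apply: le_trans (ge_inf bl rz) (ub_le_sup bu rz).
have zis : slen a b z <= sup (slice a b z) - inf (slice a b z).
  rewrite -lee_fin -slenE -mu_itvcc //; apply: le_measure; rewrite ?inE.
  - exact: slice_measurable.
  - exact: measurable_itv.
  - by move=> r rz; rewrite /= in_itv /= (ge_inf bl rz) (ub_le_sup bu rz).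
apply: filterS2 (slice_near sz) (slice_near tz) => z' sz' tz'.
have [ts'|st'] := ltP t s; first by have := slen_ge0 a b z'; lra.
by have := slen_ge sz' tz' st'; lra.
Qed.

(** Sum over the grid and integral over [t] are exchanged: for fixed [t] the boxes shifted by
    [t *: u] obey the grid average bound, and [L + 2] is the length of the window. *)
Lemma slen_average (I : Type) (r : seq I) (a b : I -> 'rV[R]_d) (rho eta : R) :
  0 < rho -> 0 < eta -> exists2 P : nat, (0 < P)%N & forall z,
  \sum_(j : {ffun 'I_d -> 'I_P})
     \sum_(k <- r) slen (a k) (b k) (gridpt z (rho / P%:R) j) <=
  P%:R ^+ d * (rho ^- d * (\sum_(k <- r) box_vol (a k) (b k) + eta) * (L + 2)).
Proof.
move=> rho0 eta0; have [P P0 hP] := grid_average_near r a b rho0 eta0.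
exists P => // z; rewrite mulrA -lee_fin.
have slI (j : {ffun 'I_d -> 'I_P}) k : (slen (a k) (b k) (gridpt z (rho / P%:R) j))%:E =
    (\int[mu]_(t in `](-1)%R, (L + 1)%R[) (\1_(slice (a k) (b k) (gridpt z (rho / P%:R) j)) t)%:E)%E.
  rewrite integral_indic //; last exact: slice_measurable.
  rewrite setIidl; [exact/esym/slenE | exact: slice_sub].
have mI (j : {ffun 'I_d -> 'I_P}) k : measurable_fun `]-1, L + 1[%classic
    (fun t => (\1_(slice (a k) (b k) (gridpt z (rho / P%:R) j)) t)%:E).
  by apply/measurable_EFinP; apply: measurable_indic; exact: slice_measurable.
pose f (j : {ffun 'I_d -> 'I_P}) (t : R) : \bar R :=
  (\sum_(k <- r) (\1_(slice (a k) (b k) (gridpt z (rho / P%:R) j)) t)%:E)%E.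
have mf j : measurable_fun `]-1, L + 1[%classic (f j).
  by apply: emeasurable_sum => k; exact: mI.
have f0 j t : (0 <= f j t)%E by apply: sume_ge0 => k _; rewrite lee_fin.
have -> : (\sum_(j : {ffun 'I_d -> 'I_P}) \sum_(k <- r) slen (a k) (b k) (gridpt z (rho / P%:R) j))%:E =
    (\int[mu]_(t in `](-1)%R, (L + 1)%R[) \sum_j f j t)%E.
  rewrite ge0_integral_sum //.
  rewrite -sumEFin; apply: eq_bigr => j _.
  rewrite -sumEFin /f ge0_integral_sum //.
  - by apply: eq_bigr => k _; exact: slI.
  - by move=> k; exact: mI.
rewrite EFinM -mu_itvoo -integral_cst //.
apply: ge0_le_integral => //.
- by move=> t Wt; apply: sume_ge0.
- by apply: emeasurable_sum.
move=> t Wt /=; rewrite /f; under eq_bigr do rewrite sumEFin.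
rewrite sumEFin lee_fin -ler_pdivrMl ?exprn_gt0 ?ltr0n //.
apply: le_trans (hP z (t *: u)); rewrite ler_wpM2l ?invr_ge0 ?exprn_ge0 ?ler0n //.
rewrite exchange_big; apply: ler_sum => k _; apply: ler_sum => j _.
rewrite indicE ler_nat; have [|//] := boolP (_ \in _).
rewrite inE => -[_ tab]; rewrite (introT (asboolP _)) // => i.
have /andP[] := tab i; rewrite !mxE => *; apply/andP; split; lra.
Qed.

(* A substitute for Fubini: the open boxes covering N meet the segments z + [0, L] u,
   z in a small cube, in a total length bounded on average; the lengths are lower
   semicontinuous in z, so a compactness argument yields one z that works for all covers. *)
Lemma null_slice (N : set 'rV[R]_d) z0 (rho : R) : 0 < rho -> Defs.negligible N ->
  exists2 z, box z0 (z0 + const_mx rho) z & forall delta, 0 < delta ->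
    exists U : set R, [/\ open U, forall t, 0 <= t <= L -> N (z + t *: u) -> U t &
      (mu U <= delta%:E)%E].
Proof.
move=> rho0 N0.
have h2 (j : nat) : 0 < 2^-1 ^+ j.+1 :> R by rewrite exprn_gt0.
(* The cover with index [j] has volume at most [2^-j], so that all covers together have volume at
   most 2. *)
have abj (j : nat) : exists ab : (nat -> 'rV[R]_d) * (nat -> 'rV[R]_d),
    N `<=` \bigcup_k obox (ab.1 k) (ab.2 k) /\
    forall n, \sum_(k < n) box_vol (ab.1 k) (ab.2 k) <= 2 * 2^-1 ^+ j.+1.
  have [|a [b [Nab abv]]] := @leb_boxcover _ _ N (2^-1 ^+ j.+1).
    by rewrite N0 lte_fin.
  have [a' [b' [aa' abv']]] := fatten_box a b (h2 j).
  exists (a', b'); split => [x /Nab[k _ /aa']|n]; first by exists k.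
  by have := abv n; have := abv' n; lra.
have {abj}[ab abP] := choice abj.
pose a j k := (ab j).1 k; pose b j k := (ab j).2 k.
(* Truncating both the covers and their boxes at [n] gives finite sums, whose sublevel sets are
   closed. *)
pose S n z := \sum_(j < n) \sum_(k < n) slen (a j k) (b j k) z.
(* The bound of [slen_average] for total volume 2 and [eta = 1]. *)
pose c := rho ^- d * (2 + 1) * (L + 2).
have geo n : \sum_(j < n) (2 * 2^-1 ^+ j.+1) <= 2 :> R.
  have -> : \sum_(j < n) (2 * 2^-1 ^+ j.+1) = 2 * (1 - 2^-1 ^+ n) :> R.
    elim: n => [|n IH]; first by rewrite big_ord0 expr0 subrr mulr0.
    by rewrite big_ord_recr /= IH exprS; lra.
  have : 0 <= 2^-1 ^+ n :> R by rewrite exprn_ge0.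
  lra.
have Smono n m z : (n <= m)%N -> S n z <= S m z.
  move=> nm; rewrite /S.
  apply: (@le_trans _ _ (\sum_(j < n) \sum_(k < m) slen (a j k) (b j k) z)).
    apply: ler_sum => j _.
    rewrite -!(big_mkord xpredT (fun k => slen (a j k) (b j k) z)).
    by rewrite [leRHS](big_cat_nat (n := n)) //= lerDl sumr_ge0 // => *; exact: slen_ge0.
  rewrite -!(big_mkord xpredT (fun j => \sum_(k < m) slen (a j k) (b j k) z)).
  rewrite [leRHS](big_cat_nat (n := n)) //= lerDl sumr_ge0 // => *.
  by rewrite sumr_ge0 // => *; exact: slen_ge0.
have [||n m nm z /=|n|z Qz Fz] := @nested_compact _ (box z0 (z0 + const_mx rho))
    (fun n => [set z | S n z <= c]).
- exact: compact_box.
- move=> n; apply: closed_lsc; apply: lsc_sum => j; apply: lsc_sum => k.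
  by move=> z delta; exact: slen_lsc.
- by move=> /(le_trans _); apply; exact: Smono.
- pose r := index_enum ('I_n * 'I_n)%type.
  have [P P0 /(_ z0) hP] := slen_average r (fun p => a p.1 p.2) (fun p => b p.1 p.2) rho0 ltr01.
  have [j jc] : exists j : {ffun 'I_d -> 'I_P}, S n (gridpt z0 (rho / P%:R) j) <= c.
    apply: contrapT => /forallNP nj.
    move: hP; apply/negP; rewrite -ltNge.
    apply: (@le_lt_trans _ _ (P%:R ^+ d * c)).
      rewrite ler_wpM2l ?exprn_ge0 ?ler0n // /c ler_wpM2r //.
        by have := L0; lra.
      rewrite ler_wpM2l ?invr_ge0 ?exprn_ge0 ?(ltW rho0) // lerD2r.
      rewrite /r -(pair_bigA _ (fun j k : 'I_n => box_vol (a j k) (b j k))) /=.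
      apply: le_trans (geo n); apply: ler_sum => j _; exact: (abP j).2.
    have -> : P%:R ^+ d * c = \sum_(j : {ffun 'I_d -> 'I_P}) c.
      by rewrite sumr_const card_ffun !card_ord -natrX mulr_natl.
    apply: ltr_sum => [|j _].
      have j0 : {ffun 'I_d -> 'I_P} by exact: [ffun=> Ordinal P0].
      by rewrite /= has_predT /index_enum -enumT -cardE; apply/card_gt0P; exists j0.
    rewrite /r -(pair_bigA _ (fun l k : 'I_n =>
      slen (a l k) (b l k) (gridpt z0 (rho / P%:R) j))) /=.
    by rewrite ltNge; apply/negP; exact: nj.
  exists (gridpt z0 (rho / P%:R) j) => //.
  by apply: gridpt_box => //; exact: ltW.
exists z => // delta delta0.
(* If every cover had slice length above [delta] at [z], more than [c / delta] of them would violate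
   [S n z <= c]. *)
have [j jd] : exists j, forall m, \sum_(k < m) slen (a j k) (b j k) z <= delta.
  apply: contrapT => /forallNP nj.
  have /choice[m mP] j : exists m, delta < \sum_(k < m) slen (a j k) (b j k) z.
    apply: contrapT => /forallNP h; apply: (nj j) => m.
    by rewrite leNgt; apply/negP; exact: h.
  have [J Jc] : exists J : nat, c / delta < J%:R.
    by exists (Num.truncn (c / delta)).+1; exact: truncnS_gt.
  pose n := maxn J (\max_(j < J) m j).
  have := Fz n => /=; apply/negP; rewrite -ltNge.
  apply: (@lt_le_trans _ _ (\sum_(j < J) delta)).
    by rewrite sumr_const card_ord -mulr_natl -ltr_pdivrMr.
  rewrite /S -!(big_mkord xpredT (fun j => \sum_(k < n) slen (a j k) (b j k) z)).
  rewrite [leRHS](big_cat_nat (n := J)) //=; last by rewrite leq_maxl.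
  rewrite -[leLHS]addr0 lerD //.
    rewrite big_mkord; apply: ler_sum => l _; apply: le_trans (ltW (mP l)) _.
    rewrite -!(big_mkord xpredT (fun k => slen (a l k) (b l k) z)).
    rewrite [leRHS](big_cat_nat (n := m l)) //= ?lerDl.
      by rewrite sumr_ge0 // => *; exact: slen_ge0.
    by rewrite /n leq_max (leq_bigmax l) orbT.
  by rewrite sumr_ge0 // => *; rewrite sumr_ge0 // => *; exact: slen_ge0.
have oS k : open (slice (a j k) (b j k) z).
  rewrite openE => t [tL tab]; apply: filterI.
    have := @near_in_itvoo R (-1) (L + 1) t; rewrite in_itv /= => /(_ tL).
    by apply: filterS => s; rewrite in_itv.
  by apply: (@near_line R d (obox (a j k) (b j k))); exact: obox_near.
exists (\bigcup_k slice (a j k) (b j k) z); split.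
- by apply: bigcup_open.
- move=> t /andP[t0 tL] /(abP j).1[k _ kt]; exists k => //; split => //.
  by apply/andP; split; lra.
- apply: le_trans (measure_sigma_subadditive mu (F := fun k => slice (a j k) (b j k) z) _ _ _) _.
  + by move=> k; exact: slice_measurable.
  + by apply: open_measurable; exact: bigcup_open.
  + by [].
  + apply: lime_le; first exact: is_cvg_nneseries.
    apply: nearW => n; rewrite big_mkord.
    rewrite (eq_bigr (fun k : 'I_n => (slen (a j k) (b j k) z)%:E)); last first.
      by move=> k _; exact: slenE.
    rewrite sumEFin lee_fin; exact: jd.
Qed.

End NullSlices.

(** * From the class to semiconvexity *)

Lemma littleo_differentiable (K : numFieldType) (V W : normedModType K) (f : V -> W)
    (df : {linear V -> W}) (x : V) : continuous df ->
  (forall e : K, 0 < e -> \forall y \near (0 : V), `|f (y + x) - f x - df y| <= e * `|y|) ->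
  differentiable f x /\ 'd f x = df :> (V -> W).
Proof.
move=> cdf h.
have fo : f \o shift x = cst (f x) + df +o_ 0 id.
  apply/eqaddoP => e e0; apply: filterS (h e e0) => y.
  by rewrite -addrA -opprD.
have dE := diff_unique cdf fo; split => //.
by apply/diff_locallyP; rewrite dE.
Qed.

Section DerivativeEstimates.
Variables (R : realType).

Lemma is_derive_estimate (g : R -> R) (x D e : R) : is_derive x 1 g D -> 0 < e ->
  exists2 delta, 0 < delta &
    forall y, `|y - x| < delta -> `|g y - g x - D * (y - x)| <= e * `|y - x|.
Proof.
move=> [dg <-] e0; have /derivable_nbhs/eqaddoP/(_ _ e0)/nbhs_ballP[r /= r0 hr] := dg.
exists r => // y yr; have := hr (y - x); rewrite -ball_normE /ball_ /= sub0r normrN.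
move=> /(_ yr).
rewrite -![(_ + _ : _ -> _) _]/(_ + _) -![(- _ : _ -> _) _]/(- _) /=.
rewrite [(y - x)%:A](mulr1) subrK opprD addrA => h.
by rewrite [_ * (y - x)]mulrC; exact: h.
Qed.

Lemma estimate_is_derive (g : R -> R) (x D : R) :
  (forall e, 0 < e -> exists2 delta, 0 < delta &
    forall y, `|y - x| < delta -> `|g y - g x - D * (y - x)| <= e * `|y - x|) ->
  is_derive x 1 g D.
Proof.
move=> h.
have c : h^-1 *: ((g \o shift x) (h *: (1 : R)) - g x) @[h --> 0^'] --> D.
  apply/cvgrPdist_le => e e0; have [r r0 hr] := h e e0.
  apply/nbhs_ballP; exists r => // t; rewrite -ball_normE /ball_ /= sub0r normrN => tr t0.
  have := hr (t + x); rewrite addrK => /(_ tr); rewrite [t%:A](mulr1) distrC => gt.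
  have -> : D - t^-1 *: (g (t + x) - g x) = t^-1 * (D * t - (g (t + x) - g x)).
    by rewrite [RHS]mulrBr [_ * (D * t)]mulrC -mulrA divff // mulr1.
  by rewrite normrM normfV ler_pdivrMl ?normr_gt0 // [leRHS]mulrC.
by split; [apply/cvg_ex; exists D|exact/cvg_lim].
Qed.

Variable d : nat.
Implicit Types (x y z u v w : 'rV[R]_d).

Lemma differentiable_estimate (f : 'rV[R]_d -> R) x w (e : R) :
  differentiable f x -> (forall v, 'd f x v = dotE w v) -> 0 < e ->
  exists2 delta, 0 < delta &
    forall y, enorm (y - x) <= delta -> `|f y - f x - dotE w (y - x)| <= e * enorm (y - x).
Proof.
move=> df dfw e0.
have /diff_locally/eqaddoP/(_ _ e0)/nbhs_eball[r r0 hr] := df.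
exists r => // y yr; have := hr (y - x); rewrite /eball /= subr0 => /(_ yr) h.
have {h} : `|f (y - x + x) - (f x + 'd f x (y - x))| <= e * `|y - x| := h.
rewrite dfw subrK opprD addrA => /le_trans; apply.
by rewrite ler_wpM2l ?(ltW e0) // mx_norm_le_enorm.
Qed.

Lemma dotE_is_linear w : linear (dotE w).
Proof. by move=> a x y; rewrite dotEDr dotEZr. Qed.

HB.instance Definition _ w := GRing.isLinear.Build R 'rV[R]_d R _ (dotE w) (dotE_is_linear w).

Lemma dotE_continuous w : continuous (dotE w).
Proof.
move=> x A /nbhs_ballP[e /= e0 eA]; apply/nbhs_eball.
have w1 : 0 < enorm w + 1 by rewrite ltr_wpDl ?enorm_ge0.
exists (e / 2 / (enorm w + 1)); first by rewrite !divr_gt0.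
move=> y; rewrite /eball /= ler_pdivlMr // => ye; apply: eA.
rewrite -ball_normE /ball_ /= -dotEBr; apply: le_lt_trans (abs_dotE_le _ _) _.
rewrite enormB mulrC; apply: (@le_lt_trans _ _ (e / 2)); last by lra.
by apply: le_trans ye; rewrite ler_wpM2l ?enorm_ge0 ?lerDl.
Qed.

Lemma estimate_differentiable (f : 'rV[R]_d -> R) x w :
  (forall e : R, 0 < e -> exists2 delta, 0 < delta &
    forall y, enorm (y - x) <= delta -> `|f y - f x - dotE w (y - x)| <= e * enorm (y - x)) ->
  differentiable f x /\ forall v, 'd f x v = dotE w v.
Proof.
move=> h.
have [|df dE] := @littleo_differentiable R 'rV[R]_d R f (dotE w) x (@dotE_continuous w).
  move=> e e0.
  have s1 : 0 < Num.sqrt d%:R + 1 :> R by rewrite ltr_wpDl ?sqrtr_ge0.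
  have [r r0 hr] := h _ (divr_gt0 e0 s1).
  apply/nbhs_eball; exists r => // y; rewrite /eball /= subr0 => yr.
  have := hr (y + x); rewrite addrK => /(_ yr)/le_trans; apply.
  rewrite mulrAC ler_pdivrMr // -mulrA ler_wpM2l ?(ltW e0) //.
  apply: le_trans (enorm_le_mx_norm _) _.
  by rewrite mulrC ler_wpM2l ?lerDl.
by split => // v; rewrite dE.
Qed.

Lemma is_derive_line (f : 'rV[R]_d -> R) w z u (t : R) :
  differentiable f (z + t *: u) -> (forall v, 'd f (z + t *: u) v = dotE w v) ->
  is_derive t 1 (fun s => f (z + s *: u)) (dotE w u).
Proof.
move=> df dfw; apply: estimate_is_derive => e e0.
have u1 : 0 < enorm u + 1 by rewrite ltr_wpDl ?enorm_ge0.
have [r r0 hr] := differentiable_estimate df dfw (divr_gt0 e0 u1).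
exists (r / (enorm u + 1)); first by rewrite divr_gt0.
move=> s; rewrite ltr_pdivlMr // => sr.
have E : z + s *: u - (z + t *: u) = (s - t) *: u.
  by rewrite opprD addrACA subrr add0r scalerBl.
have := hr (z + s *: u); rewrite E enormZ dotEZr [dotE w u * _]mulrC.
have su : `|s - t| * enorm u <= `|s - t| * (enorm u + 1) by rewrite ler_wpM2l // lerDl.
move=> /(_ (le_trans su (ltW sr)))/le_trans; apply.
by rewrite mulrAC ler_pdivrMr // -mulrA ler_wpM2l // ltW.
Qed.

End DerivativeEstimates.

(** * Lipschitz bound from absolute continuity and a derivative bound almost everywhere *)

Section AbsCont.
Variables (R : realType).
Notation mu := (@lebesgue_measure R).

(** A form of Cousin's lemma: the supremum of the points reached from [a] can be overstepped by the
    local hypothesis unless it is [b]. *)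
Lemma interval_induction (P : R -> R -> Prop) (a b : R) : a <= b ->
  (forall s t r, a <= s -> s <= t -> t <= r -> r <= b -> P s t -> P t r -> P s r) ->
  (forall x, a <= x <= b -> exists2 delta, 0 < delta & forall s t,
     a <= s -> s <= x -> x <= t -> t <= b -> t - s < delta -> P s t) ->
  P a b.
Proof.
move=> ab Padd Ploc.
pose S := [set x | a <= x <= b /\ P a x].
have Sa : S a.
  split; first by rewrite lexx.
  have [|del del0 hd] := Ploc a; first by rewrite lexx ab.
  by apply: hd; rewrite ?subrr.
have Sub : ubound S b by move=> x [/andP[]].
have hS : has_sup S by split; [exists a|exists b].
set c := sup S.
have ac : a <= c by apply: ub_le_sup => //; exists b.
have cb : c <= b by apply: ge_sup => //; exists a.
have [|del del0 hd] := Ploc c; first by rewrite ac cb.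
have [x [/andP[ax xb] Pax] xc] := sup_adherent (divr_gt0 del0 (ltr0n R 2)) hS.
have {}xc : c - del / 2 < x by [].
have xc' : x <= c by apply: ub_le_sup; [exists b|split => //; rewrite ax xb].
pose t := Num.min b (c + del / 3).
have tb : t <= b by rewrite ge_min lexx.
have ct : c <= t by rewrite le_min cb lerDl divr_ge0 // ltW.
have tc : t <= c + del / 3 by rewrite ge_min lexx orbT.
have Pat : P a t.
  by apply: (Padd a x t) => //; [lra|apply: hd => //; lra].
have : t <= c.
  by apply: ub_le_sup; [exists b|split => //; rewrite tb andbT; lra].
rewrite /t ge_min => /orP[bc|]; last by lra.
have -> : b = t by apply/eqP; rewrite eq_le tb andbT; lra.
exact: Pat.
Qed.

(* Off U the function is locally (C + e)-Lipschitz by differentiability, and the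
   increments over intervals inside U are controlled by absolute continuity. *)
Lemma abs_cont_lipschitz (h : R -> R) (a b C : R) : a <= b -> 0 <= C ->
  abs_cont_on h a b ->
  (forall delta, 0 < delta -> exists U : set R, [/\ open U, (mu U <= delta%:E)%E &
    forall x, a <= x <= b -> U x \/ exists2 D, `|D| <= C & is_derive x 1 h D]) ->
  `|h b - h a| <= C * (b - a).
Proof.
move=> ab C0 hac hU; apply/ler_addgt0Pr => e0 e0gt.
(* Chosen so that the slope error [e * (b - a)] and the variation [e] inside [U] add up to [e0]. *)
pose e := e0 / (b - a + 1).
have ba1 : 0 < b - a + 1 by lra.
have egt : 0 < e by rewrite divr_gt0.
have eE : C * (b - a) + e0 = (C + e) * (b - a) + e.
  rewrite mulrDl -addrA; congr (_ + _).
  by rewrite -[X in _ + X]mulr1 -mulrDr /e divfK // gt_eqF.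
have [del del0 hdel] := hac e egt.
have [U [oU mU Ux]] := hU _ (divr_gt0 del0 (ltr0n R 2)).
have mUU : measurable U by exact: open_measurable.
have mUst s t : measurable (U `&` `[s, t[).
  by apply: measurableI => //; exact: measurable_itv.
have Ufin s t : mu (U `&` `[s, t[) = (fine (mu (U `&` `[s, t[)))%:E.
  rewrite fineK // ge0_fin_numE //; apply: (@le_lt_trans _ _ (del / 2)%:E); last exact: ltry.
  apply: le_trans mU; apply: le_measure; rewrite ?inE; [exact: mUst|exact: mUU|exact: subIsetl].
(* The pieces [[l k, r k]] collect the part handled by absolute continuity. Half-open intervals make
   the measure term additive when [[s, t]] and [[t, r]] are joined. *)
pose P s t := exists (n : nat) (l r : nat -> R),
  [/\ forall k, (k < n)%N -> s <= l k /\ l k <= r k /\ r k <= t,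
      forall k, (k.+1 < n)%N -> r k <= l k.+1,
      \sum_(k < n) (r k - l k) <= fine (mu (U `&` `[s, t[)) &
      `|h t - h s| <= (C + e) * (t - s) + \sum_(k < n) `|h (r k) - h (l k)|].
suff [n [l [r [lr rl srl hab]]]] : P a b.
  rewrite eE; apply: le_trans hab _; rewrite lerD2l ltW //.
  apply: hdel => //; apply: le_lt_trans srl _; rewrite -lte_fin -Ufin.
  apply: (@le_lt_trans _ _ (del / 2)%:E); last by rewrite lte_fin; lra.
  apply: le_trans mU; apply: le_measure; rewrite ?inE; [exact: mUst|exact: mUU|exact: subIsetl].
apply: interval_induction => //.
- move=> s t r _ st tr _ [n [l1 [r1 [lr1 rl1 s1 h1]]]] [m [l2 [r2 [lr2 rl2 s2 h2]]]].
  pose cc (f g : nat -> R) k := if (k < n)%N then f k else g (k - n)%N.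
  have ccsum (F : R -> R -> R) : \sum_(k < n + m) F (cc r1 r2 k) (cc l1 l2 k) =
      \sum_(k < n) F (r1 k) (l1 k) + \sum_(k < m) F (r2 k) (l2 k).
    rewrite big_split_ord /=; congr (_ + _); apply: eq_bigr => k _.
      by rewrite /cc ltn_ord.
    by rewrite /cc ltnNge leq_addr /= addKn.
  exists (n + m)%N, (cc l1 l2), (cc r1 r2); split.
  + move=> k knm; rewrite /cc; case: ltnP => kn.
      by have [? [? ?]] := lr1 k kn; split=> //; split => //; lra.
    have km : (k - n < m)%N by rewrite ltn_subLR.
    by have [? [? ?]] := lr2 _ km; split; [lra|split].
  + move=> k knm; rewrite /cc; case: (ltnP k.+1 n) => kn.
      by rewrite (ltnW kn); exact: rl1.
    case: (ltnP k n) => kn'.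
      have [_ [_ ?]] := lr1 k kn'.
      have km : (k.+1 - n < m)%N by rewrite ltn_subLR.
      by have [? _] := lr2 _ km; lra.
    by rewrite subSn //; apply: rl2; rewrite -subSn // ltn_subLR // leqW.
  + rewrite (ccsum (fun x y => x - y)); apply: le_trans (lerD s1 s2) _.
    rewrite -lee_fin EFinD -!Ufin -measureU; [|exact: mUst|exact: mUst|]; last first.
      apply/seteqP; split => x //= [[_ +] [_ +]]; rewrite !in_itv /=; lra.
    apply: le_measure; rewrite ?inE; [apply: measurableU; exact: mUst|exact: mUst|].
    by move=> x [] [Ux0]; rewrite /= !in_itv /= => xx; split => //; apply/andP; split; lra.
  + rewrite (ccsum (fun x y => `|h x - h y|)).
    have := ler_normD (h r - h t) (h t - h s); rewrite addrA subrK; lra.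
- move=> x xab; have [Uxx|[D DC hD]] := Ux x xab.
    have /nbhs_ballP[del' /= del'0 hdel'] : nbhs x U by move: oU; rewrite openE; apply.
    exists del' => // s t _ sx xt _ std.
    have st : s <= t by lra.
    exists 1%N, (fun=> s), (fun=> t); split.
    + by move=> k _; rewrite !lexx.
    + by move=> k.
    + rewrite big_ord1 -lee_fin -Ufin.
      have -> : (t - s)%:E = mu `[s, t[%classic.
        rewrite lebesgue_measure_itv /= lte_fin; move: st.
        by rewrite le_eqVlt => /predU1P[->|->] //; rewrite ltxx subrr.
      apply: le_measure; rewrite ?inE; [exact: measurable_itv|exact: mUst|].
      move=> y yst; split => //; move: yst; rewrite /= in_itv /= => yst.
      by apply: hdel'; rewrite -ball_normE /ball_ /= ltr_norml; lra.
    + by rewrite big_ord1 lerDr mulr_ge0 //; lra.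
  have [del' del'0 hdel'] := is_derive_estimate hD egt.
  exists del' => // s t _ sx xt _ std.
  exists 0%N, (fun=> s), (fun=> t); split => //.
    by rewrite big_ord0; exact/fine_ge0.
  rewrite big_ord0 addr0.
  have key y : `|y - x| < del' -> `|h y - h x| <= (C + e) * `|y - x|.
    move=> /hdel' hy; have := ler_normD (h y - h x - D * (y - x)) (D * (y - x)).
    rewrite subrK normrM => hh.
    have : `|D| * `|y - x| <= C * `|y - x| by rewrite ler_wpM2r.
    lra.
  have ks : `|s - x| < del' by rewrite ltr_norml; lra.
  have kt : `|t - x| < del' by rewrite ltr_norml; lra.
  have := ler_normD (h t - h x) (h x - h s); rewrite addrA subrK [`|h x - h s|]distrC.
  have := key _ ks; have := key _ kt.
  by rewrite (ger0_norm (_ : 0 <= t - x)) ?(ler0_norm (_ : s - x <= 0)) ?subr_ge0 ?subr_le0 //; lra.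
Qed.

End AbsCont.

(** * Semiconvexity of the functions of the class *)

Section Semiconvexity.
Variables (R : realType) (d : nat).
Implicit Types (x y z u v : 'rV[R]_d) (Om : set 'rV[R]_d).
Notation mu := (@lebesgue_measure R).

Lemma within_estimateP (W : normedModType R) Om (f : 'rV[R]_d -> W) :
  {within Om, continuous f} <-> forall x (e : R), Om x -> 0 < e ->
  exists2 r, 0 < r & forall y, Om y -> enorm (y - x) <= r -> `|f y - f x| <= e.
Proof.
split=> [/subspace_continuousP cf x e Ox e0|h].
  have /(cf x Ox) : nbhs (f x) [set t | `|t - f x| <= e].
    apply/nbhs_ballP; exists e => // t; rewrite -ball_normE /ball_ /= distrC; exact: ltW.
  by move=> /nbhs_eball[r r0 hr]; exists r => // y Oy yr; exact: hr yr Oy.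
apply/subspace_continuousP => x Ox A /nbhs_ballP[e /= e0 eA].
have [r r0 hr] := h x (e / 2) Ox (divr_gt0 e0 (ltr0n R 2)).
apply/nbhs_eball; exists r => // y yr Oy; apply: eA.
rewrite -ball_normE /ball_ /= distrC; apply: le_lt_trans (hr y Oy yr) _; lra.
Qed.

Lemma convex_interior Om x y (t : R) : Defs.convex_set Om -> interior Om x -> Om y ->
  0 <= t < 1 -> interior Om ((1 - t) *: x + t *: y).
Proof.
move=> cO /interior_eball[r r0 xr] Oy /andP[t0 t1].
have t1' : 0 < 1 - t by lra.
apply/interior_eball; exists ((1 - t) * r); first by rewrite mulr_gt0.
move=> z zr; pose w : 'rV[R]_d := z - ((1 - t) *: x + t *: y).
have {}zr : enorm w <= (1 - t) * r := zr.
have -> : z = (1 - t) *: (x + (1 - t)^-1 *: w) + t *: y.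
  by rewrite scalerDr scalerA divff ?gt_eqF // scale1r /w addrAC addrC subrK.
apply: (cO (x + (1 - t)^-1 *: w) y t) => //; last by apply/andP; split; lra.
apply: xr; rewrite /eball /= addrC addKr enormZ ger0_norm ?invr_ge0 ?(ltW t1') //.
by rewrite ler_pdivrMl.
Qed.

(** On the line, [k s = f + C s^2 / 2] has a nondecreasing derivative; its mean values before and
    after [t * L] compare the two chord slopes. *)
Lemma line_semiconvex (f : 'rV[R]_d -> R) (G : 'rV[R]_d -> 'rV[R]_d) z u (L C t : R) :
  0 < L -> 0 <= t <= 1 ->
  (forall s, 0 <= s <= L -> differentiable f (z + s *: u) /\
     forall v, 'd f (z + s *: u) v = dotE (G (z + s *: u)) v) ->
  (forall s s', 0 <= s -> s <= s' -> s' <= L ->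
     `|dotE (G (z + s' *: u)) u - dotE (G (z + s *: u)) u| <= C * (s' - s)) ->
  f (z + (t * L) *: u) <= (1 - t) * f z + t * f (z + L *: u) + C * t * (1 - t) * L ^+ 2 / 2.
Proof.
move=> L0 /andP[t0 t1] df hC.
pose k s := f (z + s *: u) + C / 2 * s ^+ 2.
pose h s := dotE (G (z + s *: u)) u.
have tL0 : 0 <= t * L by rewrite mulr_ge0 // ltW.
have tL1 : t * L <= L by rewrite ler_piMl // ltW.
have dk s : 0 <= s <= L -> is_derive s 1 k (h s + C * s).
  move=> sL; have [df1 df2] := df s sL.
  apply: is_deriveD; first exact: is_derive_line df1 df2.
  apply: estimate_is_derive => e e0; exists (e / (`|C| + 1)).
    by rewrite divr_gt0 // ltr_wpDl.
  move=> y; rewrite ltr_pdivlMr ?ltr_wpDl // => ye.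
  have -> : C / 2 * y ^+ 2 - C / 2 * s ^+ 2 - C * s * (y - s) = (C * (y - s)) / 2 * (y - s) by lra.
  rewrite normrM ler_wpM2r // normrM normrM [`|2^-1|]ger0_norm //.
  have : 0 <= `|C| * `|y - s| by rewrite mulr_ge0.
  have : 0 <= `|y - s| by [].
  move: ye; set p := `|y - s|; set c := `|C| => *; lra.
have ck a b : 0 <= a -> b <= L -> {within `[a, b], continuous k}.
  move=> a0 bL; apply: derivable_within_continuous => s; rewrite in_itv /= => /andP[sa sb].
  have [] := dk s; first by apply/andP; split; lra.
  by [].
have [||x1 x1t E1] := @MVT_segment R k (fun s => h s + C * s) 0 (t * L) tL0.
- by move=> s; rewrite in_itv /= => /andP[*]; apply: dk; apply/andP; split; lra.
- exact: ck.
have [||x2 x2t E2] := @MVT_segment R k (fun s => h s + C * s) (t * L) L tL1.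
- by move=> s; rewrite in_itv /= => /andP[*]; apply: dk; apply/andP; split; lra.
- exact: ck.
move: x1t x2t; rewrite !in_itv /= => /andP[x10 x11] /andP[x20 x21].
have := hC x1 x2 x10 (le_trans x11 x20) x21; rewrite ler_norml => /andP[hh _].
have hm : h x1 + C * x1 <= h x2 + C * x2 by move: hh; rewrite -/(h x1) -/(h x2); lra.
have E3 : (1 - t) * (k (t * L) - k 0) <= t * (k L - k (t * L)).
  rewrite E1 E2 subr0.
  have -> : (1 - t) * ((h x1 + C * x1) * (t * L)) = ((1 - t) * t * L) * (h x1 + C * x1) by ring.
  have -> : t * ((h x2 + C * x2) * (L - t * L)) = ((1 - t) * t * L) * (h x2 + C * x2) by ring.
  apply: ler_wpM2l hm; rewrite !mulr_ge0 ?subr_ge0 // ltW //.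
move: E3; rewrite /k scale0r addr0 expr0n /=.
set f0 := f z; set f1 := f (z + L *: u); set ft := f (z + (t * L) *: u) => E3.
have -> : ft = (1 - t) * ft + t * ft by ring.
lra.
Qed.

Lemma abs_cont_shift (h : R -> R) (a b c : R) : abs_cont_on h (a - c) (b - c) ->
  abs_cont_on (fun t => h (t - c)) a b.
Proof.
move=> ac e e0; have [del del0 hd] := ac e e0; exists del => // n l r lr rl srl.
apply: (hd n (fun k => l k - c) (fun k => r k - c)) => [k /lr [? [? ?]]|k /rl ?|].
- by split; [lra|split; lra].
- lra.
- by under eq_bigr do rewrite opprB addrA subrK.
Qed.

Lemma W_line_lipschitz (q : R) Om (f : 'rV[R]_d -> R) (G : 'rV[R]_d -> 'rV[R]_d) z u (L C : R) : 0 < L -> 0 <= C ->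
  (forall s, 0 <= s <= L -> interior Om (z + s *: u)) ->
  (forall delta, 0 < delta -> exists U : set R, [/\ open U, forall t, 0 <= t <= L ->
     ([set x | interior Om x /\
      ~ loc_abs_cont_on (fun t => dotE (G (x + t *: u)) u)
                        [set t | interior Om (x + t *: u)]] `|`
      [set x | Om x /\
      ~ exists D, is_derive (0 : R) 1 (fun t => dotE (G (x + t *: u)) u) D
                  /\ `|D + q * f x| <= 1]) (z + t *: u) -> U t &
      (mu U <= delta%:E)%E]) ->
  (forall x, Om x -> 1 + `|q| * `|f x| <= C) ->
  forall s s', 0 <= s -> s <= s' -> s' <= L ->
     `|dotE (G (z + s' *: u)) u - dotE (G (z + s *: u)) u| <= C * (s' - s).
Proof.
move=> L0 C0 zL hU hC s s' s0 ss' s'L.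
(* A set [U] of measure at most [L / 2] cannot contain [[0, L]]. One good base point on the line is
   enough, since changing the base point only shifts the parameter. *)
have [t0 [t0L [_ act0]]] : exists t0, 0 <= t0 <= L /\ interior Om (z + t0 *: u) /\
    loc_abs_cont_on (fun t => dotE (G (z + t0 *: u + t *: u)) u)
                        [set t | interior Om (z + t0 *: u + t *: u)].
  have [U [oU hUU mU]] := hU (L / 2) (divr_gt0 L0 (ltr0n R 2)).
  apply: contrapT => nt.
  have : (mu `[0%R, L]%classic <= mu U)%E.
    apply: le_measure; rewrite ?inE; [exact: measurable_itv|exact: open_measurable|].
    move=> t; rewrite /= in_itv /= => tL; apply: hUU => //; left; split; first exact: zL.
    by move=> ac; apply: nt; exists t; split => //; split => //; exact: zL.
  rewrite mu_itvcc ?(ltW L0) // => /le_trans/(_ mU); rewrite lee_fin; lra.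
have /andP[t00 t0L'] := t0L.
apply: (@abs_cont_lipschitz R (fun t => dotE (G (z + t *: u)) u) s s' C) => //.
  have -> : (fun t => dotE (G (z + t *: u)) u) =
      (fun t => dotE (G (z + t0 *: u + (t - t0) *: u)) u).
    by apply/funext => t; rewrite -addrA -scalerDl addrCA subrr addr0.
  apply: (abs_cont_shift (h := fun t => dotE (G (z + t0 *: u + t *: u)) u)).
  apply: act0; first by lra.
  move=> t /=; rewrite in_itv /= -addrA -scalerDl => /andP[? ?].
  by apply: zL; apply/andP; split; lra.
move=> delta delta0; have [U [oU hUU mU]] := hU delta delta0.
exists U; split => // x xs; have [Ux|nUx] := pselect (U x); [by left|right].
have xL : 0 <= x <= L by apply/andP; lra.
have [D [hD D1]] : exists D, is_derive (0 : R) 1 (fun t => dotE (G (z + x *: u + t *: u)) u) D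
                  /\ `|D + q * f (z + x *: u)| <= 1.
  apply: contrapT => nD; apply: nUx; apply: hUU => //.
  by right; split => //; apply: interior_subset; exact: zL.
exists D.
  apply: le_trans (hC _ (interior_subset (zL _ xL))).
  have := ler_normB (D + q * f (z + x *: u)) (q * f (z + x *: u)).
  by rewrite addrK normrM; lra.
apply: estimate_is_derive => e e0; have [r r0 hr] := is_derive_estimate hD e0.
exists r => // y yr; have := hr (y - x); rewrite !subr0 scale0r addr0 => /(_ yr).
have -> : z + x *: u + (y - x) *: u = z + y *: u.
  by rewrite -addrA -scalerDl [x + _]addrC subrK.
by [].
Qed.

(* Almost every segment parallel to [x, y] satisfies the second order bound, so
   the inequality holds on nearby segments and passes to the limit by continuity. *)
Lemma W_semiconvex_interior (q : R) Om (f : 'rV[R]_d -> R) (G : 'rV[R]_d -> 'rV[R]_d)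
    (C t : R) x y : Defs.convex_set Om -> W_class q Om f G ->
  (forall x, Om x -> 1 + `|q| * `|f x| <= C) ->
  interior Om x -> interior Om y -> 0 <= t <= 1 ->
  f ((1 - t) *: x + t *: y) <=
    (1 - t) * f x + t * f y + C * t * (1 - t) * enorm (x - y) ^+ 2 / 2.
Proof.
move=> cO [[cf [cG fG]] W] hC ix iy t01; have /andP[t0 t1] := t01.
have C0 : 0 <= C.
  by apply: le_trans (hC x (interior_subset ix)); rewrite addr_ge0 // mulr_ge0.
have [->|xy] := eqVneq x y.
  rewrite -scalerDl subrK scale1r -mulrDl subrK mul1r lerDl.
  by rewrite divr_ge0 // !mulr_ge0 ?enorm_ge0 ?subr_ge0.
have L0 : 0 < enorm (y - x).
  rewrite lt_neqAle enorm_ge0 andbT eq_sym; apply: contra xy => /eqP/enorm_eq0/eqP.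
  by rewrite subr_eq0 eq_sym.
rewrite enormB; set L := enorm (y - x) in L0 *.
pose u := L^-1 *: (y - x).
have u1 : enorm u = 1 by rewrite enormZ ger0_norm ?invr_ge0 ?(ltW L0) // mulVf ?gt_eqF.
have Lu : L *: u = y - x by rewrite scalerA divff ?gt_eqF // scale1r.
have mE : (1 - t) *: x + t *: y = x + (t * L) *: u.
  by rewrite -scalerA Lu; apply/rowP => i; rewrite !mxE; ring.
have [W1 W2] := W u u1; have N0 := leb_null_setU W1 W2.
apply/ler_addgt0Pr => e e0; have e4 : 0 < e / 4 by rewrite divr_gt0.
have im : interior Om ((1 - t) *: x + t *: y).
  have [t1'|t1'] := ltP t 1; first by apply: convex_interior (interior_subset iy) _ => //; rewrite t0.
  have -> : t = 1 by lra.
  by rewrite subrr scale0r add0r scale1r.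
have [r1 r10 h1] := (within_estimateP _ _).1 cf _ _ (interior_subset ix) e4.
have [r2 r20 h2] := (within_estimateP _ _).1 cf _ _ (interior_subset iy) e4.
have [r3 r30 h3] := (within_estimateP _ _).1 cf _ _ (interior_subset im) e4.
have /interior_eball[r4 r40 h4] := ix.
have /interior_eball[r5 r50 h5] := iy.
pose r := Num.min (Num.min (Num.min r1 r2) (Num.min r3 (r4 / 2))) (r5 / 2).
have r0 : 0 < r by rewrite !lt_min r10 r20 r30 !divr_gt0.
have [rr1 rr2 rr3 rr4 rr5] : [/\ r <= r1, r <= r2, r <= r3, r <= r4 / 2 & r <= r5 / 2].
  by split; rewrite !ge_min lexx ?orbT.
have sd : 0 < Num.sqrt d%:R + 1 :> R by rewrite ltr_wpDl ?sqrtr_ge0.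
(* A cube of side [r / (sqrt d + 1)] with corner [x] stays within Euclidean distance [r] of [x]. *)
have [z zx hz] := @null_slice R d u L L0 _ x (r / (Num.sqrt d%:R + 1)) (divr_gt0 r0 sd) N0.
have zxr : enorm (z - x) <= r.
  have : enorm (z - x) <= Num.sqrt d%:R * (r / (Num.sqrt d%:R + 1)).
    apply: enorm_le_coord; first by rewrite divr_ge0 // ltW.
    by move=> i; have := zx i; rewrite !mxE => /andP[? ?]; rewrite ler_norml; lra.
  move/le_trans; apply; rewrite mulrA ler_pdivrMr // mulrC ler_wpM2l // ?lerDl //.
  exact: ltW.
have half_int c rc : 0 < rc -> eball c rc `<=` Om -> r <= rc / 2 -> forall w,
    enorm (w - c) <= r -> interior Om w.
  move=> rc0 crc rrc w wc; apply/interior_eball; exists (rc / 2); first by rewrite divr_gt0.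
  move=> v vw; apply: crc; apply: le_trans (enorm_tri w _ _) _.
  by have : enorm (v - w) <= rc / 2 := vw; lra.
have iz : interior Om z by apply: half_int h4 rr4 _ zxr.
have zLx : z + L *: u - y = z - x by rewrite Lu -addrA [y - x]addrC addrK.
have izL : interior Om (z + L *: u) by apply: half_int h5 rr5 _ _; rewrite // zLx.
have zmE : z + (t * L) *: u - ((1 - t) *: x + t *: y) = z - x.
  by rewrite mE opprD addrACA subrr addr0.
have zs s : 0 <= s <= L -> interior Om (z + s *: u).
  move=> /andP[s0 sL]; have [sL'|Ls] := ltP s L; last first.
    by have -> : s = L by lra.
  have -> : z + s *: u = (1 - s / L) *: z + (s / L) *: (z + L *: u).
    by apply/rowP => i; rewrite !mxE; field; rewrite gt_eqF.
  apply: convex_interior (interior_subset izL) _ => //.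
  by rewrite divr_ge0 ?(ltW L0) //= ltr_pdivrMr // mul1r.
have hlip := W_line_lipschitz L0 C0 zs hz hC.
have := line_semiconvex L0 t01 (fun s sL => fG _ (zs s sL)) hlip.
have izm : interior Om (z + (t * L) *: u).
  by apply: zs; rewrite mulr_ge0 ?(ltW L0) //= ler_piMl // ltW.
have := h1 z (interior_subset iz) (le_trans zxr rr1).
have := h2 _ (interior_subset izL); rewrite zLx => /(_ (le_trans zxr rr2)).
have := h3 _ (interior_subset izm); rewrite zmE => /(_ (le_trans zxr rr3)).
rewrite !ler_norml => /andP[a1 a2] /andP[b1 b2] /andP[c1 c2] key.
set fm := f (_ *: x + _) in a1 a2 *.
have k1 : (1 - t) * f z <= (1 - t) * (f x + e / 4) by apply: ler_wpM2l; lra.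
have k2 : t * f (z + L *: u) <= t * (f y + e / 4) by apply: ler_wpM2l => //; lra.
have : (1 - t) * (f x + e / 4) + t * (f y + e / 4) = (1 - t) * f x + t * f y + e / 4 by ring.
set K := C * t * (1 - t) * L ^+ 2 / 2 in key *.
lra.
Qed.

(** Contraction towards an interior point [x0] moves the three points into the interior and shortens
    the segment; continuity on [Om] undoes the contraction. *)
Lemma W_semiconvex (q : R) Om (f : 'rV[R]_d -> R) (G : 'rV[R]_d -> 'rV[R]_d)
    (C t : R) x y : convex_body Om -> W_class q Om f G ->
  (forall x, Om x -> 1 + `|q| * `|f x| <= C) -> Om x -> Om y -> 0 <= t <= 1 ->
  f ((1 - t) *: x + t *: y) <=
    (1 - t) * f x + t * f y + C * t * (1 - t) * enorm (x - y) ^+ 2 / 2.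
Proof.
move=> [_ [cO [x0 ix0]]] Wf hC Ox Oy t01; have [[cf _] _] := Wf; have /andP[t0 t1] := t01.
have Ox0 := interior_subset ix0.
have C0 : 0 <= C by apply: le_trans (hC x Ox); rewrite addr_ge0 // mulr_ge0.
apply/ler_addgt0Pr => e e0; have e4 : 0 < e / 4 by rewrite divr_gt0.
have Om_ : Om ((1 - t) *: x + t *: y) by apply: cO.
have [r1 r10 h1] := (within_estimateP _ _).1 cf _ _ Ox e4.
have [r2 r20 h2] := (within_estimateP _ _).1 cf _ _ Oy e4.
have [r3 r30 h3] := (within_estimateP _ _).1 cf _ _ Om_ e4.
set m := (1 - t) *: x + t *: y in Om_ r3 r30 h3 *.
pose M := enorm (x0 - x) + enorm (x0 - y) + enorm (x0 - m) + 1.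
have [M0 Mx My Mm] : [/\ 0 < M, enorm (x0 - x) <= M, enorm (x0 - y) <= M & enorm (x0 - m) <= M].
  have := enorm_ge0 (x0 - x); have := enorm_ge0 (x0 - y); have := enorm_ge0 (x0 - m).
  by rewrite /M; split; lra.
pose r := Num.min (Num.min r1 r2) (Num.min r3 M).
have r0 : 0 < r by rewrite !lt_min r10 r20 r30.
have [rr1 rr2 rr3 rM] : [/\ r <= r1, r <= r2, r <= r3 & r <= M].
  by split; rewrite !ge_min lexx ?orbT.
pose s := r / (2 * M).
have s0 : 0 < s by rewrite divr_gt0 // mulr_gt0.
have sM : s * M <= r.
  have -> : s * M = r / 2 by rewrite /s; field; rewrite gt_eqF.
  lra.
have s1 : s < 1 by rewrite ltr_pdivrMr ?mulr_gt0 // mul1r; lra.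
(* The coefficient is written [1 - (1 - s)] to match [convex_interior]. *)
pose g (z : 'rV[R]_d) : 'rV[R]_d := (1 - (1 - s)) *: x0 + (1 - s) *: z.
have gi z : Om z -> interior Om (g z).
  by move=> Oz; apply: convex_interior => //; apply/andP; split; lra.
have gz z : enorm (x0 - z) <= M -> enorm (g z - z) <= r.
  have -> : g z - z = s *: (x0 - z) by apply/rowP => i; rewrite !mxE; ring.
  rewrite enormZ gtr0_norm // => zM; apply: le_trans sM.
  by rewrite ler_wpM2l // ltW.
have gm : g m = (1 - t) *: g x + t *: g y by apply/rowP => i; rewrite !mxE; ring.
have gxy : enorm (g x - g y) ^+ 2 <= enorm (x - y) ^+ 2.
  have -> : g x - g y = (1 - s) *: (x - y) by apply/rowP => i; rewrite !mxE; ring.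
  rewrite enormZ ger0_norm ?subr_ge0 ?(ltW s1) // lerXn2r ?nnegrE ?mulr_ge0 ?enorm_ge0 ?subr_ge0 ?(ltW s1) //.
  by rewrite ler_piMl ?enorm_ge0 //; lra.
have := W_semiconvex_interior cO Wf hC (gi _ Ox) (gi _ Oy) t01; rewrite -gm => key.
have := h1 _ (interior_subset (gi _ Ox)) (le_trans (gz _ Mx) rr1).
have := h2 _ (interior_subset (gi _ Oy)) (le_trans (gz _ My) rr2).
have := h3 _ (interior_subset (gi _ Om_)) (le_trans (gz _ Mm) rr3).
rewrite !ler_norml => /andP[a1 a2] /andP[b1 b2] /andP[c1 c2].
have k1 : (1 - t) * f (g x) <= (1 - t) * (f x + e / 4) by apply: ler_wpM2l; lra.
have k2 : t * f (g y) <= t * (f y + e / 4) by apply: ler_wpM2l => //; lra.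
have k3 : C * t * (1 - t) * enorm (g x - g y) ^+ 2 / 2 <=
    C * t * (1 - t) * enorm (x - y) ^+ 2 / 2.
  rewrite ler_wpM2r ?invr_ge0 // ler_wpM2l // !mulr_ge0 // subr_ge0 //.
have : (1 - t) * (f x + e / 4) + t * (f y + e / 4) = (1 - t) * f x + t * f y + e / 4 by ring.
lra.
Qed.

End Semiconvexity.

(** * Functions with zero information and the Chebyshev centre *)

Section UpperBound.
Variables (R : realType) (d : nat).
Implicit Types (x y z u v m p : 'rV[R]_d) (Om : set 'rV[R]_d).

(** The class is convex and symmetric. This reduces the recovery error to the size of functions with
    zero data. *)
Lemma W_half_diff (q : R) Om (f1 f2 : 'rV[R]_d -> R) (G1 G2 : 'rV[R]_d -> 'rV[R]_d) :
  W_class q Om f1 G1 -> W_class q Om f2 G2 ->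
  W_class q Om (fun x => (f1 x - f2 x) / 2) (fun x => 2^-1 *: (G1 x - G2 x)).
Proof.
move=> [[cf1 [cG1 df1]] W1] [[cf2 [cG2 df2]] W2].
have dE x u : dotE (2^-1 *: (G1 x - G2 x)) u = (dotE (G1 x) u - dotE (G2 x) u) / 2.
  by rewrite dotEZl dotEBl mulrC.
split; first (split; [|split]).
- apply/within_estimateP => x e Ox e0.
  have [r1 r10 h1] := (within_estimateP _ _).1 cf1 x e Ox e0.
  have [r2 r20 h2] := (within_estimateP _ _).1 cf2 x e Ox e0.
  exists (Num.min r1 r2); first by rewrite lt_min r10.
  move=> y Oy; rewrite le_min => /andP[yr1 yr2].
  by have := h1 y Oy yr1; have := h2 y Oy yr2; rewrite !ler_norml => *; apply/andP; split; lra.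
- apply/within_estimateP => x e Ox e0.
  have [r1 r10 h1] := (within_estimateP _ _).1 cG1 x e Ox e0.
  have [r2 r20 h2] := (within_estimateP _ _).1 cG2 x e Ox e0.
  exists (Num.min r1 r2); first by rewrite lt_min r10.
  move=> y Oy; rewrite le_min => /andP[yr1 yr2].
  have -> : 2^-1 *: (G1 y - G2 y) - 2^-1 *: (G1 x - G2 x) =
      2^-1 *: ((G1 y - G1 x) - (G2 y - G2 x)).
    by apply/rowP => i; rewrite !mxE; ring.
  rewrite normrZ ger0_norm //; have := ler_normB (G1 y - G1 x) (G2 y - G2 x).
  by have := h1 y Oy yr1; have := h2 y Oy yr2; lra.
- move=> x ix; have [d1 e1] := df1 x ix; have [d2 e2] := df2 x ix.
  apply: estimate_differentiable => e e0.
  have [r1 r10 h1] := differentiable_estimate d1 e1 e0.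
  have [r2 r20 h2] := differentiable_estimate d2 e2 e0.
  exists (Num.min r1 r2); first by rewrite lt_min r10.
  move=> y; rewrite le_min dE => /andP[yr1 yr2].
  have := h1 y yr1; have := h2 y yr2; rewrite !ler_norml => *; apply/andP; split; lra.
move=> u u1; have [N1 M1] := W1 u u1; have [N2 M2] := W2 u u1; split.
  apply: leb_null_subset (leb_null_setU N1 N2) => x /= [ix nac].
  have [ac1|] := pselect (loc_abs_cont_on (fun t => dotE (G1 (x + t *: u)) u)
                        [set t | interior Om (x + t *: u)]); last by left.
  have [ac2|] := pselect (loc_abs_cont_on (fun t => dotE (G2 (x + t *: u)) u)
                        [set t | interior Om (x + t *: u)]); last by right.
  case: nac => a b ab abO e e0.
  have [d1 d10 h1] := ac1 a b ab abO e e0; have [d2 d20 h2] := ac2 a b ab abO e e0.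
  exists (Num.min d1 d2); first by rewrite lt_min d10.
  move=> n s t st ts; rewrite lt_min => /andP[sd1 sd2].
  have := h1 n s t st ts sd1; have := h2 n s t st ts sd2.
  set S2 := \sum_(k < n) _; set S1 := \sum_(k < n) _ => l2 l1.
  apply: le_lt_trans (_ : (S1 + S2) / 2 < e); last by lra.
  rewrite -big_split /= mulr_suml; apply: ler_sum => k _; rewrite !dE.
  set a1 := dotE (G1 (_ + t k *: _)) _; set b1 := dotE (G1 (_ + s k *: _)) _.
  set a2 := dotE (G2 (_ + t k *: _)) _; set b2 := dotE (G2 (_ + s k *: _)) _.
  have -> : (a1 - a2) / 2 - (b1 - b2) / 2 = ((a1 - b1) - (a2 - b2)) / 2 by lra.
  by rewrite normrM [`|2^-1|]ger0_norm // ler_wpM2r // ler_normB.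
apply: leb_null_subset (leb_null_setU M1 M2) => x /= [Ox nD].
have [[D1 [hD1 l1]]|] := pselect (exists D, is_derive (0 : R) 1 (fun t => dotE (G1 (x + t *: u)) u) D
                  /\ `|D + q * f1 x| <= 1); last by left.
have [[D2 [hD2 l2]]|] := pselect (exists D, is_derive (0 : R) 1 (fun t => dotE (G2 (x + t *: u)) u) D
                  /\ `|D + q * f2 x| <= 1); last by right.
case: nD; exists ((D1 - D2) / 2); split.
  apply: estimate_is_derive => e e0.
  have [r1 r10 h1] := is_derive_estimate hD1 e0.
  have [r2 r20 h2] := is_derive_estimate hD2 e0.
  exists (Num.min r1 r2); first by rewrite lt_min r10.
  move=> y; rewrite lt_min !dE => /andP[yr1 yr2].
  by have := h1 y yr1; have := h2 y yr2; rewrite !ler_norml => *; apply/andP; split; lra.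
have -> : (D1 - D2) / 2 + q * ((f1 x - f2 x) / 2) = (D1 + q * f1 x) / 2 - (D2 + q * f2 x) / 2 by lra.
by move: l1 l2; rewrite !ler_norml => *; apply/andP; split; lra.
Qed.

(* That is, f + C |.|^2 / 2 is convex on Om. *)
Definition semiconvex Om (C : R) (f : 'rV[R]_d -> R) := forall x y t,
  Om x -> Om y -> 0 <= t <= 1 -> f ((1 - t) *: x + t *: y) <=
    (1 - t) * f x + t * f y + C * t * (1 - t) * enorm (x - y) ^+ 2 / 2.

(** Divide semiconcavity on [[y, m]] by the parameter [t]: as [t] shrinks, the difference quotient
    of [f] at the critical point [y] disappears. *)
Lemma critical_le Om (C : R) (f : 'rV[R]_d -> R) w y m : 0 <= C ->
  semiconvex Om C (fun x => - f x) -> differentiable f y ->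
  (forall v, 'd f y v = dotE w v) -> w = 0 -> Om y -> Om m ->
  f m <= f y + C * enorm (y - m) ^+ 2 / 2.
Proof.
move=> C0 sc df dfw w0 Oy Om_; apply/ler_addgt0Pr => e e0.
have m1 : 0 < enorm (m - y) + 1 by rewrite ltr_wpDl ?enorm_ge0.
have [r r0 hr] := differentiable_estimate df dfw (divr_gt0 e0 m1).
pose t := Num.min 1 (r / (enorm (m - y) + 1)).
have t0 : 0 < t by rewrite lt_min ltr01 divr_gt0.
have t1 : t <= 1 by rewrite ge_min lexx.
have tr : t * enorm (m - y) <= r.
  apply: (@le_trans _ _ (t * (enorm (m - y) + 1))); first by rewrite ler_wpM2l ?lerDl // ltW.
  by rewrite -ler_pdivlMr // ge_min lexx orbT.
have zE : (1 - t) *: y + t *: m - y = t *: (m - y) by apply/rowP => i; rewrite !mxE; ring.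
have := hr ((1 - t) *: y + t *: m); rewrite zE enormZ gtr0_norm // => /(_ tr).
rewrite w0 dotE0l subr0 ler_norml => /andP[_ h1].
have t01 : 0 <= t <= 1 by rewrite ltW.
have := sc y m t Oy Om_ t01; set z := (1 - t) *: y + t *: m in h1 *.
set D := enorm (y - m) ^+ 2 => h2.
have h3 : e / (enorm (m - y) + 1) * (t * enorm (m - y)) <= t * e.
  rewrite [leLHS]mulrC -mulrA; apply: ler_wpM2l; first exact: ltW.
  by rewrite mulrA ler_pdivrMr // mulrC ler_wpM2l ?lerDl // ltW.
have h4 : t * f m <= t * (f y + C * (1 - t) * D / 2 + e) by lra.
rewrite ler_pM2l // in h4; apply: le_trans h4 _; rewrite lerD2r lerD2l.
rewrite ler_wpM2r ?invr_ge0 // ler_wpM2r ?sqr_ge0 // ler_piMr //; lra.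
Qed.

(* Apply semiconvexity on a segment from m through x to a point p slightly beyond x. *)
Lemma interior_max_le Om (C : R) (f : 'rV[R]_d -> R) x m : 0 <= C -> semiconvex Om C f ->
  interior Om x -> (forall y, Om y -> f y <= f x) -> Om m ->
  f x <= f m + C * enorm (x - m) ^+ 2 / 2.
Proof.
move=> C0 sc /interior_eball[r r0 hr] xmax Om_.
set D := enorm (x - m) ^+ 2; have D0 : 0 <= D by exact: sqr_ge0.
apply/ler_addgt0Pr => e e0.
have CD : 0 < C * D + 1 by rewrite ltr_wpDl // mulr_ge0.
pose ep := Num.min (e / (C * D + 1)) (r / (enorm (m - x) + 1)).
have m1 : 0 < enorm (m - x) + 1 by rewrite ltr_wpDl ?enorm_ge0.
have ep0 : 0 < ep by rewrite lt_min !divr_gt0.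
have epe : ep * (C * D) <= e.
  apply: (@le_trans _ _ (ep * (C * D + 1))); first by rewrite ler_wpM2l ?lerDl // ltW.
  by rewrite -ler_pdivlMr // ge_min lexx.
have epr : ep * enorm (m - x) <= r.
  apply: (@le_trans _ _ (ep * (enorm (m - x) + 1))); first by rewrite ler_wpM2l ?lerDl // ltW.
  by rewrite -ler_pdivlMr // ge_min lexx orbT.
pose p : 'rV[R]_d := x - ep *: (m - x).
have Op : Om p.
  by apply: hr; rewrite /eball /= /p addrC addKr enormN enormZ gtr0_norm.
(* The parameter at which the segment from [p = x - ep (m - x)] to [m] passes through [x]. *)
pose t := ep / (1 + ep).
have ep1 : 0 < 1 + ep by lra.
have t0 : 0 < t by rewrite divr_gt0.
have t1 : t <= 1 by rewrite ler_pdivrMr //; lra.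
have xE : (1 - t) *: p + t *: m = x.
  by apply/rowP => i; rewrite !mxE /t; field; rewrite gt_eqF.
have pmE : enorm (p - m) ^+ 2 = (1 + ep) ^+ 2 * D.
  have -> : p - m = (1 + ep) *: (x - m) by apply/rowP => i; rewrite !mxE; ring.
  by rewrite enormZ gtr0_norm // exprMn.
have t01 : 0 <= t <= 1 by rewrite ltW.
have := sc p m t Op Om_ t01; rewrite xE pmE => h1.
have h2 : (1 - t) * f p <= (1 - t) * f x by rewrite ler_wpM2l ?xmax // subr_ge0.
have h3 : t * f x <= t * (f m + C * D / 2 + ep * (C * D) / 2).
  have E : C * t * (1 - t) * ((1 + ep) ^+ 2 * D) / 2 = t * (C * D / 2 + ep * (C * D) / 2).
    by rewrite /t; field; rewrite gt_eqF.
  lra.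
by rewrite ler_pM2l // in h3; lra.
Qed.

(* The denser covering of the boundary compensates the missing factor 1/2 in
   [zero_info_max] for a maximum attained outside the interior. *)
Definition node_cover Om (xi : seq 'rV[R]_d) (h : R) :=
  [/\ forall y, y \in xi -> interior Om y,
      forall x, Om x -> exists2 y, y \in xi & enorm (x - y) <= h &
      forall x, Om x -> ~ interior Om x -> exists2 y, y \in xi & enorm (x - y) <= h / 2].

Lemma zero_info_max Om xi (h C : R) (f : 'rV[R]_d -> R) (G : 'rV[R]_d -> 'rV[R]_d) x :
  Defs.convex_set Om -> node_cover Om xi h -> 0 <= h -> 0 <= C ->
  semiconvex Om C f -> semiconvex Om C (fun x => - f x) ->
  (forall x, interior Om x -> differentiable f x /\ forall v, 'd f x v = dotE (G x) v) ->
  (forall y, y \in xi -> f y = 0 /\ G y = 0) ->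
  Om x -> (forall y, Om y -> f y <= f x) -> f x <= C * h ^+ 2 / 4.
Proof.
move=> cO [xii cov covb] h0 C0 sc scN df f0 Ox xmax.
have sq y (c : R) : 0 <= c -> enorm y <= c -> enorm y ^+ 2 <= c ^+ 2.
  by move=> c0 yc; rewrite lerXn2r ?nnegrE ?enorm_ge0.
have [ix|nix] := pselect (interior Om x); last first.
  have [y yxi xy] := covb x Ox nix; have [fy Gy] := f0 y yxi.
  have [dfy dfGy] := df y (xii y yxi).
  have := critical_le C0 scN dfy dfGy Gy (interior_subset (xii y yxi)) Ox.
  rewrite fy add0r enormB => /le_trans; apply.
  have := ler_wpM2l C0 (sq _ _ (divr_ge0 h0 (ler0n R 2)) xy).
  have : 0 <= C * h ^+ 2 by rewrite mulr_ge0 // sqr_ge0.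
  lra.
have [y yxi xy] := cov x Ox; have [fy Gy] := f0 y yxi.
have [dfy dfGy] := df y (xii y yxi).
have Oy := interior_subset (xii y yxi).
(* Both comparisons run over a distance of at most [h / 2] and cost [C * h ^+ 2 / 8] each. *)
pose m : 'rV[R]_d := (1 - 2^-1) *: x + 2^-1 *: y.
have Om_ : Om m by apply: cO => //; apply/andP; split; lra.
have h1 := interior_max_le C0 sc ix xmax Om_.
have h2 := critical_le C0 scN dfy dfGy Gy Oy Om_.
have xm : x - m = 2^-1 *: (x - y) by apply/rowP => i; rewrite !mxE; field.
have ym : y - m = 2^-1 *: (y - x) by apply/rowP => i; rewrite !mxE; field.
move: h1 h2; rewrite xm ym !enormZ ger0_norm // (enormB y x) fy add0r !exprMn.
have := ler_wpM2l C0 (sq _ _ h0 xy).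
set D := enorm (x - y) ^+ 2; lra.
Qed.

Lemma zero_info_bound (q : R) Om xi (h : R) (f : 'rV[R]_d -> R) (G G' : 'rV[R]_d -> 'rV[R]_d) :
  convex_body Om -> node_cover Om xi h -> 0 <= h -> `|q| * (h ^+ 2 / 4) < 1 ->
  W_class q Om f G -> W_class q Om (fun x => - f x) G' ->
  (forall y, y \in xi -> [/\ f y = 0, G y = 0 & G' y = 0]) ->
  forall x, Om x -> `|f x| <= (h ^+ 2 / 4) / (1 - `|q| * (h ^+ 2 / 4)).
Proof.
move=> bO nc h0 qh Wf WNf fxi; have [cpO [cO [x0 ix0]]] := bO.
have [[cf [_ df]] _] := Wf; have [[_ [_ dNf]] _] := WNf.
have cnf : {within Om, continuous (fun x => `|f x|)}.
  apply/within_estimateP => x e Ox e0.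
  have [r r0 hr] := (within_estimateP _ _).1 cf x e Ox e0.
  by exists r => // y Oy yr; apply: le_trans (ler_dist_dist _ _) (hr y Oy yr).
have [|x1 + hmax] := EVT_max_rV _ cpO cnf; first by exists x0; exact: interior_subset.
rewrite inE => Ox1; have {}hmax y : Om y -> `|f y| <= `|f x1|.
  by move=> Oy; apply: hmax; rewrite inE.
set M := `|f x1| in hmax.
have M0 : 0 <= M by exact: normr_ge0.
(* [C] depends on the maximum [M] itself; the bound [M <= C * h ^+ 2 / 4] is solved for [M] at the
   end, which is possible because [|q| * (h ^+ 2 / 4) < 1]. *)
pose C := 1 + `|q| * M.
have C0 : 0 <= C by rewrite addr_ge0 // mulr_ge0.
have sc : semiconvex Om C f.
  move=> y z t; apply: W_semiconvex bO Wf _ => w Ow.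
  by rewrite lerD2l ler_wpM2l // hmax.
have scN : semiconvex Om C (fun x => - f x).
  move=> y z t; apply: W_semiconvex bO WNf _ => w Ow.
  by rewrite lerD2l ler_wpM2l // normrN hmax.
have MC : M <= C * h ^+ 2 / 4.
  rewrite /M; have [f10|f10] := leP 0 (f x1).
    rewrite ger0_norm //; apply: (zero_info_max cO nc h0 C0 sc scN df) => //.
      by move=> y /fxi[].
    move=> y Oy; apply: le_trans (ler_norm _) (le_trans (hmax y Oy) _).
    by rewrite /M ger0_norm.
  rewrite ltr0_norm //; apply: (@zero_info_max Om xi h C (fun x => - f x) G' x1 cO nc h0 C0 scN _ dNf) => //.
  - by have -> : (fun x => - - f x) = f by apply/funext => z; rewrite opprK.
  - by move=> y /fxi[-> _ ->]; rewrite oppr0.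
  - move=> y Oy; apply: le_trans (ler_norm _) _; rewrite normrN.
    by apply: le_trans (hmax y Oy) _; rewrite /M ltr0_norm.
move=> x Ox; apply: le_trans (hmax x Ox) _.
rewrite ler_pdivlMr ?subr_gt0 //.
move: MC; rewrite /C; lra.
Qed.

End UpperBound.

(** * Continuous reconstruction by the Chebyshev centre *)

Section ChebyshevCentre.
Variables (R : realType) (d : nat).
Implicit Types (x y z u v m p : 'rV[R]_d) (Om : set 'rV[R]_d).

Lemma compact_enorm_bounded Om : compact Om ->
  exists2 D : R, 0 <= D & forall x y, Om x -> Om y -> enorm (x - y) <= D.
Proof.
move=> /compact_bounded [M [_ hM]].
pose M1 := `|M| + 1; have M1p : 0 <= M1 by rewrite addr_ge0.
have hM1 x : Om x -> `|x| <= M1.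
  by move=> Ox; apply: hM Ox; rewrite (le_lt_trans (ler_norm M)) // ltrDl.
exists (Num.sqrt d%:R * (M1 + M1)); first by rewrite mulr_ge0 ?sqrtr_ge0 // addr_ge0.
move=> x y Ox Oy; apply: le_trans (enorm_le_mx_norm _) _.
rewrite ler_wpM2l ?sqrtr_ge0 //; apply: le_trans (ler_normB _ _) _.
by rewrite lerD ?hM1.
Qed.

(* The Lipschitz constant does not depend on f: differences of functions of the
   class with equal data are equicontinuous. *)
Lemma semiconvex_lipschitz Om (C B : R) (x0 : 'rV[R]_d) (r : R) : Defs.convex_set Om -> compact Om ->
  0 < r -> eball x0 r `<=` Om -> 0 <= C -> 0 <= B ->
  exists2 K : R, 0 <= K & forall f, semiconvex Om C f -> semiconvex Om C (fun x => - f x) ->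
   (forall x, Om x -> `|f x| <= B) ->
   forall x y, Om x -> Om y -> enorm (x - y) < r -> `|f x - f y| <= K * enorm (x - y).
Proof.
move=> cO cpO r0 rO C0 B0; have [D D0 hD] := compact_enorm_bounded cpO.
(* [2 * B] bounds an increment of [f], the other term the semiconvexity defect on a body of diameter
   at most [D]. *)
pose K := 2 * B + C * D ^+ 2 / 2.
have K0 : 0 <= K by rewrite addr_ge0 ?mulr_ge0 // ?invr_ge0 // sqr_ge0.
exists (2 * K / r); first by rewrite divr_ge0 ?mulr_ge0 // ltW.
move=> f sc scN fB.
have half g z p s : semiconvex Om C g -> (forall x, Om x -> `|g x| <= B) ->
    Om z -> Om p -> 0 <= s <= 1 -> g ((1 - s) *: z + s *: p) - g z <= s * K.
  move=> scg gB Oz Op s01; have := scg z p s Oz Op s01; have /andP[s0 s1] := s01.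
  have := gB z Oz; have := gB p Op; rewrite !ler_norml => /andP[_ gp] /andP[gz _].
  have zp : enorm (z - p) ^+ 2 <= D ^+ 2.
    by rewrite lerXn2r ?nnegrE ?enorm_ge0 // hD.
  have h1 : C * s * (1 - s) * enorm (z - p) ^+ 2 / 2 <= s * (C * D ^+ 2 / 2).
    have -> : C * s * (1 - s) * enorm (z - p) ^+ 2 / 2 =
      s * (C * ((1 - s) * enorm (z - p) ^+ 2) / 2) by ring.
    rewrite ler_wpM2l // ler_wpM2r ?invr_ge0 // ler_wpM2l //.
    apply: le_trans zp; rewrite ler_piMl ?sqr_ge0 //; lra.
  have h2 : s * (g p - g z) <= s * (2 * B) by rewrite ler_wpM2l //; lra.
  rewrite /K; lra.
have move z p s : Om z -> Om p -> 0 <= s <= 1 -> `|f ((1 - s) *: z + s *: p) - f z| <= s * K.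
  move=> Oz Op s01; rewrite ler_norml half // andbT lerNl opprB.
  have := half (fun x => - f x) z p s scN; rewrite opprK addrC; apply => //.
  by move=> x Ox; rewrite normrN fB.
move=> x y Ox Oy; set dl := enorm (x - y) => dlr.
have [xy0|xyn0] := eqVneq x y.
  by rewrite xy0 subrr normr0 mulr_ge0 ?divr_ge0 ?mulr_ge0 ?enorm_ge0 // ltW.
have dl0 : 0 < dl.
  rewrite lt_neqAle enorm_ge0 andbT eq_sym; apply: contra xyn0 => /eqP/enorm_eq0/eqP.
  by rewrite subr_eq0.
pose s := dl / r.
have s0 : 0 < s by rewrite divr_gt0.
have s1 : s < 1 by rewrite ltr_pdivrMr // mul1r.
have s01 : 0 <= s <= 1 by rewrite !ltW.
(* [p] solves [(1 - s) x + s x0 = (1 - s) y + s p]: moving [x] towards [x0] and [y] towards [p]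
   leads to the same point, and [|p - x0| <= r] because [s = dl / r]. *)
pose p : 'rV[R]_d := x0 + ((1 - s) / s) *: (x - y).
have Op : Om p.
  apply: rO; rewrite /eball /= /p addrC addKr enormZ ger0_norm; last first.
    by rewrite divr_ge0 ?subr_ge0 // ltW.
  rewrite -/dl; have -> : (1 - s) / s * dl = (1 - s) * r.
    by rewrite /s; field; rewrite !gt_eqF.
  by rewrite ler_piMl ?(ltW r0) //; lra.
have Ox0 : Om x0 by apply: rO; exact/eball_center/ltW.
have E : (1 - s) *: x + s *: x0 = (1 - s) *: y + s *: p.
  by apply/rowP => i; rewrite !mxE; field; rewrite gt_eqF.
have := move x x0 s Ox Ox0 s01; have := move y p s Oy Op s01; rewrite E => h1 h2.
have -> : 2 * K / r * dl = s * K + s * K by rewrite /s; ring.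
set w := f _ in h1 h2; rewrite distrC in h2.
have -> : f x - f y = (f x - w) + (w - f y) by ring.
by apply: le_trans (ler_normD _ _) _; rewrite lerD.
Qed.

Lemma info_eq0 (xi : seq 'rV[R]_d) (f1 f2 : 'rV[R]_d -> R) (G1 G2 : 'rV[R]_d -> 'rV[R]_d) :
  info xi f1 G1 = info xi f2 G2 -> forall y, y \in xi -> f1 y = f2 y /\ G1 y = G2 y.
Proof.
elim: xi => // a xi IH [e1 e2 e3] y; rewrite inE => /predU1P[->//|yxi].
exact: IH.
Qed.

(** Functions with the same data differ by at most [2 * B], so the midpoint between the extreme
    possible values is within [B] of all of them. *)
Lemma R_xi_le (q : R) Om (xi : seq 'rV[R]_d) (h : R) :
  convex_body Om -> node_cover Om xi h -> 0 <= h -> `|q| * (h ^+ 2 / 4) < 1 ->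
  (R_xi q Om xi <= ((h ^+ 2 / 4) / (1 - `|q| * (h ^+ 2 / 4)))%:E)%E.
Proof.
move=> bO nc h0 qh; set B := _ / _; have [cpO [cO [x0 /interior_eball[r r0 rO]]]] := bO.
have B0 : 0 <= B by rewrite divr_ge0 ?divr_ge0 ?sqr_ge0 // subr_ge0 ltW.
pose C := 1 + `|q| * B.
have C0 : 0 <= C by rewrite addr_ge0 // mulr_ge0.
pose S I x := [set f x | f in [set f : 'rV[R]_d -> R |
  exists2 G, W_class q Om f G & info xi f G = I]].
have diff f1 G1 f2 G2 : W_class q Om f1 G1 -> W_class q Om f2 G2 ->
    info xi f1 G1 = info xi f2 G2 ->
    [/\ W_class q Om (fun x => (f1 x - f2 x) / 2) (fun x => 2^-1 *: (G1 x - G2 x)),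
     W_class q Om (fun x => - ((f1 x - f2 x) / 2)) (fun x => 2^-1 *: (G2 x - G1 x)) &
     forall x, Om x -> `|(f1 x - f2 x) / 2| <= B].
  move=> W1 W2 /info_eq0 i12; have W12 := W_half_diff W1 W2.
  have W21 : W_class q Om (fun x => - ((f1 x - f2 x) / 2)) (fun x => 2^-1 *: (G2 x - G1 x)).
    have -> : (fun x => - ((f1 x - f2 x) / 2)) = (fun x => (f2 x - f1 x) / 2).
      by apply/funext => x; ring.
    exact: W_half_diff.
  split => //; apply: zero_info_bound bO nc h0 qh W12 W21 _ => y /i12[-> ->].
  by rewrite !subrr mul0r scaler0.
have [K K0 hK] := semiconvex_lipschitz cO cpO r0 rO C0 B0.
have lip f1 G1 f2 G2 : W_class q Om f1 G1 -> W_class q Om f2 G2 ->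
    info xi f1 G1 = info xi f2 G2 -> forall x y, Om x -> Om y -> enorm (x - y) < r ->
    f1 x - f2 x <= f1 y - f2 y + 2 * K * enorm (x - y).
  move=> W1 W2 i12 x y Ox Oy xyr; have [W12 W21 B12] := diff _ _ _ _ W1 W2 i12.
  have hC z : Om z -> 1 + `|q| * `|(f1 z - f2 z) / 2| <= C.
    by move=> Oz; rewrite lerD2l ler_wpM2l // B12.
  have hCN z : Om z -> 1 + `|q| * `|- ((f1 z - f2 z) / 2)| <= C.
    by move=> Oz; rewrite normrN hC.
  have := hK (fun x => (f1 x - f2 x) / 2).
  move=> /(_ (fun x y t => W_semiconvex bO W12 hC) (fun x y t => W_semiconvex bO W21 hCN) B12).
  by move=> /(_ x y Ox Oy xyr); rewrite ler_norml; lra.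
(* Data that no function of the class produces get the value 0, so that [phi I] is continuous for
   every [I]. *)
pose phi I x := if `[< exists f G, W_class q Om f G /\ info xi f G = I >]
  then (sup (S I x) + inf (S I x)) / 2 else 0.
have Sbnd f G x : W_class q Om f G -> Om x ->
   [/\ S (info xi f G) x !=set0, ubound (S (info xi f G) x) (f x + 2 * B) &
       lbound (S (info xi f G) x) (f x - 2 * B)].
  move=> Wf Ox; split; first by exists (f x), f => //; exists G.
    move=> _ [g [G' Wg ig] <-]; have [_ _ /(_ x Ox)] := diff _ _ _ _ Wg Wf ig.
    by rewrite ler_norml; lra.
  move=> _ [g [G' Wg ig] <-]; have [_ _ /(_ x Ox)] := diff _ _ _ _ Wg Wf ig.
  by rewrite ler_norml; lra.
apply: (@le_trans _ _ (alg_error q Om xi phi)).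
  apply: ereal_inf_lbound; exists phi => // I.
  apply/within_estimateP => x e Ox e0; rewrite /phi.
  have [[f [G [Wf <-]]]|nex] := pselect (exists f G, W_class q Om f G /\ info xi f G = I); last first.
    exists 1 => // y _ _; rewrite (introF (asboolP _) nex) subrr normr0; exact: ltW.
  have [[cf _] _] := Wf.
  have [r1 r10 h1] := (within_estimateP _ _).1 cf x (e / 2) Ox (divr_gt0 e0 (ltr0n R 2)).
  pose rr := Num.min r1 (Num.min (r / 2) (e / (4 * K + 1))).
  have K1 : 0 < 4 * K + 1 by rewrite ltr_wpDl // mulr_ge0.
  exists rr; first by rewrite !lt_min r10 !divr_gt0.
  move=> y Oy; rewrite !le_min => /and3P[yr1 yr yre].
  have {}yr : enorm (y - x) < r by lra.
  have yrK : 2 * K * enorm (y - x) <= e / 2.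
    move: yre; rewrite ler_pdivlMr //; have := enorm_ge0 (y - x); lra.
  (* By [lip], [sup - f] and [inf - f] change by at most [e / 2] between nearby points; the
     continuity of [f] supplies the other half. *)
  have shift x1 x2 : Om x1 -> Om x2 -> enorm (x1 - x2) = enorm (y - x) ->
      sup (S (info xi f G) x1) <= f x1 - f x2 + sup (S (info xi f G) x2) + e / 2 /\
      f x1 - f x2 + inf (S (info xi f G) x2) - e / 2 <= inf (S (info xi f G) x1).
    move=> O1 O2 E12.
    have [n1 u1 l1] := Sbnd f G x1 Wf O1; have [n2 u2 l2] := Sbnd f G x2 Wf O2.
    split.
      apply: ge_sup => // _ [g [G' Wg ig] <-].
      have := lip _ _ _ _ Wg Wf ig x1 x2 O1 O2; rewrite E12 => /(_ yr).
      have : g x2 <= sup (S (info xi f G) x2).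
        by apply: ub_le_sup; [exists (f x2 + 2 * B)|exists g => //; exists G'].
      lra.
    apply: lb_le_inf => // _ [g [G' Wg ig] <-].
    have := lip _ _ _ _ Wf Wg (esym ig) x1 x2 O1 O2; rewrite E12 => /(_ yr).
    have : inf (S (info xi f G) x2) <= g x2.
      by apply: ge_inf; [exists (f x2 - 2 * B)|exists g => //; exists G'].
    lra.
  have [a1 a2] := shift y x Oy Ox erefl.
  have [b1 b2] := shift x y Ox Oy (enormB _ _).
  have ex : exists f0 G0, W_class q Om f0 G0 /\ info xi f0 G0 = info xi f G by exists f, G.
  rewrite (introT (asboolP _) ex).
  have := h1 y Oy yr1; rewrite !ler_norml => /andP[c1 c2]; apply/andP; split; lra.
apply: ge_ereal_sup => _ [f [G [x [Wf [Ox ->]]]]]; rewrite lee_fin.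
have ex : exists f0 G0, W_class q Om f0 G0 /\ info xi f0 G0 = info xi f G by exists f, G.
rewrite /phi (introT (asboolP _) ex).
have [n1 u1 l1] := Sbnd f G x Wf Ox.
have Sfx : S (info xi f G) x (f x) by exists f => //; exists G.
have fs : f x <= sup (S (info xi f G) x) by apply: ub_le_sup => //; exists (f x + 2 * B).
have fi : inf (S (info xi f G) x) <= f x by apply: ge_inf => //; exists (f x - 2 * B).
have si : sup (S (info xi f G) x) <= inf (S (info xi f G) x) + 2 * B.
  apply: ge_sup => // _ [g [G' Wg ig] <-].
  rewrite -lerBlDr; apply: lb_le_inf => // _ [g' [G'' Wg' ig'] <-].
  have [_ _ /(_ x Ox)] := diff _ _ _ _ Wg Wg' (etrans ig (esym ig')).
  by rewrite ler_norml; lra.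
rewrite ler_norml; lra.
Qed.

End ChebyshevCentre.

(** * Grid cells and convex bodies *)

Section Cells.
Variables (R : realType) (d : nat).
Hypothesis d0 : (0 < d)%N.
Implicit Types (x y z v w : 'rV[R]_d) (A : set 'rV[R]_d).

Lemma cube_boxE (T : R) : cube T = box (const_mx (- T)) (const_mx (- T) + const_mx (2 * T)) :> set 'rV[R]_d.
Proof.
apply/seteqP; split => x xT i; have := xT i; rewrite !mxE => /andP[? ?]; apply/andP; split; lra.
Qed.

Section Grid.
Variables (m : nat) (s : R).
Hypotheses (m0 : (0 < m)%N) (s0 : 0 < s).
Implicit Types (k : {ffun 'I_d -> 'I_m}).

(* The cells are the m^d cubes of side s that tile [cube half_side]. *)
Definition half_side : R := m%:R * s / 2.

Definition cell k : set 'rV[R]_d :=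
  box (gridpt (const_mx (- half_side)) s k)
      (gridpt (const_mx (- half_side)) s k + const_mx s).

Definition meeting A := finset (fun k => `[< exists2 x, cell k x & A x >]).
Definition inside A := finset (fun k => `[< cell k `<=` A >]).

Lemma cell_vol k : box_vol (gridpt (const_mx (- half_side)) s k)
  (gridpt (const_mx (- half_side)) s k + const_mx s) = s ^+ d.
Proof.
rewrite -[in RHS](card_ord d) -prodr_const; apply: eq_bigr => i _.
by rewrite !mxE addrAC subrr add0r max_r // ltW.
Qed.

Lemma cell_diam k x y : cell k x -> cell k y -> enorm (x - y) <= Num.sqrt d%:R * s.
Proof.
move=> kx ky; apply: enorm_le_coord; first exact: ltW.
move=> i; have /andP[] := kx i; have /andP[] := ky i; rewrite !mxE ler_norml => *.
by apply/andP; split; lra.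
Qed.

Lemma cell_exists x : cube half_side x -> exists k, cell k x.
Proof.
move=> xT; have mlt : (m.-1 < m)%N by rewrite prednK.
have key i : exists j : 'I_m, - half_side + s * j%:R <= x 0 i <= - half_side + s * j%:R + s.
  have /andP[xl xr] := xT i; pose a := (x 0 i + half_side) / s.
  have a0 : 0 <= a by rewrite divr_ge0 ?(ltW s0) //; lra.
  have xE : x 0 i = - half_side + s * a by rewrite /a; field; rewrite gt_eqF.
  have /andP[] := truncn_itv a0; set j := Num.truncn a => ja aj.
  have sja : s * j%:R <= s * a by rewrite ler_wpM2l // ltW.
  have [jm|mj] := ltnP j m.
    exists (Ordinal jm); rewrite xE /=.
    have : s * a <= s * j.+1%:R by rewrite ler_wpM2l ?ltW.
    by rewrite -natr1 => *; apply/andP; split; lra.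
  (* Only on the upper face [x 0 i = half_side] is the integer part as large as [m]; the last closed
     cell takes that point. *)
  exists (Ordinal mlt); rewrite /=.
  have am : a <= m%:R.
    rewrite /a ler_pdivrMr //; move: xr; rewrite /half_side; lra.
  have mE : m%:R = m.-1%:R + 1 :> R by rewrite natr1 prednK.
  have mja : m%:R <= a by apply: le_trans ja; rewrite ler_nat.
  have am' : a = m%:R by apply/eqP; rewrite eq_le am.
  rewrite xE am' mE mulrDr mulr1; have := s0 => s0'; apply/andP; split; lra.
have [k hk] := choice key; exists [ffun i => k i] => i.
by rewrite !mxE ffunE; exact: hk.
Qed.

Lemma meeting_cover A : A `<=` cube half_side ->
  A `<=` \big[setU/set0]_(k in meeting A) cell k.
Proof.
move=> AT x Ax; have [k kx] := cell_exists (AT x Ax).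
rewrite -bigcup_seq_cond; exists k => //=; rewrite mem_index_enum /= inE.
by apply/asboolP; exists x.
Qed.

Lemma boxcover_cells (K : {set {ffun 'I_d -> 'I_m}}) :
  boxcover (\big[setU/set0]_(k in K) cell k) (#|K|%:R * s ^+ d).
Proof.
have -> : #|K|%:R * s ^+ d = \sum_(k in K) s ^+ d by rewrite sumr_const mulr_natl.
by apply: (boxcover_bigsetU d0) => k _; rewrite -(cell_vol k); exact: boxcover_box.
Qed.

Lemma boxcover_meeting A : A `<=` cube half_side ->
  boxcover A (#|meeting A|%:R * s ^+ d).
Proof. by move=> /meeting_cover AK; apply: boxcoverS AK (boxcover_cells _). Qed.

(** A lower bound for an outer measure by complementation: the whole cube has at least its volume,
    and the remaining cells have at most theirs. *)
Lemma lebR_cells (K : {set {ffun 'I_d -> 'I_m}}) :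
  #|K|%:R * s ^+ d <= lebR (\big[setU/set0]_(k in K) cell k).
Proof.
have T0 : 0 < 2 * half_side.
  by rewrite /half_side mulrC divfK ?pnatr_eq0 // mulr_gt0 // ltr0n.
pose KC := finset (fun k => k \notin K).
have cubeU : cube half_side `<=`
    \big[setU/set0]_(k in K) cell k `|` \big[setU/set0]_(k in KC) cell k.
  move=> x /cell_exists[k kx]; have [kK|kK] := boolP (k \in K).
    by left; rewrite -bigcup_seq_cond; exists k; rewrite //= mem_index_enum.
  by right; rewrite -bigcup_seq_cond; exists k; rewrite //= mem_index_enum inE.
have bU := boxcoverU (boxcover_cells K) (boxcover_cells KC).
have h1 : (2 * half_side) ^+ d <= lebR (\big[setU/set0]_(k in K) cell k) +
    lebR (\big[setU/set0]_(k in KC) cell k).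
  apply: le_trans (lebRU (boxcover_cells K) (boxcover_cells KC)).
  apply/ler_addgt0Pr => e e0.
  apply: (@cube_le_boxcover R d (const_mx (- half_side)) _ _ T0).
  rewrite -cube_boxE; apply: boxcoverS cubeU _; exact: boxcover_lebR bU e0.
have h2 := lebR_le (boxcover_cells KC).
have h3 : (2 * half_side) ^+ d = #|K|%:R * s ^+ d + #|KC|%:R * s ^+ d.
  rewrite -mulrDl -natrD.
  have -> : (#|K| + #|KC| = m ^ d)%N.
    have -> : KC = (~: K)%SET by apply/setP => k; rewrite !inE.
    by rewrite cardsC card_ffun !card_ord.
  by rewrite /half_side mulrC divfK ?pnatr_eq0 // exprMn natrX.
lra.
Qed.

Lemma lebR_inside A (v : R) : boxcover A v -> #|inside A|%:R * s ^+ d <= lebR A.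
Proof.
move=> Av; apply: le_trans (lebR_cells (inside A)) _; apply: lebRS Av _ => x.
rewrite -bigcup_seq_cond => -[k /= /andP[_]]; rewrite inE => /asboolP; exact.
Qed.

End Grid.

Section Dilation.
Variables (Om : set 'rV[R]_d) (x0 : 'rV[R]_d) (r : R).
Hypotheses (cO : Defs.convex_set Om) (r0 : 0 < r) (rO : eball x0 r `<=` Om).

Definition dil (l : R) : set 'rV[R]_d := [set l *: w + (1 - l) *: x0 | w in Om].

Lemma dil1 : dil 1 = Om.
Proof.
apply/seteqP; split => [_ [w Ow <-]|x Ox]; first by rewrite subrr scale0r addr0 scale1r.
by exists x => //; rewrite subrr scale0r addr0 scale1r.
Qed.

(** With [x0] as origin, convexity gives that [l Om + (l' - l) Om] lies in [l' Om], and the second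
    summand contains the ball of radius [(l' - l) r]. *)
Lemma dil_fatten (l l' : R) x v : 0 <= l -> l < l' -> dil l x -> enorm v <= (l' - l) * r ->
  dil l' (x + v).
Proof.
move=> l0 ll' [w Ow <-] vr; have l'0 : 0 < l' by exact: le_lt_trans ll'.
have dl : 0 < l' - l by rewrite subr_gt0.
pose w' : 'rV[R]_d := x0 + (l' - l)^-1 *: v.
have Ow' : Om w'.
  apply: rO; rewrite /eball /= /w' addrC addKr enormZ ger0_norm ?invr_ge0 ?(ltW dl) //.
  by rewrite ler_pdivrMl.
exists ((1 - (l' - l) / l') *: w + ((l' - l) / l') *: w').
  apply: cO => //; apply/andP; split; first by rewrite divr_ge0 // ltW.
  by rewrite ler_pdivrMr //; lra.
by apply/rowP => i; rewrite !mxE; field; rewrite !gt_eqF.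
Qed.

Lemma dil_cell m (s l l' : R) (k : {ffun 'I_d -> 'I_m}) : 0 < s -> 0 <= l -> l < l' ->
  Num.sqrt d%:R * s <= (l' - l) * r -> k \in meeting m s (dil l) -> cell s k `<=` dil l'.
Proof.
move=> s0 l0 ll' sr; rewrite inE => /asboolP[x kx lx] y ky.
rewrite -(subrKC x y); apply: dil_fatten lx _ => //.
exact: le_trans (cell_diam s0 ky kx) sr.
Qed.

Lemma meeting_inside m (s l l' : R) : 0 < s -> 0 <= l -> l < l' ->
  Num.sqrt d%:R * s <= (l' - l) * r ->
  meeting m s (dil l) \subset inside m s (dil l').
Proof.
move=> s0 l0 ll' sr; apply/fintype.subsetP => k kl; rewrite inE; apply/asboolP.
exact: dil_cell kl.
Qed.

Variable v0 : R.
Hypothesis Ov : boxcover Om v0.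

Lemma boxcover_dil (l : R) : 0 < l -> boxcover (dil l) (l ^+ d * v0).
Proof. by move=> l0; exact: boxcover_affine. Qed.

Lemma lebR_dil (l : R) : 0 < l -> lebR (dil l) = l ^+ d * lebR Om.
Proof. by move=> l0; rewrite /dil (lebR_affine _ l0 Ov). Qed.

Lemma meeting_ge m (s l : R) : (0 < m)%N -> 0 < s -> 0 < l -> dil l `<=` cube (half_side m s) ->
  l ^+ d * lebR Om <= #|meeting m s (dil l)|%:R * s ^+ d.
Proof.
move=> m0 s0 l0 lT; rewrite -lebR_dil //; apply: lebR_le.
exact: boxcover_meeting.
Qed.

Lemma inside_le m (s l : R) : (0 < m)%N -> 0 < s -> 0 < l ->
  #|inside m s (dil l)|%:R * s ^+ d <= l ^+ d * lebR Om.
Proof.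
move=> m0 s0 l0; rewrite -lebR_dil //; apply: lebR_inside => //; exact: boxcover_dil.
Qed.

Lemma meeting_le m (s l l' : R) : (0 < m)%N -> 0 < s -> 0 < l -> l < l' ->
  Num.sqrt d%:R * s <= (l' - l) * r ->
  #|meeting m s (dil l)|%:R * s ^+ d <= l' ^+ d * lebR Om.
Proof.
move=> m0 s0 l0 ll' sr; apply: le_trans (inside_le m0 s0 (lt_trans l0 ll')).
rewrite ler_wpM2r ?exprn_ge0 ?(ltW s0) // ler_nat subset_leq_card //.
exact: meeting_inside (ltW l0) ll' sr.
Qed.

(** Cells are so small that those meeting [dil (1 - 2 * e)] lie in [dil (1 - e)]. The cells of the
    shell are therefore among those meeting [Om] but not [dil (1 - 2 * e)], and the two counts are
    compared with volumes. *)
Lemma meeting_shell m (s e : R) : (0 < m)%N -> 0 < s -> 0 < e -> 2 * e < 1 ->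
  Num.sqrt d%:R * s <= e * r -> Om `<=` cube (half_side m s) ->
  #|meeting m s (Om `\` dil (1 - e))|%:R * s ^+ d <=
    ((1 + e) ^+ d - (1 - 2 * e) ^+ d) * lebR Om.
Proof.
move=> m0 s0 e0 e1 sr OT.
have e2 : 0 < 1 - 2 * e by lra.
have sr1 : Num.sqrt d%:R * s <= (1 - e - (1 - 2 * e)) * r.
  by have -> : 1 - e - (1 - 2 * e) = e by ring.
have sr2 : Num.sqrt d%:R * s <= (1 + e - 1) * r by rewrite addrAC subrr add0r.
have h1 := meeting_le m0 s0 ltr01 (_ : 1 < 1 + e) sr2.
have {}h1 := h1 (ltac:(lra)).
have dO : dil (1 - 2 * e) `<=` dil 1.
  move=> x xl; rewrite -[x]addr0; apply: dil_fatten xl _; try lra.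
  by rewrite enorm0 mulr_ge0 ?(ltW r0) //; lra.
rewrite dil1 in dO.
have h2 := meeting_ge m0 s0 e2 (subset_trans dO OT).
have sub : (meeting m s (Om `\` dil (1 - e))) \subset
    (meeting m s (dil 1) :\: meeting m s (dil (1 - 2 * e)))%SET.
  apply/fintype.subsetP => k; rewrite dil1 inE => /asboolP[x kx [Ox nx]].
  rewrite finset.in_setD; apply/andP; split; last by rewrite inE; apply/asboolP; exists x.
  apply/negP => kl; apply: nx; move: x kx {Ox}.
  by apply: dil_cell kl => //; lra.
have sub2 : (meeting m s (dil (1 - 2 * e))) \subset (meeting m s (dil 1)).
  apply/fintype.subsetP => k; rewrite inE => /asboolP[x kx xl].
  by rewrite inE dil1; apply/asboolP; exists x; [exact: kx|exact: dO xl].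
have := subset_leq_card sub; rewrite cardsD (finset.setIidPr sub2) => hc.
have : #|meeting m s (Om `\` dil (1 - e))|%:R <=
    #|meeting m s (dil 1)|%:R - #|meeting m s (dil (1 - 2 * e))|%:R :> R.
  by rewrite -natrB ?ler_nat // subset_leq_card.
have sd0 : 0 <= s ^+ d by rewrite exprn_ge0 // ltW.
move=> /(ler_wpM2r sd0); rewrite mulrBl; lra.
Qed.

End Dilation.
End Cells.

(** * Volume of convex bodies, their boundaries and balls *)

Section ConvexBodies.
Variables (R : realType) (d : nat).
Hypothesis d0 : (0 < d)%N.
Implicit Types (x y z c : 'rV[R]_d) (Om : set 'rV[R]_d).

Lemma compact_sub_cube Om : compact Om -> exists2 T : R, 0 < T & Om `<=` cube T.
Proof.
move=> /compact_bounded [M [_ hM]]; exists (`|M| + 1); first by rewrite ltr_wpDl.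
move=> x Ox i; have : `|x| <= `|M| + 1.
  by apply: hM Ox; rewrite (le_lt_trans (ler_norm M)) // ltrDl.
by move/(le_trans (mx_norm_coord x i)); rewrite ler_norml.
Qed.

Lemma boxcover_cube (T : R) : 0 < T -> boxcover (cube T : set 'rV[R]_d) ((2 * T) ^+ d).
Proof.
move=> T0; rewrite cube_boxE.
have -> : (2 * T) ^+ d = box_vol (const_mx (- T)) (const_mx (- T) + const_mx (2 * T) : 'rV[R]_d).
  rewrite -[in LHS](card_ord d) -prodr_const; apply: eq_bigr => i _.
  by rewrite !mxE addrAC subrr add0r max_r // mulr_ge0 // ltW.
exact: boxcover_box.
Qed.

Lemma compact_boxcover Om : compact Om -> exists v : R, boxcover Om v.
Proof.
by move=> /compact_sub_cube[T T0 OT]; exists ((2 * T) ^+ d); apply: boxcoverS OT (boxcover_cube T0).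
Qed.

Lemma shell_small (mu eta : R) : 0 < eta ->
  exists2 e1 : R, 0 < e1 & forall e, 0 < e < e1 -> ((1 + e) ^+ d - (1 - 2 * e) ^+ d) * mu <= eta.
Proof.
move=> eta0; apply: near_right0_ex.
pose p : {poly R} := ((1 + 'X) ^+ d - (1 - 2%:P * 'X) ^+ d) * mu%:P.
have pE t : p.[t] = ((1 + t) ^+ d - (1 - 2 * t) ^+ d) * mu by rewrite /p !hornerE.
have c : p.[t] @[t --> 0^'+] --> p.[0] by apply: cvg_at_right_filter; exact: continuous_horner.
have /cvgrPdist_le/(_ _ eta0) := c; apply: filterS => t.
by rewrite !pE mulr0 addr0 subr0 subrr mul0r sub0r normrN => /ler_normlW.
Qed.

Lemma mesh_exists (T s0 : R) : 0 < T -> 0 < s0 ->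
  exists2 m, (0 < m)%N & 2 * T / m%:R <= s0.
Proof.
move=> T0 s00; have Ts : 0 < 2 * T / s0 by rewrite divr_gt0 // mulr_gt0.
have h := truncnS_gt (2 * T / s0); exists (Num.truncn (2 * T / s0)).+1 => //.
by rewrite ler_pdivrMr ?ltr0n // [leRHS]mulrC -ler_pdivrMr // ltW.
Qed.

Lemma half_sideE (T : R) m : (0 < m)%N -> half_side m (2 * T / m%:R) = T.
Proof. by move=> m0; rewrite /half_side; field; rewrite pnatr_eq0 -lt0n. Qed.

(** Points of [dil (1 - e)] have a ball of radius [e * r] around them inside [Om], so boundary
    points lie in the shell, whose cells have small total volume. *)
Lemma boundary_null Om : convex_body Om -> Defs.negligible (Om `\` interior Om).
Proof.
move=> [cpO [cO [x0 /interior_eball[r r0 rO]]]].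
have [v Ov] := compact_boxcover cpO; have [T T0 OT] := compact_sub_cube cpO.
apply/leb_nullP => eta eta0.
have [e1 e10 he] := shell_small (lebR Om) eta0.
pose e := Num.min (e1 / 2) (1 / 3).
have e0 : 0 < e by rewrite lt_min !divr_gt0.
have ee1 : e <= e1 / 2 by rewrite ge_min lexx.
have e3 : e <= 1 / 3 by rewrite ge_min lexx orbT.
have sd : 0 < Num.sqrt d%:R + 1 :> R by rewrite ltr_wpDl ?sqrtr_ge0.
have [m m0 hm] := mesh_exists T0 (divr_gt0 (mulr_gt0 e0 r0) sd).
set s := 2 * T / m%:R in hm.
have s0 : 0 < s by rewrite divr_gt0 ?mulr_gt0 ?ltr0n.
have sr : Num.sqrt d%:R * s <= e * r.
  move: hm; rewrite ler_pdivlMr // => hm; apply: le_trans hm.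
  by rewrite mulrC ler_wpM2l ?lerDl // ltW.
have OTs : Om `<=` cube (half_side m s) by rewrite half_sideE.
have sub : Om `\` interior Om `<=` Om `\` dil Om x0 (1 - e).
  move=> x [Ox nix]; split => // xl; apply: nix; apply/interior_eball.
  exists (e * r); first by rewrite mulr_gt0.
  move=> y yx; have e1' : 0 <= 1 - e by lra.
  have e1'' : 1 - e < 1 by lra.
  have := dil_fatten cO rO e1' e1'' xl (v := y - x); rewrite dil1 subrKC; apply.
  by have -> : 1 - (1 - e) = e by ring.
apply: boxcoverS sub _.
have OTd : Om `\` dil Om x0 (1 - e) `<=` cube (half_side m s) by move=> x [/OTs].
apply: boxcover_le (boxcover_meeting d0 m0 s0 OTd).
apply: le_trans (meeting_shell d0 cO r0 rO Ov m0 s0 e0 _ sr OTs) _; first by lra.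
apply: he; apply/andP; split; lra.
Qed.

Lemma closed_eball c (rho : R) : closed (eball c rho).
Proof.
rewrite -openC openE => x /= /negP; rewrite -ltNge => xr.
apply/nbhs_eball; exists ((enorm (x - c) - rho) / 2); first by rewrite divr_gt0 // subr_gt0.
move=> y yx; have {}yx : enorm (y - x) <= (enorm (x - c) - rho) / 2 := yx.
rewrite /eball /=; apply/negP; rewrite -ltNge.
by have := enorm_tri y x c; rewrite (enormB x y); lra.
Qed.

Lemma compact_eball c (rho : R) : compact (eball c rho).
Proof.
have sub : eball c rho `<=` box (c - const_mx `|rho|) (c + const_mx `|rho|).
  move=> x xr i; have := le_trans (coord_le_enorm (x - c) i) (le_trans xr (ler_norm rho)).
  by rewrite !mxE ler_norml => /andP[? ?]; apply/andP; split; lra.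
exact: subclosed_compact (@closed_eball c rho) (@compact_box _ _ _ _) sub.
Qed.

Lemma convex_eball c (rho : R) : Defs.convex_set (eball c rho).
Proof.
move=> x y t xr yr /andP[t0 t1]; rewrite /eball /=.
have -> : (1 - t) *: x + t *: y - c = (1 - t) *: (x - c) + t *: (y - c).
  by apply/rowP => i; rewrite !mxE; ring.
apply: le_trans (enormD _ _) _; rewrite !enormZ !ger0_norm ?subr_ge0 //.
have h1 : (1 - t) * enorm (x - c) <= (1 - t) * rho by rewrite ler_wpM2l ?subr_ge0.
have h2 : t * enorm (y - c) <= t * rho by rewrite ler_wpM2l.
lra.
Qed.

Lemma convex_body_eball c (rho : R) : 0 < rho -> convex_body (eball c rho).
Proof.
move=> rho0; split; first exact: compact_eball.
split; first exact: convex_eball.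
by exists c; apply/interior_eball; exists rho.
Qed.

(** Serves the fooling function, whose second derivatives may fail to exist on two spheres. *)
Lemma sphere_null c (rho : R) : 0 < rho -> Defs.negligible [set x | enorm (x - c) = rho].
Proof.
move=> rho0; apply: leb_null_subset (boundary_null (convex_body_eball c rho0)) => x /= xr.
split; first by rewrite /eball /= xr.
move=> /interior_eball[r r0 hr].
have rr : 0 < r / rho by rewrite divr_gt0.
have E1 : enorm (x + (r / rho) *: (x - c) - x) = r.
  by rewrite addrC addKr enormZ xr gtr0_norm // divfK // gt_eqF.
have E2 : enorm (x + (r / rho) *: (x - c) - c) = rho + r.
  have -> : x + (r / rho) *: (x - c) - c = (1 + r / rho) *: (x - c).
    by apply/rowP => i; rewrite !mxE; ring.
  by rewrite enormZ xr gtr0_norm ?addr_gt0 // mulrDl mul1r divfK // gt_eqF.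
have := hr (x + (r / rho) *: (x - c)); rewrite /eball /= E1 E2 lexx => /(_ isT).
by rewrite gerDl leNgt r0.
Qed.

Lemma lebR_eball c (rho : R) : 0 < rho -> lebR (eball c rho) = rho ^+ d * nu R d.
Proof.
move=> rho0; have [v Bv] := compact_boxcover (@compact_eball 0 1).
have -> : eball c rho = [set rho *: x + c | x in eball 0 1].
  apply/seteqP; split => [x xr|_ [x xr <-]].
    exists (rho^-1 *: (x - c)); last by rewrite scalerA divff ?gt_eqF // scale1r subrK.
    by rewrite /eball /= subr0 enormZ ger0_norm ?invr_ge0 ?(ltW rho0) // ler_pdivrMl // mulr1.
  rewrite /eball /= addrK enormZ gtr0_norm // ger_pMr //.
  by have : enorm (x - 0) <= 1 := xr; rewrite subr0.
by rewrite (lebR_affine c rho0 Bv).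
Qed.

Lemma nu_gt0 : 0 < nu R d.
Proof.
have [v Bv] := compact_boxcover (@compact_eball 0 1).
have sd : 0 < Num.sqrt d%:R + 1 :> R by rewrite ltr_wpDl ?sqrtr_ge0.
pose t : R := (Num.sqrt d%:R + 1)^-1.
have t0 : 0 < t by rewrite invr_gt0.
have sub : box (const_mx (- t)) (const_mx (- t) + const_mx (2 * t)) `<=` eball (0 : 'rV[R]_d) 1.
  move=> x xb; rewrite /eball /= subr0.
  apply: (@le_trans _ _ (Num.sqrt d%:R * t)).
    apply: enorm_le_coord => [|i]; first exact: ltW.
    by have /andP[] := xb i; rewrite !mxE ler_norml => *; apply/andP; split; lra.
  by rewrite /t ler_pdivrMr // mul1r lerDl.
have t20 : 0 < 2 * t by rewrite mulr_gt0.
apply: lt_le_trans (_ : (2 * t) ^+ d <= _); first by rewrite exprn_gt0.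
apply/ler_addgt0Pr => e e0; apply: (cube_le_boxcover t20).
by apply: boxcoverS sub _; exact: boxcover_lebR Bv e0.
Qed.

End ConvexBodies.

(** * The fooling function *)

Lemma near_is_derive (R : realType) (f g : R -> R) (x D : R) :
  (\forall y \near x, f y = g y) -> is_derive x 1 f D -> is_derive x 1 g D.
Proof.
move=> fg df; have fgx := nbhs_singleton fg.
apply: estimate_is_derive => e e0.
have [r r0 hr] := is_derive_estimate df e0.
move: fg => /nbhs_ballP[r' /= r'0 hr']; exists (Num.min r r'); first by rewrite lt_min r0.
move=> y; rewrite lt_min => /andP[yr yr']; rewrite -fgx -(hr' y) ?hr //.
by rewrite -ball_normE /ball_ /= distrC.
Qed.

(** * Projection onto a ball and the Huber function *)

Section BallProjection.
Variables (R : realType) (d : nat).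
Implicit Types (z w p u v c : 'rV[R]_d) (rho : R).

(* [bproj rho] is the projection onto the ball of radius rho and the gradient of
   [huber rho]. *)
Definition bproj rho z : 'rV[R]_d := if enorm z <= rho then z else (rho / enorm z) *: z.

Definition huber rho z : R :=
  if enorm z <= rho then enorm z ^+ 2 / 2 else rho * enorm z - rho ^+ 2 / 2.

Lemma bproj_le rho z : 0 <= rho -> enorm (bproj rho z) <= rho.
Proof.
move=> rho0; rewrite /bproj; case: (leP (enorm z) rho) => // zr.
have z0 : 0 < enorm z by exact: le_lt_trans rho0 zr.
by rewrite enormZ ger0_norm ?divr_ge0 ?enorm_ge0 // divfK // gt_eqF.
Qed.

(** The obtuse angle criterion for the projection; it makes [bproj] nonexpansive. *)
Lemma bproj_variational rho z p : 0 <= rho -> enorm p <= rho ->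
  dotE (z - bproj rho z) (p - bproj rho z) <= 0.
Proof.
move=> rho0 pr; rewrite /bproj; case: (leP (enorm z) rho) => [_|zr]; first by rewrite subrr dotE0l.
have z0 : 0 < enorm z by exact: le_lt_trans rho0 zr.
have -> : z - (rho / enorm z) *: z = (1 - rho / enorm z) *: z by rewrite scalerBl scale1r.
rewrite dotEZl mulr_ge0_le0 //; first by rewrite subr_ge0 ler_pdivrMr // mul1r ltW.
rewrite dotEBr dotEZr -enorm_sqr subr_le0.
have -> : rho / enorm z * enorm z ^+ 2 = rho * enorm z by field; rewrite gt_eqF.
apply: le_trans (cauchy_schwarz _ _) _.
by rewrite mulrC ler_wpM2r // enorm_ge0.
Qed.

Lemma huberE rho z : 0 <= rho ->
  huber rho z = dotE (bproj rho z) z - dotE (bproj rho z) (bproj rho z) / 2.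
Proof.
move=> rho0; rewrite /huber /bproj; case: (leP (enorm z) rho) => [_|zr].
  by rewrite -enorm_sqr; lra.
have z0 : 0 < enorm z by exact: le_lt_trans rho0 zr.
by rewrite !dotEZl !dotEZr -enorm_sqr; field; rewrite gt_eqF.
Qed.

(** Together with [huberE], this presents [huber rho] as a maximum of affine functions over
    [|p| <= rho], attained at [bproj rho z]. Inserting the maximiser of one point at the other gives
    [huber_diff] without distinguishing regions. *)
Lemma huber_ge rho z p : 0 <= rho -> enorm p <= rho ->
  dotE p z - dotE p p / 2 <= huber rho z.
Proof.
move=> rho0 pr; rewrite huberE //.
have := bproj_variational z rho0 pr; have := dotE_ge0 (p - bproj rho z).
set b := bproj rho z; rewrite !dotEBl !dotEBr (dotEC z b) (dotEC z p) (dotEC b p); lra.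
Qed.

Lemma bproj_lipschitz rho z w : 0 <= rho ->
  enorm (bproj rho z - bproj rho w) <= enorm (z - w).
Proof.
move=> rho0; set a := bproj rho z; set b := bproj rho w.
have h1 : dotE (z - a) (b - a) <= 0 by apply: bproj_variational => //; exact: bproj_le.
have h2 : dotE (w - b) (a - b) <= 0 by apply: bproj_variational => //; exact: bproj_le.
have h3 : enorm (a - b) ^+ 2 <= enorm (z - w) * enorm (a - b).
  apply: le_trans (cauchy_schwarz (z - w) (a - b)).
  rewrite enorm_sqr; move: h1 h2; rewrite !dotEBl !dotEBr (dotEC b a); lra.
have [ab0|ab0] := eqVneq (enorm (a - b)) 0; first by rewrite ab0 enorm_ge0.
have abp : 0 < enorm (a - b) by rewrite lt_neqAle eq_sym ab0 enorm_ge0.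
by move: h3; rewrite expr2 ler_pM2r.
Qed.

Lemma huber_diff rho z w : 0 <= rho ->
  `|huber rho w - huber rho z - dotE (bproj rho z) (w - z)| <= enorm (w - z) ^+ 2.
Proof.
move=> rho0; have h1 := huber_ge w rho0 (bproj_le z rho0).
have h2 := huber_ge z rho0 (bproj_le w rho0).
have h3 : dotE (bproj rho w - bproj rho z) (w - z) <= enorm (w - z) ^+ 2.
  apply: le_trans (cauchy_schwarz _ _) _; rewrite expr2 ler_wpM2r ?enorm_ge0 //.
  exact: bproj_lipschitz.
have E1 := huberE z rho0; have E2 := huberE w rho0.
move: h1 h2 h3; have := enorm_ge0 (w - z) => /(exprn_ge0 2).
set D := enorm (w - z) ^+ 2; rewrite dotEBl !dotEBr ler_norml => *.
by apply/andP; split; lra.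
Qed.

Lemma bproj_in rho z : enorm z <= rho -> bproj rho z = z.
Proof. by rewrite /bproj => ->. Qed.

Lemma bproj_out rho z : rho < enorm z -> bproj rho z = (rho / enorm z) *: z.
Proof. by rewrite /bproj ltNge => /negbTE ->. Qed.

Lemma enorm_near z (A : set R) : nbhs (enorm z) A -> \forall w \near z, A (enorm w).
Proof.
move=> /nbhs_ballP[e /= e0 eA]; apply/nbhs_eball; exists (e / 2); first by rewrite divr_gt0.
move=> w wz; apply: eA; rewrite -ball_normE /ball_ /=.
have {}wz : enorm (w - z) <= e / 2 := wz.
have := enormD (w - z) z; rewrite subrK; have := enormD (z - w) w; rewrite subrK enormB.
by move=> *; rewrite ltr_norml; apply/andP; split; lra.
Qed.

Lemma is_derive_bproj_in rho z u : enorm u = 1 -> enorm z < rho ->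
  is_derive (0 : R) 1 (fun t => dotE (bproj rho (z + t *: u)) u) 1.
Proof.
move=> u1 zr; apply: estimate_is_derive => e e0.
have nz : \forall w \near z + 0 *: u, enorm w < rho.
  rewrite scale0r addr0; apply: (@enorm_near z [set t | t < rho]).
  by apply: lt_nbhsl.
have /nbhs_ballP[r /= r0 hr] := near_line nz.
exists r => // y; rewrite subr0 => yr.
have yl : enorm (z + y *: u) < rho by apply: hr; rewrite -ball_normE /ball_ /= sub0r normrN.
rewrite scale0r addr0 !bproj_in ?(ltW yl) ?(ltW zr) // dotEDl dotEZl -[dotE u u]enorm_sqr u1.
have -> : dotE z u + y * 1 ^+ 2 - dotE z u - 1 * y = 0 by ring.
by rewrite normr0 mulr_ge0 // ltW.
Qed.

(** Outside the ball [huber] is [rho |z|] up to a constant; its second derivative is [rho / |z|]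
    times the squared sine of the angle between [z] and [u]. *)
Lemma is_derive_bproj_out rho z u : enorm u = 1 -> 0 <= rho -> rho < enorm z ->
  is_derive (0 : R) 1 (fun t => dotE (bproj rho (z + t *: u)) u)
    (rho * ((enorm z ^+ 2 - dotE z u ^+ 2) / enorm z ^+ 3)).
Proof.
move=> u1 rho0 zr; have z0 : 0 < enorm z by exact: le_lt_trans rho0 zr.
have uu : dotE u u = 1 by rewrite -enorm_sqr u1 expr1n.
pose a := dotE z u.
pose g (t : R) : R := dotE z z + 2 * a * t + t ^+ 2.
have gE t : g t = dotE (z + t *: u) (z + t *: u).
  by rewrite /g dotEDl !dotEDr !dotEZl !dotEZr uu (dotEC u z) /a; ring.
have g0 : g 0 = enorm z ^+ 2 by rewrite /g mulr0 expr0n /= !addr0 enorm_sqr.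
have dg : is_derive (0 : R) 1 g (2 * a).
  apply: estimate_is_derive => e e0; exists e => // y; rewrite subr0 => ye.
  have -> : g y - g 0 - 2 * a * y = y * y by rewrite /g; ring.
  by rewrite normrM ler_wpM2r // ltW.
have ds : is_derive (0 : R) 1 (fun t => Num.sqrt (g t)) (a / enorm z).
  have gp : 0 < g 0 by rewrite g0 exprn_gt0.
  have := @is_derive1_comp R (@Num.sqrt R) g 0 _ _ (is_derive1_sqrt gp) dg.
  move=> h; apply: is_derive_eq h _.
  by rewrite g0 sqrtr_sqr gtr0_norm //; field; rewrite gt_eqF.
have s0 : Num.sqrt (g 0) = enorm z by rewrite g0 sqrtr_sqr gtr0_norm.
have dv : is_derive (0 : R) 1 (fun t => (Num.sqrt (g t))^-1) (- (a / enorm z ^+ 3)).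
  have := @is_deriveV R (fun t => Num.sqrt (g t)) 0 _ 1; rewrite s0 => /(_ _ (negbT (gt_eqF z0)) ds) h.
  apply: is_derive_eq h _; rewrite /GRing.scale /=; field; rewrite gt_eqF //.
have da : is_derive (0 : R) 1 (fun t => a + t) 1.
  apply: estimate_is_derive => e e0; exists 1 => // y _.
  have -> : a + y - (a + 0) - 1 * (y - 0) = 0 by ring.
  by rewrite normr0 mulr_ge0 // ltW.
have dp := is_deriveM da dv.
have dr := is_deriveZ rho dp.
apply: (near_is_derive (f := rho \*: ((fun t => a + t) * (fun t => (Num.sqrt (g t))^-1)))).
  have nz : \forall w \near z + 0 *: u, rho < enorm w.
    rewrite scale0r addr0; apply: (@enorm_near z [set t | rho < t]).
    by apply: lt_nbhsr.
  apply: filterS (near_line nz) => y zy.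
  rewrite bproj_out // dotEZl dotEDl dotEZl uu mulr1.
  have -> : enorm (z + y *: u) = Num.sqrt (g y) by rewrite gE.
  change (rho * ((a + y) * (Num.sqrt (g y))^-1) = rho / Num.sqrt (g y) * (a + y)).
  by ring.
apply: is_derive_eq dr _.
rewrite s0 addr0 /GRing.scale /= -/a; field; rewrite gt_eqF //.
Qed.

End BallProjection.

Section FoolingFunction.
Variables (R : realType) (d : nat) (c : 'rV[R]_d) (h q : R).
Hypotheses (d0 : (0 < d)%N) (h0 : 0 < h).
Implicit Types (z w u : 'rV[R]_d).

Let lam : R := (1 + `|q| * (h ^+ 2 / 4))^-1.

(** The radial second derivative is [1 - 2] inside radius [h / 2] and 1 up to radius [h]; beyond [h]
    the two linear parts cancel and the constant makes the sum 0. The factor [lam] makes room for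
    the term [q f]. *)
Definition fool z : R :=
  lam * (h ^+ 2 / 4 + huber h (z - c) - 2 * huber (h / 2) (z - c)).
Definition gfool z : 'rV[R]_d :=
  lam *: (bproj h (z - c) - 2 *: bproj (h / 2) (z - c)).

Let qh0 : 0 <= `|q| * (h ^+ 2 / 4).
Proof. by rewrite mulr_ge0 // divr_ge0 // sqr_ge0. Qed.

Let lam0 : 0 < lam. Proof. by rewrite invr_gt0 ltr_pwDl. Qed.

Let h20 : 0 <= h / 2. Proof. by rewrite divr_ge0 // ltW. Qed.

Lemma fool_bound z : 0 <= fool z <= lam * (h ^+ 2 / 4).
Proof.
suff /andP[a1 a2] : 0 <= h ^+ 2 / 4 + huber h (z - c) - 2 * huber (h / 2) (z - c) <= h ^+ 2 / 4.
  by apply/andP; split; [rewrite mulr_ge0 // ltW|rewrite ler_wpM2l // ltW].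
rewrite /huber; have := enorm_ge0 (z - c); set r := enorm (z - c) => r0.
have h0' := h0; have [rh|rh] := leP r h; have [rh2|rh2] := leP r (h / 2).
- have : r ^+ 2 <= (h / 2) ^+ 2 by rewrite lerXn2r ?nnegrE.
  have := sqr_ge0 r; rewrite exprMn => *; apply/andP; split; lra.
- have e0 : 0 <= h - r by lra.
  have e1 : h - r <= h / 2 by lra.
  have := sqr_ge0 (h - r); have : (h - r) ^+ 2 <= (h / 2) ^+ 2 by rewrite lerXn2r ?nnegrE.
  by rewrite !exprMn !expr2 => *; apply/andP; split; lra.
- by lra.
- by have := sqr_ge0 h; rewrite !expr2 => *; apply/andP; split; lra.
Qed.

Lemma fool_center : fool c = lam * (h ^+ 2 / 4).
Proof.
by rewrite /fool subrr /huber enorm0 h20 (ltW h0) expr0n /= mul0r mulr0 subr0 addr0.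
Qed.

Lemma fool_far z : h < enorm (z - c) -> fool z = 0 /\ gfool z = 0.
Proof.
move=> hz; have h2z : h / 2 < enorm (z - c) by have := h0; lra.
rewrite /fool /gfool /huber !bproj_out // !leNgt hz h2z /=; split; first by field.
rewrite scalerA; have -> : 2 * (h / 2 / enorm (z - c)) = h / enorm (z - c) by field; rewrite gt_eqF //; have := h0; lra.
by rewrite subrr scaler0.
Qed.

Lemma fool_diff z w :
  `|fool w - fool z - dotE (gfool z) (w - z)| <= 3 * lam * enorm (w - z) ^+ 2.
Proof.
have E : w - c - (z - c) = w - z by apply/rowP => i; rewrite !mxE; ring.
have := huber_diff (z - c) (w - c) (ltW h0); have := huber_diff (z - c) (w - c) h20.
rewrite E /fool /gfool dotEZl dotEBl dotEZl.
set D := enorm (w - z) ^+ 2; set p := dotE _ _; set p' := dotE _ _ => h1 h2.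
set a := huber h (w - c) in h2 *; set b := huber h (z - c) in h2 *.
set a' := huber _ (w - c) in h1 *; set b' := huber _ (z - c) in h1 *.
have -> : lam * (h ^+ 2 / 4 + a - 2 * a') - lam * (h ^+ 2 / 4 + b - 2 * b') - lam * (p' - 2 * p)
  = lam * ((a - b - p') - 2 * (a' - b' - p)) by ring.
rewrite normrM gtr0_norm // [3 * lam]mulrC -mulrA ler_wpM2l ?(ltW lam0) //.
move: h1 h2; rewrite !ler_norml => *; apply/andP; split; lra.
Qed.

Lemma gfool_lipschitz z w : enorm (gfool w - gfool z) <= 3 * lam * enorm (w - z).
Proof.
have E : w - c - (z - c) = w - z by apply/rowP => i; rewrite !mxE; ring.
have := bproj_lipschitz (w - c) (z - c) (ltW h0); have := bproj_lipschitz (w - c) (z - c) h20.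
rewrite E /gfool; set D := enorm (w - z).
set a := bproj h (w - c); set b := bproj h (z - c).
set a' := bproj _ (w - c); set b' := bproj _ (z - c) => h1 h2.
have -> : lam *: (a - 2 *: a') - lam *: (b - 2 *: b') = lam *: ((a - b) - 2 *: (a' - b')).
  by apply/rowP => i; rewrite !mxE; ring.
rewrite enormZ gtr0_norm // [3 * lam]mulrC -mulrA ler_wpM2l ?(ltW lam0) //.
apply: le_trans (enormD _ _) _; rewrite enormN enormZ ger0_norm //; lra.
Qed.

Lemma fool_second z u : enorm u = 1 -> enorm (z - c) != h -> enorm (z - c) != h / 2 ->
  exists D, is_derive (0 : R) 1 (fun t => dotE (gfool (z + t *: u)) u) D /\
    `|D + q * fool z| <= 1.
Proof.
move=> u1 zh zh2; set y := z - c in zh zh2.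
have hh := h0.
suff [D1 [D2 [hD1 hD2 D12]]] : exists D1 D2,
    [/\ is_derive (0 : R) 1 (fun t => dotE (bproj h (y + t *: u)) u) D1,
     is_derive (0 : R) 1 (fun t => dotE (bproj (h / 2) (y + t *: u)) u) D2 &
     `|D1 - 2 * D2| <= 1].
  exists (lam * (D1 - 2 * D2)); split.
    apply: estimate_is_derive => e e0.
    have e3 : 0 < e / (3 * lam) by rewrite divr_gt0 // mulr_gt0.
    have [r1 r10 h1] := is_derive_estimate hD1 e3.
    have [r2 r20 h2] := is_derive_estimate hD2 e3.
    exists (Num.min r1 r2); first by rewrite lt_min r10.
    move=> s; rewrite lt_min => /andP[/h1 + /h2].
    rewrite /gfool !dotEZl !dotEBl !dotEZl.
    have E t : z + t *: u - c = y + t *: u by apply/rowP => i; rewrite !mxE; ring.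
    rewrite !E; set a := dotE _ _; set b := dotE _ _; set a' := dotE _ _; set b' := dotE _ _.
    set N := `|s - 0| => k1 k2.
    have -> : lam * (a - 2 * a') - lam * (b - 2 * b') - lam * (D1 - 2 * D2) * (s - 0) =
      lam * ((a - b - D1 * (s - 0)) - 2 * (a' - b' - D2 * (s - 0))) by ring.
    rewrite normrM gtr0_norm // mulrC -ler_pdivlMr //.
    have -> : e * N / lam = 3 * (e / (3 * lam) * N) by field; rewrite gt_eqF.
    by move: k1 k2; rewrite !ler_norml => *; apply/andP; split; lra.
  apply: le_trans (ler_normD _ _) _; rewrite [`|lam * _|]normrM [`|q * _|]normrM gtr0_norm //.
  have /andP[f0 f1] := fool_bound z; rewrite [`|fool z|]ger0_norm //.
  have k1 : lam * `|D1 - 2 * D2| <= lam * 1 by rewrite ler_wpM2l // ltW.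
  have k2 : `|q| * fool z <= `|q| * (lam * (h ^+ 2 / 4)) by rewrite ler_wpM2l.
  have : lam * (1 + `|q| * (h ^+ 2 / 4)) = 1 by rewrite mulVf // gt_eqF // ltr_pwDl.
  lra.
have yu : dotE y u ^+ 2 <= enorm y ^+ 2.
  rewrite -real_normK ?num_real // lerXn2r ?nnegrE ?enorm_ge0 //.
  by have := abs_dotE_le y u; rewrite u1 mulr1.
have kap (rho : R) : 0 < rho -> rho < enorm y ->
    0 <= rho * ((enorm y ^+ 2 - dotE y u ^+ 2) / enorm y ^+ 3) <= rho / enorm y.
  move=> rho0 ry; have y0 : 0 < enorm y by exact: lt_trans ry.
  have -> : rho * ((enorm y ^+ 2 - dotE y u ^+ 2) / enorm y ^+ 3) =
    rho / enorm y * ((enorm y ^+ 2 - dotE y u ^+ 2) / enorm y ^+ 2) by field; rewrite gt_eqF.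
  have g0 : 0 <= (enorm y ^+ 2 - dotE y u ^+ 2) / enorm y ^+ 2.
    by rewrite divr_ge0 ?sqr_ge0 // subr_ge0.
  have g1 : (enorm y ^+ 2 - dotE y u ^+ 2) / enorm y ^+ 2 <= 1.
    by rewrite ler_pdivrMr ?exprn_gt0 // mul1r gerBl sqr_ge0.
  have ry0 : 0 <= rho / enorm y by rewrite divr_ge0 // ltW.
  by rewrite mulr_ge0 //= ler_piMr.
have h2p : 0 < h / 2 by lra.
have [yl|yl|yE] := ltgtP (enorm y) (h / 2); last by rewrite yE eqxx in zh2.
  exists 1, 1; split.
  - by apply: is_derive_bproj_in => //; lra.
  - exact: is_derive_bproj_in.
  - by rewrite ler_norml; lra.
(* In the shell [D1 - 2 * D2] runs from 1 in the radial direction down to [1 - h / |y|] in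
   tangential ones, which exceeds -1 as [|y| > h / 2]; beyond [h] the two terms cancel. *)
have [yl'|yl'|yE] := ltgtP (enorm y) h; last by rewrite yE eqxx in zh.
  exists 1, (h / 2 * ((enorm y ^+ 2 - dotE y u ^+ 2) / enorm y ^+ 3)); split.
  - exact: is_derive_bproj_in.
  - exact: is_derive_bproj_out.
  - have /andP[k1 k2] := kap _ h2p yl.
    have : h / 2 / enorm y <= 1 by rewrite ler_pdivrMr ?mul1r ?(ltW yl) //; lra.
    by rewrite ler_norml => *; apply/andP; split; lra.
exists (h * ((enorm y ^+ 2 - dotE y u ^+ 2) / enorm y ^+ 3)),
  (h / 2 * ((enorm y ^+ 2 - dotE y u ^+ 2) / enorm y ^+ 3)); split.
- by apply: is_derive_bproj_out => //; exact: ltW.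
- exact: is_derive_bproj_out.
- by rewrite ler_norml; apply/andP; split; lra.
Qed.

(** [gfool] is Lipschitz, hence absolutely continuous on every line, and the exceptional points for
    second derivatives lie on the spheres of radii [h] and [h / 2]. *)
Lemma fool_W Om : W_class q Om fool gfool.
Proof.
have l3 : 0 < 3 * lam by rewrite mulr_gt0.
split; first (split; [|split]).
- apply/within_estimateP => z e _ e0.
  have K0 : 0 < enorm (gfool z) + 3 * lam by rewrite ltr_wpDl ?enorm_ge0.
  exists (Num.min 1 (e / (enorm (gfool z) + 3 * lam))); first by rewrite lt_min ltr01 divr_gt0.
  move=> w _; rewrite le_min ler_pdivlMr // => /andP[w1 we].
  have := fool_diff z w; have := abs_dotE_le (gfool z) (w - z).
  have : 3 * lam * enorm (w - z) ^+ 2 <= 3 * lam * enorm (w - z).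
    by rewrite ler_wpM2l ?(ltW l3) // expr2 ler_piMl ?enorm_ge0.
  by rewrite !ler_norml => k1 /andP[k2 k3] /andP[k4 k5]; apply/andP; split; lra.
- apply/within_estimateP => z e _ e0; exists (e / (3 * lam)); first by rewrite divr_gt0.
  move=> w _; rewrite ler_pdivlMr // mulrC => we.
  by apply: le_trans (mx_norm_le_enorm _) (le_trans (gfool_lipschitz z w) we).
- move=> z _; apply: estimate_differentiable => e e0.
  exists (e / (3 * lam)); first by rewrite divr_gt0.
  move=> w; rewrite ler_pdivlMr // => we; apply: le_trans (fool_diff z w) _.
  by rewrite expr2 mulrA ler_wpM2r ?enorm_ge0 // mulrC.
move=> u u1.
have N := leb_null_setU (sphere_null d0 c h0) (@sphere_null R d d0 c (h / 2) (divr_gt0 h0 (ltr0n R 2))).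
split; apply: leb_null_subset N => z /=.
  move=> [_ nac]; exfalso; apply: nac => a b ab _ e e0.
  exists (e / (3 * lam)); first by rewrite divr_gt0.
  move=> n s t st _; rewrite ltr_pdivlMr // mulrC; apply: le_lt_trans.
  rewrite mulr_sumr; apply: ler_sum => k _; have [_ [sk _]] := st k (ltn_ord k).
  rewrite -dotEBl; apply: le_trans (abs_dotE_le _ _) _; rewrite u1 mulr1.
  apply: le_trans (gfool_lipschitz _ _) _; rewrite ler_wpM2l ?(ltW l3) //.
  have -> : z + t k *: u - (z + s k *: u) = (t k - s k) *: u.
    by apply/rowP => i; rewrite !mxE; ring.
  by rewrite enormZ u1 mulr1 ger0_norm // subr_ge0.
move=> [_ nD]; have [zh|zh] := eqVneq (enorm (z - c)) h; first by left.
have [zh2|zh2] := eqVneq (enorm (z - c)) (h / 2); first by right.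
by case: nD; exact: fool_second.
Qed.

End FoolingFunction.

Lemma W_opp (R : realType) (d : nat) (q : R) (Om : set 'rV[R]_d) (f : 'rV[R]_d -> R)
    (G : 'rV[R]_d -> 'rV[R]_d) :
  W_class q Om f G -> W_class q Om (fun x => - f x) (fun x => - G x).
Proof.
move=> [[cf [cG df]] W]; split; first (split; [|split]).
- apply/within_estimateP => x e Ox e0.
  have [r r0 hr] := (within_estimateP _ _).1 cf x e Ox e0.
  by exists r => // y Oy yr; rewrite -opprD normrN hr.
- apply/within_estimateP => x e Ox e0.
  have [r r0 hr] := (within_estimateP _ _).1 cG x e Ox e0.
  by exists r => // y Oy yr; rewrite -opprD normrN hr.
- move=> x ix; have [dx ex] := df x ix; apply: estimate_differentiable => e e0.
  have [r r0 hr] := differentiable_estimate dx ex e0.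
  by exists r => // y yr; rewrite dotENl -!opprD normrN hr.
move=> u u1; have [N M] := W u u1; split.
  apply: leb_null_subset N => x /= [ix nac]; split => // ac; apply: nac => a b ab abO e e0.
  have [del del0 hd] := ac a b ab abO e e0; exists del => // n s t st ts sd.
  by under eq_bigr do rewrite !dotENl -opprD normrN; exact: hd.
apply: leb_null_subset M => x /= [Ox nD]; split => // -[D [hD D1]]; apply: nD.
exists (- D); split; last by rewrite mulrN -opprD normrN.
apply: estimate_is_derive => e e0; have [r r0 hr] := is_derive_estimate hD e0.
by exists r => // y yr; rewrite !dotENl mulNr -!opprD normrN hr.
Qed.

(** The fooling function and its negative produce the same data; whatever the sign of the
    reconstruction at [c], it misses one of them by at least their height there. *)
Lemma R_xi_ge (R : realType) (d : nat) (q : R) (Om : set 'rV[R]_d) (xi : seq 'rV[R]_d)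
    (h : R) (c : 'rV[R]_d) :
  (0 < d)%N -> 0 < h -> Om c -> (forall y, y \in xi -> h < enorm (c - y)) ->
  (((h ^+ 2 / 4) / (1 + `|q| * (h ^+ 2 / 4)))%:E <= R_xi q Om xi)%E.
Proof.
move=> d0 h0 Oc far; apply: le_ereal_inf_tmp => _ [phi _ <-].
have Wf := fool_W c q d0 h0 Om.
have Wn := W_opp Wf.
have ff y : y \in xi -> fool c h q y = 0 /\ gfool c h q y = 0.
  by move=> yxi; apply: fool_far => //; rewrite enormB far.
have iE : info xi (fun x => - fool c h q x) (fun x => - gfool c h q x) =
    info xi (fool c h q) (gfool c h q).
  by apply/eq_in_map => y /ff[-> ->]; rewrite !oppr0.
set B := _ / _; have fB : fool c h q c = B by rewrite fool_center // mulrC.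
set p := phi (info xi (fool c h q) (gfool c h q)) c.
have [pB|pB] := leP p 0.
  apply: (@le_trans _ _ (`|fool c h q c - p|)%:E).
    by rewrite lee_fin fB; apply: le_trans (ler_norm _); lra.
  apply: ereal_sup_ubound; exists (fool c h q), (gfool c h q), c; split => //.
apply: (@le_trans _ _ (`|- fool c h q c - p|)%:E).
  by rewrite lee_fin fB -normrN; apply: le_trans (ler_norm _); lra.
apply: ereal_sup_ubound; exists (fun x => - fool c h q x), (fun x => - gfool c h q x), c.
by split => //; split => //; rewrite iE.
Qed.

(** * Covering numbers and the covering density *)

Section CoveringConstant.
Variables (R : realType) (d : nat).

Implicit Types (x y z : 'rV[R]_d) (xi : seq 'rV[R]_d) (A : set 'rV[R]_d).

Definition covers A (h : R) xi := forall x, A x -> exists2 y, y \in xi & enorm (x - y) <= h.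

Definition covering_ratios : set R := [set t | exists (L : R) xi,
  [/\ 0 < L, covers (box 0 (const_mx L)) 1 xi & t = (size xi)%:R / L ^+ d]].

(* The number of unit balls per unit volume needed to cover large cubes. *)
Definition kappa : R := inf covering_ratios.

Lemma covering_ratios_lb : has_lbound covering_ratios.
Proof.
by exists 0 => _ [L [xi [L0 _ ->]]]; rewrite divr_ge0 ?ler0n // exprn_ge0 // ltW.
Qed.

Lemma covering_ratios_neq0 : covering_ratios !=set0.
Proof.
have sd : 0 < Num.sqrt d%:R + 1 :> R by rewrite ltr_wpDl ?sqrtr_ge0.
pose L : R := (Num.sqrt d%:R + 1)^-1; have L0 : 0 < L by rewrite invr_gt0.
exists ((size [:: (0 : 'rV[R]_d)])%:R / L ^+ d), L, [:: 0]; split => // x xL.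
exists 0; rewrite ?inE // subr0.
apply: (@le_trans _ _ (Num.sqrt d%:R * L)).
  apply: enorm_le_coord => [|i]; first exact: ltW.
  by have := xL i; rewrite !mxE => /andP[a b]; rewrite ger0_norm.
by rewrite /L ler_pdivrMr // mul1r lerDl.
Qed.

Lemma kappa_ge0 : 0 <= kappa.
Proof.
apply: lb_le_inf; first exact: covering_ratios_neq0.
by move=> _ [L [xi [L0 _ ->]]]; rewrite divr_ge0 ?ler0n // exprn_ge0 // ltW.
Qed.

Lemma kappa_le (L h : R) z xi : 0 < L -> 0 < h -> covers (box z (z + const_mx L)) h xi ->
  kappa * (L / h) ^+ d <= (size xi)%:R.
Proof.
move=> L0 h0 cov; have Lh : 0 < L / h by rewrite divr_gt0.
rewrite -ler_pdivlMr ?exprn_gt0 //; apply: ge_inf; first exact: covering_ratios_lb.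
exists (L / h), [seq h^-1 *: (y - z) | y <- xi]; split => //; last by rewrite size_map.
move=> x xL; have [|y yxi hy] := cov (z + h *: x).
  move=> i; have := xL i; rewrite !mxE => /andP[a b].
  rewrite lerDl mulr_ge0 ?(ltW h0) //= lerD2l; move: b.
  by rewrite ler_pdivlMr // mulrC.
exists (h^-1 *: (y - z)); first exact: map_f.
have -> : x - h^-1 *: (y - z) = h^-1 *: (z + h *: x - y).
  by apply/rowP => i; rewrite !mxE; field; rewrite gt_eqF.
by rewrite enormZ ger0_norm ?invr_ge0 ?(ltW h0) // ler_pdivrMl // mulr1.
Qed.

Lemma kappa_near (e : R) : 0 < e -> exists (L : R) (N : nat),
  [/\ 0 < L, (0 < N)%N, N%:R <= (kappa + e) * L ^+ d &
   exists2 xi0, size xi0 = N & covers (box 0 (const_mx L)) 1 xi0].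
Proof.
move=> e0; have [|t [L [xi [L0 cov ->]]] tk] := @inf_adherent R covering_ratios e e0.
  by split; [exact: covering_ratios_neq0|exact: covering_ratios_lb].
exists L, (size xi); split => //; last by exists xi.
  have [|y + _] := cov 0; last by case: xi {cov tk}.
  by move=> i; rewrite !mxE lexx (ltW L0).
by rewrite -ler_pdivrMr ?exprn_gt0 // ltW.
Qed.

Lemma covers_cell (L h : R) z xi : 0 < h -> covers (box 0 (const_mx L)) 1 xi ->
  covers (box z (z + const_mx (h * L))) h [seq z + h *: y | y <- xi].
Proof.
move=> h0 cov x xL; have [|y yxi hy] := cov (h^-1 *: (x - z)).
  move=> i; have := xL i; rewrite !mxE => /andP[a b].
  by rewrite mulr_ge0 ?invr_ge0 ?subr_ge0 ?(ltW h0) //= ler_pdivrMl //; lra.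
exists (z + h *: y); first exact: map_f.
have -> : x - (z + h *: y) = h *: (h^-1 *: (x - z) - y).
  by apply/rowP => i; rewrite !mxE; field; rewrite gt_eqF.
by rewrite enormZ gtr0_norm // ger_pMr.
Qed.

End CoveringConstant.

(** * Economical coverings of convex bodies *)

Section CoveringBodies.
Variables (R : realType) (d : nat).
Hypothesis d0 : (0 < d)%N.
Implicit Types (x y z : 'rV[R]_d) (xi : seq 'rV[R]_d) (A Om : set 'rV[R]_d).

(** Each cell of side [h * L] meeting [A] receives a copy of [xi0] scaled by [h]. This is economical
    when [xi0] is, but leaves the position of the nodes uncontrolled. *)
Lemma coarse_cover A m (L h : R) xi0 : (0 < m)%N -> 0 < L -> 0 < h ->
  covers (box 0 (const_mx L)) 1 xi0 -> A `<=` cube (half_side m (h * L)) ->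
  exists2 xi, size xi = (#|meeting m (h * L) A| * size xi0)%N & covers A h xi.
Proof.
move=> m0 L0 h0 cov AT; set K := meeting m (h * L) A.
pose corner (k : {ffun 'I_d -> 'I_m}) := gridpt (const_mx (- half_side m (h * L))) (h * L) k.
exists (flatten [seq [seq corner k + h *: y | y <- xi0] | k <- enum K]).
  rewrite size_flatten /shape -map_comp (eq_map (g := fun=> size xi0)); last first.
    by move=> k /=; rewrite size_map.
  rewrite cardE; elim: (enum K) => //= a s ->; by rewrite mulSn.
move=> x Ax; have [k kx] := cell_exists m0 (mulr_gt0 h0 L0) (AT x Ax).
have [y yin xy] := covers_cell h0 cov kx.
exists y => //; apply/flattenP; exists [seq corner k + h *: y | y <- xi0] => //.
apply/mapP; exists k => //; rewrite mem_enum inE; apply/asboolP; exists x => //.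
Qed.

(** One node per cell costs more nodes, but each is the image under [g] of a point of [A]; used near
    the boundary, where [g] pushes points into the interior. *)
Lemma fine_cover A m (s : R) (g : 'rV[R]_d -> 'rV[R]_d) (a : R) : (0 < m)%N -> 0 < s ->
  A `<=` cube (half_side m s) -> (forall x, A x -> enorm (x - g x) <= a) ->
  exists2 xi, size xi = #|meeting m s A| &
    covers A (Num.sqrt d%:R * s + a) xi /\ forall y, y \in xi -> exists2 x, A x & y = g x.
Proof.
move=> m0 s0 AT ga; set K := meeting m s A.
have /choice[p hp] (k : {ffun 'I_d -> 'I_m}) : exists x, k \in K -> cell s k x /\ A x.
  have [|nk] := boolP (k \in K); last by exists 0.
  by rewrite inE => /asboolP[x kx Ax]; exists x.
exists [seq g (p k) | k <- enum K]; first by rewrite size_map cardE.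
split=> [x Ax|y /mapP[k]]; last first.
  by rewrite mem_enum => /hp[_ Ap] ->; exists (p k).
have [k kx] := cell_exists m0 s0 (AT x Ax).
have kK : k \in K by rewrite inE; apply/asboolP; exists x.
have [pk Ap] := hp k kK.
exists (g (p k)); first by apply/mapP; exists k; rewrite ?mem_enum.
apply: le_trans (enorm_tri (p k) _ _) _; apply: lerD; last exact: ga.
exact: (cell_diam s0 kx pk).
Qed.

Lemma grid_large (T s : R) : 0 < T -> 0 < s -> exists2 m, (0 < m)%N & T <= half_side m s.
Proof.
move=> T0 s0; exists (Num.truncn (2 * T / s)).+1 => //.
have h := truncnS_gt (2 * T / s); rewrite /half_side ler_pdivlMr // mulrC.
by rewrite -ler_pdivrMr // ltW.
Qed.

Lemma cubeS (T T' : R) : T <= T' -> (cube T : set 'rV[R]_d) `<=` cube T'.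
Proof. by move=> TT' x xT i; have /andP[a b] := xT i; apply/andP; split; lra. Qed.

Lemma node_cover_exists Om (eps : R) : convex_body Om -> 0 < eps ->
  exists2 h1 : R, 0 < h1 & forall h, 0 < h < h1 -> exists2 xi, node_cover Om xi h &
    (size xi)%:R * h ^+ d <= kappa R d * lebR Om + eps.
Proof.
move=> [cpO [cO [x0 ix0]]] eps0; have /interior_eball[r r0 rO] := ix0.
have [v Ov] := compact_boxcover d0 cpO; have [T T0 OT] := compact_sub_cube cpO.
have [D D0 hD] := compact_enorm_bounded cpO.
set mu := lebR Om; have mu0 : 0 <= mu by exact: lebR_ge0.
have mu1 : 0 < mu + 1 by lra.
have dl0 : 0 < eps / 2 / (mu + 1) by rewrite !divr_gt0.
have [L [N [L0 N0 NL [xi0 sxi0 cov]]]] := kappa_near d dl0.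
have sd0 : 0 <= Num.sqrt d%:R :> R by rewrite sqrtr_ge0.
pose sd : R := Num.sqrt d%:R + 1; have sd1 : 0 < sd by rewrite ltr_wpDl.
(* Cells of side [a * h] have diameter at most [h / 4]; the push into the interior uses another
   [h / 4] of the allowed [h / 2]. *)
pose a : R := (4 * sd)^-1; have a0 : 0 < a by rewrite invr_gt0 mulr_gt0.
(* The factor [a ^+ d] converts the volume of the shell into a number of cells of side [a * h], to
   be at most [eps / 2] times [h ^- d]. *)
have [e1 e10 he] := shell_small d mu (mulr_gt0 (exprn_gt0 d a0) (divr_gt0 eps0 (ltr0n R 2))).
pose e := Num.min (e1 / 2) (1 / 3).
have e0 : 0 < e by rewrite lt_min !divr_gt0.
have ee1 : e <= e1 / 2 by rewrite ge_min lexx.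
have e3 : e <= 1 / 3 by rewrite ge_min lexx orbT.
have er0 : 0 < e * r by rewrite mulr_gt0.
exists (Num.min (e * r / 2) (e * r / (sd * L))).
  by rewrite lt_min !divr_gt0 ?mulr_gt0.
move=> h /andP[h0]; rewrite lt_min => /andP[her]; rewrite ltr_pdivlMr ?mulr_gt0 // => hL.
have hL0 : 0 < h * L by rewrite mulr_gt0.
have ah0 : 0 < a * h by rewrite mulr_gt0.
have sdah : Num.sqrt d%:R * (a * h) <= h / 4.
  have -> : h / 4 = sd * (a * h) by rewrite /a; field; rewrite gt_eqF.
  by rewrite ler_wpM2r ?(ltW ah0) // lerDl.
have sdhL : Num.sqrt d%:R * (h * L) <= e * r.
  apply: le_trans (ltW hL); rewrite mulrCA ler_wpM2l ?(ltW h0) //.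
  by rewrite ler_wpM2r ?(ltW L0) // lerDl.
have dint x y : dil Om x0 (1 - e) x -> enorm (y - x) <= e * r -> Om y.
  move=> xl yx; have k0 : 0 <= 1 - e by lra.
  have k1 : 1 - e < 1 by lra.
  have := dil_fatten cO rO k0 k1 xl (v := y - x); rewrite dil1 subrKC; apply.
  by have -> : 1 - (1 - e) = e by ring.
have dO : dil Om x0 (1 - e) `<=` Om.
  by move=> x xl; apply: dint xl _; rewrite subrr enorm0 ltW.
have [m1 m10 hm1] := grid_large T0 hL0.
have [m2 m20 hm2] := grid_large T0 ah0.
have [xi1 sz1 cov1] := coarse_cover m10 L0 h0 cov (subset_trans dO (subset_trans OT (cubeS hm1))).
(* A contraction by [tau] towards [x0] displaces points of [Om] by at most [h / 4]. *)
pose tau := Num.min 1 (h / 4 / (D + 1)).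
have D1 : 0 < D + 1 by lra.
have tau0 : 0 < tau by rewrite lt_min ltr01 !divr_gt0.
have tau1 : tau <= 1 by rewrite ge_min lexx.
pose g x : 'rV[R]_d := (1 - (1 - tau)) *: x0 + (1 - tau) *: x.
have gi x : Om x -> interior Om (g x).
  by move=> Ox; apply: convex_interior => //; apply/andP; split; lra.
have gx x : (Om `\` dil Om x0 (1 - e)) x -> enorm (x - g x) <= h / 4.
  move=> [Ox _]; have -> : x - g x = tau *: (x - x0) by apply/rowP => i; rewrite !mxE; ring.
  rewrite enormZ gtr0_norm //; apply: (@le_trans _ _ (tau * (D + 1))).
    rewrite ler_wpM2l ?(ltW tau0) //; have := hD x x0 Ox (interior_subset ix0); lra.
  by rewrite -ler_pdivlMr // ge_min lexx orbT.
have OTd : Om `\` dil Om x0 (1 - e) `<=` cube (half_side m2 (a * h)).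
  by move=> x [/OT Tx _]; exact: cubeS hm2 _ Tx.
have [xi2 sz2 [cov2 im2]] := fine_cover m20 ah0 OTd gx.
(* Dropping the other nodes is harmless: a node within [h < e * r / 2] of a point of [dil (1 - e)]
   is interior. *)
pose xi1' := [seq y <- xi1 | `[< interior Om y >]].
exists (xi1' ++ xi2).
  split.
  - move=> y; rewrite mem_cat mem_filter => /orP[/andP[/asboolP] //|/im2[x [Ox _] ->]].
    exact: gi.
  - move=> x Ox; have [xl|nxl] := pselect (dil Om x0 (1 - e) x).
      have [y yxi xy] := cov1 x xl; exists y => //.
      rewrite mem_cat mem_filter yxi andbT; apply/orP; left; apply/asboolP.
      apply/interior_eball; exists (e * r / 2); first by rewrite divr_gt0.
      move=> z zy; apply: dint xl _; have {}zy : enorm (z - y) <= e * r / 2 := zy.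
      by apply: le_trans (enorm_tri y _ _) _; rewrite (enormB y x); lra.
    have [y yxi xy] := cov2 x (conj Ox nxl); exists y; first by rewrite mem_cat yxi orbT.
    lra.
  - move=> x Ox nix; have nxl : ~ dil Om x0 (1 - e) x.
      move=> xl; apply: nix; apply/interior_eball; exists (e * r) => // y yx.
      exact: dint xl yx.
    have [y yxi xy] := cov2 x (conj Ox nxl); exists y; first by rewrite mem_cat yxi orbT.
    lra.
have h1 : (size xi1)%:R * h ^+ d <= (kappa R d + eps / 2 / (mu + 1)) * mu.
  have e1' : 0 < 1 - e by lra.
  have e1'' : 1 - e < 1 by lra.
  have sdhL' : Num.sqrt d%:R * (h * L) <= (1 - (1 - e)) * r by have -> : 1 - (1 - e) = e by ring.
  have := meeting_le d0 cO rO Ov m10 hL0 e1' e1'' sdhL'; rewrite expr1n mul1r => k1.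
  rewrite sz1 sxi0 natrM -mulrA.
  have k2 : N%:R * h ^+ d <= (kappa R d + eps / 2 / (mu + 1)) * (h * L) ^+ d.
    have -> : forall c : R, c * (h * L) ^+ d = c * L ^+ d * h ^+ d by move=> c; rewrite exprMn; ring.
    by rewrite ler_wpM2r // exprn_ge0 // ltW.
  apply: le_trans (ler_wpM2l (ler0n R _) k2) _.
  rewrite mulrCA ler_wpM2l // addr_ge0 ?kappa_ge0 //; exact: ltW.
have h2 : (size xi2)%:R * h ^+ d <= eps / 2.
  have sda : Num.sqrt d%:R * (a * h) <= e * r by lra.
  have := meeting_shell d0 cO r0 rO Ov m20 ah0 e0 (ltac:(lra)) sda (subset_trans OT (cubeS hm2)).
  move=> /le_trans/(_ (he e _)) k; have {}k := k (ltac:(apply/andP; split; lra)).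
  move: k; rewrite exprMn mulrCA sz2 ler_pM2l // exprn_gt0 //.
have h3 : eps / 2 / (mu + 1) * mu <= eps / 2.
  by rewrite mulrAC ler_pdivrMr // ler_wpM2l ?lerDl // ltW // divr_gt0.
rewrite size_cat natrD mulrDl.
have : (size xi1')%:R * h ^+ d <= (size xi1)%:R * h ^+ d.
  by rewrite ler_wpM2r ?exprn_ge0 ?(ltW h0) // ler_nat size_filter count_size.
lra.
Qed.

End CoveringBodies.

(** * Lower bound for the number of balls covering a convex body *)

Section CoveringLower.
Variables (R : realType) (d : nat).
Hypothesis d0 : (0 < d)%N.
Implicit Types (x y z : 'rV[R]_d) (xi : seq 'rV[R]_d) (A Om : set 'rV[R]_d).

Lemma obox_cell_inj m (s : R) (z : 'rV[R]_d) (k k' : {ffun 'I_d -> 'I_m}) y : 0 < s ->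
  obox (gridpt z s k) (gridpt z s k + const_mx s) y ->
  obox (gridpt z s k') (gridpt z s k' + const_mx s) y -> k = k'.
Proof.
move=> s0 yk yk'; apply/ffunP => i; apply/val_inj => /=.
have /andP[a b] := yk i; have /andP[a' b'] := yk' i; move: a b a' b'; rewrite !mxE => a b a' b'.
have lt (p q : 'I_m) : z 0 i + s * p%:R < y 0 i -> y 0 i < z 0 i + s * q%:R + s -> (p <= q)%N.
  move=> h1 h2; rewrite -ltnS -(ltr_nat R) -(ltr_pM2l s0) -natr1; lra.
by apply/eqP; rewrite eqn_leq !lt.
Qed.

Lemma sum_disjoint_filters (I : finType) (K : {set I}) (P : I -> pred 'rV[R]_d) xi :
  (forall k k' y, P k y -> P k' y -> k = k') ->
  (\sum_(k in K) size [seq y <- xi | P k y] <= size xi)%N.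
Proof.
move=> disj; elim: xi => [|y xi IH] /=; first by rewrite big1.
have -> : (\sum_(k in K) size (if P k y then y :: [seq y <- xi | P k y] else [seq y <- xi | P k y]) =
    \sum_(k in K) P k y + \sum_(k in K) size [seq y <- xi | P k y])%N.
  by rewrite -big_split; apply: eq_bigr => k _; case: (P k y).
suff h1 : (\sum_(k in K) P k y <= 1)%N by exact: leq_add h1 IH.
have [[k0 Pk0]|nP] := pselect (exists k, P k y).
  rewrite (bigID (pred1 k0)) /= [X in (_ + X)%N]big1 ?addn0; last first.
    by move=> k /andP[_ kk0]; apply/eqP; rewrite eqb0; apply: contra kk0 => Pk; rewrite (disj k k0 y).
  apply: leq_trans (_ : \sum_(k | k == k0) 1 <= 1)%N; last by rewrite sum1_card card1.
  rewrite [leqLHS]big_mkcond [leqRHS]big_mkcond /=; apply: leq_sum => k _.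
  by case: (k == k0); rewrite ?andbT ?andbF //; case: ifP => // _; exact: leq_b1.
rewrite big1 // => k _; apply/eqP; rewrite eqb0; apply/negP => Pk; apply: nP; by exists k.
Qed.

Lemma pow_near (c eps : R) : 0 < eps ->
  exists2 e1 : R, 0 < e1 & forall e, 0 < e < e1 -> c - eps <= c * ((1 - e) ^+ d * (1 - e) ^+ d).
Proof.
move=> eps0; apply: near_right0_ex.
pose p : {poly R} := c%:P * ((1 - 'X) ^+ d * (1 - 'X) ^+ d).
have pE t : p.[t] = c * ((1 - t) ^+ d * (1 - t) ^+ d) by rewrite /p !hornerE.
have ct : p.[t] @[t --> 0^'+] --> p.[0] by apply: cvg_at_right_filter; exact: continuous_horner.
have /cvgrPdist_le/(_ _ eps0) := ct; apply: filterS => t.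
by rewrite !pE subr0 expr1n !mulr1 => /ler_normlW; lra.
Qed.

(** In each cell contained in [Om] a smaller concentric cube is covered by the nodes of that open
    cell alone. Open cells are disjoint, so the bounds of [kappa_le] add up. *)
Lemma covers_size_ge Om (eps : R) : convex_body Om -> 0 < eps ->
  exists2 h1 : R, 0 < h1 & forall h, 0 < h < h1 -> forall xi, covers Om h xi ->
    kappa R d * lebR Om - eps <= (size xi)%:R * h ^+ d.
Proof.
move=> [cpO [cO [x0 /interior_eball[r r0 rO]]]] eps0.
have [v Ov] := compact_boxcover d0 cpO; have [T T0 OT] := compact_sub_cube cpO.
set mu := lebR Om; have mu0 : 0 <= mu by exact: lebR_ge0.
(* One factor [(1 - e) ^+ d] pays for shrinking [Om], the other for shrinking the cells. *)
have [e1 e10 he] := pow_near (kappa R d * mu) eps0.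
pose e := Num.min (e1 / 2) (1 / 2).
have e0 : 0 < e by rewrite lt_min !divr_gt0.
have ee1 : e <= e1 / 2 by rewrite ge_min lexx.
have e2 : e <= 1 / 2 by rewrite ge_min lexx orbT.
have sd1 : 0 < Num.sqrt d%:R + 1 :> R by rewrite ltr_wpDl ?sqrtr_ge0.
have [m m0 hm] := mesh_exists T0 (divr_gt0 (mulr_gt0 e0 r0) sd1).
set s := 2 * T / m%:R in hm.
have s0 : 0 < s by rewrite divr_gt0 ?mulr_gt0 ?ltr0n.
have sr : Num.sqrt d%:R * s <= (1 - (1 - e)) * r.
  have -> : 1 - (1 - e) = e by ring.
  move: hm; rewrite ler_pdivlMr // => hm; apply: le_trans hm.
  by rewrite mulrC ler_wpM2l ?lerDl // ltW.
have OTs : Om `<=` cube (half_side m s) by rewrite half_sideE.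
have k0 : 0 < 1 - e by lra.
have k1 : 1 - e < 1 by lra.
have dO : dil Om x0 (1 - e) `<=` Om.
  move=> x xl; have := dil_fatten cO rO (ltW k0) k1 xl (v := 0); rewrite dil1 addr0; apply.
  rewrite enorm0 mulr_ge0 ?(ltW r0) //; lra.
have K1 := meeting_ge d0 Ov m0 s0 k0 (subset_trans dO OTs).
have K2 := subset_leq_card (meeting_inside cO rO m s0 (ltW k0) k1 sr).
rewrite dil1 in K2; set K := inside m s Om in K2.
have {K2}KE : (1 - e) ^+ d * mu <= #|K|%:R * s ^+ d.
  by apply: le_trans K1 _; rewrite ler_wpM2r ?exprn_ge0 ?(ltW s0) // ler_nat.
exists (e * s / 3); first by rewrite divr_gt0 // mulr_gt0.
move=> h /andP[h0 hs] xi cov.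
pose corner (k : {ffun 'I_d -> 'I_m}) := gridpt (const_mx (- half_side m s)) s k.
pose P k y := `[< obox (corner k) (corner k + const_mx s) y >].
have disj k k' y : P k y -> P k' y -> k = k'.
  by move=> /asboolP a /asboolP b; exact: obox_cell_inj a b.
have es0 : 0 < (1 - e) * s by rewrite mulr_gt0.
have es : 0 < s - 3 * h by lra.
have each k : k \in K -> kappa R d * ((s - 3 * h) / h) ^+ d <= (size [seq y <- xi | P k y])%:R.
  rewrite inE => /asboolP kO.
  (* A margin of [3 / 2 * h], larger than [h], keeps the nodes near the inner cube strictly inside
     the cell. *)
  apply: (@kappa_le _ _ _ _ (corner k + const_mx (3 / 2 * h))) => // x xk.
  have xc i := xk i; have [|y yxi xy] := cov x.
    apply: kO => i; have := xc i; rewrite !mxE => /andP[? ?]; apply/andP; split; lra.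
  exists y => //; rewrite mem_filter yxi andbT; apply/asboolP => i.
  have := le_trans (coord_le_enorm (x - y) i) xy; have := xc i.
  rewrite !mxE ler_norml => /andP[? ?] /andP[? ?]; apply/andP; split; lra.
have tot : #|K|%:R * (kappa R d * ((s - 3 * h) / h) ^+ d) <= (size xi)%:R.
  apply: (@le_trans _ _ (\sum_(k in K) (size [seq y <- xi | P k y])%:R)).
    by rewrite mulr_natl -sumr_const; apply: ler_sum => k; exact: each.
  by rewrite -natr_sum ler_nat; exact: sum_disjoint_filters.
have hd0 : 0 < h ^+ d by rewrite exprn_gt0.
apply: le_trans (ler_wpM2r (ltW hd0) tot).
have kap0 := kappa_ge0 R d.
have -> : #|K|%:R * (kappa R d * ((s - 3 * h) / h) ^+ d) * h ^+ d =
    kappa R d * (#|K|%:R * (s - 3 * h) ^+ d).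
  by rewrite expr_div_n; field; rewrite gt_eqF.
have {}he := he e (ltac:(apply/andP; split; lra)).
apply: le_trans he _; rewrite -mulrA ler_wpM2l //.
have pe : ((1 - e) * s) ^+ d <= (s - 3 * h) ^+ d.
  rewrite lerXn2r ?nnegrE ?mulr_ge0 ?(ltW k0) ?(ltW s0) ?(ltW es) //; lra.
apply: (@le_trans _ _ (#|K|%:R * ((1 - e) * s) ^+ d)); last by rewrite ler_wpM2l ?ler0n.
have -> : mu * ((1 - e) ^+ d * (1 - e) ^+ d) = (1 - e) ^+ d * ((1 - e) ^+ d * mu) by ring.
have -> : #|K|%:R * ((1 - e) * s) ^+ d = (1 - e) ^+ d * (#|K|%:R * s ^+ d).
  by rewrite exprMn; ring.
by rewrite ler_wpM2l // exprn_ge0 // ltW.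
Qed.

End CoveringLower.

(** * Lower bound for the covering density *)

Section CoveringDensity.
Variables (R : realType) (d : nat).
Hypothesis d0 : (0 < d)%N.
Implicit Types (x y z : 'rV[R]_d) (xi : seq 'rV[R]_d).

Lemma count_unbounded (P : pred nat) : (forall n, exists2 k, (n <= k)%N & P k) ->
  forall m, exists n, (m <= count P (iota 0 n))%N.
Proof.
move=> hP; elim=> [|m [n mn]]; first by exists 0%N.
have [k nk Pk] := hP n; exists k.+1.
have -> : k.+1 = (n + ((k - n) + 1))%N by rewrite addnA subnKC // addn1.
rewrite iotaD count_cat iotaD count_cat add0n subnKC //= Pk addn0 addn1.
by rewrite addnS ltnS (leq_trans mn) // leq_addr.
Qed.

(** Balls meeting the cube of half side [T - 2 * r] lie in [cube T] and count with their full
    volume; [kappa] bounds their number from below. *)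
Lemma ball_sum_ge (c : nat -> 'rV[R]_d) (r T : R) : is_ball_covering c r -> 2 * r < T ->
  ((nu R d * (kappa R d * (2 * (T - 2 * r)) ^+ d))%:E <=
    \sum_(k <oo) leb_outer (eball (c k) r `&` cube T))%E.
Proof.
move=> [r0 cov] rT.
pose I k := `[< exists2 x, cube (T - 2 * r) x & eball (c k) r x >].
have T20 : 0 < 2 * (T - 2 * r) by rewrite mulr_gt0 // subr_gt0.
have Iball k : I k -> leb_outer (eball (c k) r `&` cube T) = (r ^+ d * nu R d)%:E.
  move=> /asboolP[x xT xk].
  have -> : eball (c k) r `&` cube T = eball (c k) r.
    apply/setIidl => y yk i.
    have h1 := le_trans (coord_le_enorm _ i) (yk : enorm (y - c k) <= r).
    have h2 := le_trans (coord_le_enorm _ i) (xk : enorm (x - c k) <= r).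
    have /andP[h3 h4] := xT i; move: h1 h2; rewrite !mxE !ler_norml => /andP[? ?] /andP[? ?].
    by apply/andP; split; lra.
  have [v Bv] := compact_boxcover d0 (compact_eball (c := c k) (rho := r)).
  by rewrite (boxcover_fin Bv) lebR_eball.
have [n hn] : exists n, kappa R d * (2 * (T - 2 * r) / r) ^+ d <= (count I (iota 0 n))%:R.
  (* The covering need not be locally finite. If infinitely many balls meet the smaller cube, the
     required number is reached trivially; otherwise they form a finite covering of it. *)
  have [[n hn]|hub] := pselect (exists n, forall k, I k -> (k < n)%N).
    exists n; apply: le_trans (_ : (size [seq c k | k <- iota 0 n & I k])%:R <= _).
      apply: (@kappa_le _ _ _ _ (const_mx (- (T - 2 * r)))) => // x.
      rewrite -cube_boxE => xT; have : (\bigcup_k eball (c k) r) x by rewrite cov.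
      move=> [k _ xk]; have Ik : I k by apply/asboolP; exists x.
      by exists (c k) => //; apply/map_f; rewrite mem_filter Ik mem_iota /= hn.
    by rewrite size_map size_filter.
  have hub' n : exists2 k, (n <= k)%N & I k.
    apply: contrapT => h; apply: hub; exists n => k Ik; rewrite ltnNge; apply/negP => nk.
    by apply: h; exists k.
  set X := _ * _; have [n hn] := count_unbounded hub' (Num.truncn X).+1.
  exists n; apply: le_trans (ltW (truncnS_gt X)) _; by rewrite ler_nat.
apply: (@le_trans _ _ (\sum_(0 <= k < n) leb_outer (eball (c k) r `&` cube T))%E); last first.
  by apply: nneseries_lim_ge => k _ _; exact: leb_outer_ge0.
apply: (@le_trans _ _ (((count I (iota 0 n))%:R * (r ^+ d * nu R d))%:E)).
  rewrite lee_fin [leRHS](_ : _ = nu R d * ((count I (iota 0 n))%:R * r ^+ d)); last by ring.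
  rewrite ler_wpM2l ?(ltW (nu_gt0 R d0)) //.
  have := ler_wpM2r (exprn_ge0 d (ltW r0)) hn; rewrite expr_div_n -mulrA divfK //.
  by rewrite expf_neq0 // gt_eqF.
apply: (@le_trans _ _ (\sum_(0 <= k < n | I k) leb_outer (eball (c k) r `&` cube T))%E).
  rewrite (eq_bigr (fun=> (r ^+ d * nu R d)%:E)); last by move=> k /Iball.
  rewrite sumEFin lee_fin big_const_seq /= iter_addr_0 /index_iota subn0.
  by rewrite mulr_natl.
rewrite [leRHS](bigID I) /= leeDl //; apply: sume_ge0 => k _; exact: leb_outer_ge0.
Qed.

Lemma Theta_ge : ((nu R d * kappa R d)%:E <= Theta R d)%E.
Proof.
have nu0 := nu_gt0 R d0; have k0 := kappa_ge0 R d.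
apply: le_ereal_inf_tmp => _ [c [r [cov ->]]].
apply/lee_addgt0Pr => eps eps0; rewrite -leeBlDr // -EFinB.
have [e1 e10 he] := pow_near d (nu R d * kappa R d) eps0.
pose e := Num.min (e1 / 2) (1 / 2).
have e0 : 0 < e by rewrite lt_min !divr_gt0.
have ee1 : e <= e1 / 2 by rewrite ge_min lexx.
have e2 : e <= 1 / 2 by rewrite ge_min lexx orbT.
have [r0 _] := cov.
(* From [T = 2 * r / e + 1] on, the boundary loss [2 * r] is at most [e * T]. *)
apply: le_trans (ereal_sup_ubound _); last by exists (2 * r / e + 1); [|reflexivity].
apply: le_ereal_inf_tmp => _ [T /= MT <-].
have T0 : 0 < T by apply: lt_le_trans MT; rewrite ltr_wpDl // divr_ge0 // ?mulr_ge0 // ltW.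
have eT : 2 * r <= e * T.
  by rewrite mulrC [e * T]mulrC -ler_pdivrMr // mulrC; apply: le_trans MT; lra.
have rT : 2 * r < T by apply: le_lt_trans eT _; rewrite gtr_pMl //; lra.
have T2 : 0 < (2 * T) ^+ d by rewrite exprn_gt0 // mulr_gt0.
apply: le_trans (_ : ((nu R d * (kappa R d * (2 * (T - 2 * r)) ^+ d)) * ((2 * T) ^+ d)^-1)%:E <= _)%E.
  rewrite lee_fin; apply: le_trans (he e _) _; first by apply/andP; split; lra.
  rewrite mulrA -[leRHS]mulrA ler_wpM2l ?mulr_ge0 ?(ltW nu0) //.
  rewrite -expr_div_n; apply: (@le_trans _ _ ((1 - e) ^+ d)).
    rewrite ler_piMr ?exprn_ge0 //; try lra.
    by apply: exprn_ile1; lra.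
  rewrite lerXn2r ?nnegrE; try lra.
    by rewrite divr_ge0 // mulr_ge0 //; lra.
  by rewrite ler_pdivlMr ?mulr_gt0 //; lra.
rewrite EFinM /dens_at lee_pmul2r ?lte_fin ?invr_gt0 //; exact: ball_sum_ge.
Qed.

End CoveringDensity.

(** Coverings are sequences, so the translates have to be enumerated; injectivity prevents a ball
    from entering the density several times. *)
Lemma infinite_countType_enum (J : countType) (i : nat -> J) : injective i ->
  exists g : nat -> J, injective g /\ forall j, exists n, g n = j.
Proof.
move=> iI.
have nf : ~ finite_set [set: J].
  move=> fJ; apply: infinite_nat; have -> : [set: nat] = i @^-1` [set: J] by [].
  by apply: finite_preimage fJ => x y _ _; exact: iI.
have /card_set_bijP[f [_ fI fS]] := eq_card_nat (countableP [set: J]) nf.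
have /choice[g gP] (n : nat) : exists j, f j = n by have [j _ jn] := fS n Logic.I; exists j.
exists g; split; first by move=> n m gnm; rewrite -(gP n) -(gP m) gnm.
by move=> j; exists (f j); apply: fI; rewrite ?inE.
Qed.

(** Encodes the integers from [-p] to [p] by the [2 * p + 1] smallest naturals, for counting lattice
    points. *)
Lemma absz_shift_inj (p : nat) (a b : int) : - (p%:Z) <= a <= p%:Z -> - (p%:Z) <= b <= p%:Z ->
  absz (a + p%:Z) = absz (b + p%:Z) -> a = b.
Proof. lia. Qed.

Lemma absz_shift_lt (p : nat) (a : int) : - (p%:Z) <= a <= p%:Z ->
  (absz (a + p%:Z)%R < (2 * p).+1)%N.
Proof. lia. Qed.

(** * Upper bound for the covering density by periodic coverings *)

Section TilingCovering.
Variables (R : realType) (d : nat).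
Hypothesis d0 : (0 < d)%N.
Implicit Types (x y z : 'rV[R]_d) (xi : seq 'rV[R]_d).

Lemma size_inj_le (T : finType) (s : seq nat) (f : nat -> T) : uniq s ->
  {in s &, injective f} -> (size s <= #|T|)%N.
Proof.
move=> us fI; rewrite -(size_map f) -(card_uniqP _) ?max_card //.
by rewrite map_inj_in_uniq.
Qed.

(* A finite covering of a cube of side L is repeated along the lattice of its translates. *)
Lemma Theta_le : (Theta R d <= (nu R d * kappa R d)%:E)%E.
Proof.
have nu0 := nu_gt0 R d0; have k0 := kappa_ge0 R d.
apply/lee_addgt0Pr => eps eps0; rewrite -EFinD.
have e10 : 0 < eps / 2 / nu R d by rewrite !divr_gt0.
have [L [N [L0 N0 NL [xi0 sxi0 cov0]]]] := kappa_near d e10.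
have Ld : 0 < L ^+ d by rewrite exprn_gt0.
pose J : countType := ({ffun 'I_d -> int} * 'I_N)%type.
have [g [gI gS]] : exists g : nat -> J, injective g /\ forall j, exists n, g n = j.
  apply: (@infinite_countType_enum J (fun n => ([ffun=> n%:Z], Ordinal N0))) => n m [] /ffunP.
  by move=> /(_ (Ordinal d0)); rewrite !ffunE => -[].
pose c n : 'rV[R]_d := \row_i (L * ((g n).1 i)%:~R) + nth 0 xi0 (g n).2.
have ccov : is_ball_covering c 1.
  split => //; apply/seteqP; split => // x _.
  pose k : {ffun 'I_d -> int} := [ffun i => Num.floor (x 0 i / L)].
  pose z : 'rV[R]_d := \row_i (L * (k i)%:~R).
  have [|y yxi xy] := cov0 (x - z).
    move=> i; rewrite !mxE ffunE.
    have /andP[a b] := floor_itv (x 0 i / L).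
    rewrite ler_pdivlMr // mulrC in a; rewrite ltr_pdivrMr // in b.
    rewrite intrD mulrDl mul1r [_%:~R * L]mulrC in b.
    by apply/andP; split; lra.
  have iy : (index y xi0 < N)%N by rewrite -sxi0 index_mem.
  have [n gn] := gS (k, Ordinal iy).
  exists n => //; rewrite /eball /= /c gn /= nth_index //.
  have -> : x - (\row_i (L * (k i)%:~R) + y) = x - z - y by rewrite opprD addrA.
  exact: xy.
(* The nodes of [xi0] may lie outside the cube they cover; [B0] bounds how far. *)
have [B0 hB0 hB] : exists2 B0 : R, 0 <= B0 & forall j i, `|nth 0 xi0 j 0 i| <= B0.
  exists (\sum_(y <- xi0) enorm y); first by apply: sumr_ge0 => *; exact: enorm_ge0.
  move=> j i; have [js|sj] := ltnP j (size xi0); last first.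
    by rewrite nth_default // mxE normr0 sumr_ge0 // => *; exact: enorm_ge0.
  apply: le_trans (coord_le_enorm _ i) _; rewrite (big_nth 0) big_mkord.
  rewrite (bigD1 (Ordinal js)) //= lerDl; apply: sumr_ge0 => *; exact: enorm_ge0.
(* [2 * (1 + B0)] accounts for balls reaching into [cube T] from outside, [3 * L] for rounding up to
   whole periods. *)
pose B := 2 * B0 + 2 + 3 * L.
have B1 : 0 < B by rewrite /B; lra.
have Sbound T : 0 < T -> (\sum_(k <oo) leb_outer (eball (c k) 1 `&` cube T) <=
    (nu R d * (N%:R / L ^+ d * (2 * T + B) ^+ d))%:E)%E.
  (* Balls that meet [cube T] have lattice indices with all coordinates between [-p] and [p]. *)
  move=> T0; pose p := (Num.truncn ((T + 1 + B0) / L)).+1.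
  have TB0 : 0 <= (T + 1 + B0) / L by rewrite divr_ge0 ?(ltW L0) //; lra.
  have /andP[p1 p2] := truncn_itv TB0; rewrite -/p in p2.
  have pB : L * (2 * p).+1%:R <= 2 * T + B.
    rewrite -natr1 natrM /p -natr1.
    have := ler_wpM2l (ltW L0) p1; rewrite mulrCA divff ?gt_eqF // mulr1.
    by rewrite /B; lra.
  pose I k := `[< exists2 x, cube T x & eball (c k) 1 x >].
  have kp k i : I k -> - (p%:Z) <= (g k).1 i <= p%:Z.
    move=> /asboolP[x xT xk].
    have := le_trans (coord_le_enorm _ i) (xk : enorm (x - c k) <= 1).
    have := hB (g k).2 i; have /andP[h3 h4] := xT i.
    rewrite !mxE !ler_norml => /andP[a1 a2] /andP[b1 b2].
    have pL : T + 1 + B0 <= L * p%:R by rewrite mulrC -ler_pdivrMr // ltW.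
    apply/andP; split; rewrite -(ler_int R) -(ler_pM2l L0) ?mulrNz ?mulrN -pmulrn; lra.
  have Icount n : (count I (iota 0 n) <= (2 * p).+1 ^ d * N)%N.
    have -> : ((2 * p).+1 ^ d * N = #|{: {ffun 'I_d -> 'I_(2 * p).+1} * 'I_N}|)%N.
      by rewrite card_prod card_ffun !card_ord.
    rewrite -size_filter.
    pose phi k : ({ffun 'I_d -> 'I_(2 * p).+1} * 'I_N)%type :=
      ([ffun i => inord (absz ((g k).1 i + p%:Z)%R)], (g k).2).
    apply: (@size_inj_le _ _ phi); first by rewrite filter_uniq // iota_uniq.
    move=> k k'; rewrite !mem_filter => /andP[Ik _] /andP[Ik' _] [/ffunP e1 e2].
    apply: gI; rewrite (surjective_pairing (g k)) (surjective_pairing (g k')) e2.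
    congr (_, _); apply/ffunP => i.
    have := e1 i; rewrite !ffunE => /(congr1 val) /=.
    rewrite !inordK ?absz_shift_lt ?kp // => e.
    by apply: absz_shift_inj e; exact: kp.
  apply: lime_le; first by apply: is_cvg_nneseries => k *; exact: leb_outer_ge0.
  apply: nearW => n.
  have term k : (leb_outer (eball (c k) 1 `&` cube T) <= (if I k then nu R d else 0)%:E)%E.
    have [v Bv] := compact_boxcover d0 (compact_eball (c := c k) (rho := 1)).
    case: ifPn => [_|/asboolP nI].
      apply: (@le_trans _ _ (leb_outer (eball (c k) 1))); first by apply: leb_outerS; exact: subIsetl.
      by rewrite (boxcover_fin Bv) lebR_eball // expr1n mul1r.
    have -> : eball (c k) 1 `&` cube T = set0.
      by apply/seteqP; split => // x [xk xT]; apply: nI; exists x.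
    exact: boxcover_leb (boxcover_set0 R d0).
  apply: le_trans (lee_sum _ (fun k _ => term k)) _.
  rewrite sumEFin lee_fin.
  have -> : \sum_(0 <= k < n) (if I k then nu R d else 0) = (count I (iota 0 n))%:R * nu R d.
    by rewrite -big_mkcond /= big_const_seq iter_addr_0 /index_iota subn0 mulr_natl.
  rewrite mulrC ler_wpM2l ?(ltW nu0) //.
  apply: (@le_trans _ _ ((2 * p).+1 ^ d * N)%:R); first by rewrite ler_nat.
  rewrite natrM natrX mulrC -mulrA ler_wpM2l ?ler0n // ler_pdivlMl // -exprMn.
  by rewrite lerXn2r ?nnegrE ?mulr_ge0 ?(ltW L0) //; lra.
pose kN := nu R d * (N%:R / L ^+ d).
have kN0 : 0 <= kN by rewrite mulr_ge0 ?divr_ge0 ?ler0n // ltW.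
have kNb : kN <= nu R d * kappa R d + eps / 2.
  have : N%:R / L ^+ d <= kappa R d + eps / 2 / nu R d by rewrite ler_pdivrMr.
  move/(ler_wpM2l (ltW nu0)); rewrite mulrDr [nu R d * (eps / 2 / _)]mulrC divfK ?gt_eqF //.
have [e2 e20 he2] := shell_small d kN (divr_gt0 eps0 (ltr0n R 2)).
apply: le_trans (ereal_inf_lbound _) _; first by exists c, 1; split; [exact: ccov|reflexivity].
apply: ge_ereal_sup => _ [M _ <-].
pose e := Num.min (e2 / 2) (1 / 2).
have e0 : 0 < e by rewrite lt_min !divr_gt0.
have ee2 : e <= e2 / 2 by rewrite ge_min lexx.
have e12 : e <= 1 / 2 by rewrite ge_min lexx orbT.
pose T := Num.max (Num.max M 1) (B / e).
have T0 : 0 < T by rewrite !lt_max ltr01 orbT.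
have MT : M <= T by rewrite !le_max lexx.
have BT : B <= e * T by rewrite mulrC -ler_pdivrMr // !le_max lexx orbT.
apply: le_trans (ereal_inf_lbound _) _; first by exists T; [exact: MT|reflexivity].
have T2 : 0 < (2 * T) ^+ d by rewrite exprn_gt0 // mulr_gt0.
apply: (@le_trans _ _ ((nu R d * (N%:R / L ^+ d * (2 * T + B) ^+ d)) * ((2 * T) ^+ d)^-1)%:E).
  rewrite EFinM /dens_at lee_pmul2r ?lte_fin ?invr_gt0 //; exact: Sbound.
rewrite lee_fin.
have -> : nu R d * (N%:R / L ^+ d * (2 * T + B) ^+ d) * ((2 * T) ^+ d)^-1 =
    kN * ((2 * T + B) / (2 * T)) ^+ d by rewrite /kN expr_div_n; ring.
apply: (@le_trans _ _ (kN * (1 + e) ^+ d)).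
  rewrite ler_wpM2l // lerXn2r ?nnegrE ?divr_ge0 //; try lra.
  by rewrite ler_pdivrMr ?mulr_gt0 //; lra.
have := he2 e (ltac:(apply/andP; split; lra)); rewrite mulrBl => h.
have : (1 - 2 * e) ^+ d * kN <= kN.
  by rewrite ler_piMl //; apply: exprn_ile1; lra.
lra.
Qed.

Lemma ThetaE : Theta R d = (nu R d * kappa R d)%:E.
Proof. by apply/eqP; rewrite eq_le Theta_le Theta_ge. Qed.

End TilingCovering.

(** * Asymptotics *)

Section Asymptotics.
Variables (R : realType) (d : nat).
Hypothesis d0 : (0 < d)%N.
Implicit Types (x y z : 'rV[R]_d) (xi : seq 'rV[R]_d) (Om : set 'rV[R]_d).

(** A covered cube has at most the total volume of the balls, so [kappa >= 1 / nu]. Positivity makes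
    the radii chosen below positive. *)
Lemma kappa_gt0 : 0 < kappa R d.
Proof.
have nu0 := nu_gt0 R d0.
apply: lt_le_trans (_ : (nu R d)^-1 <= _); first by rewrite invr_gt0.
apply: lb_le_inf; first exact: covering_ratios_neq0.
move=> _ [L [xi [L0 cov ->]]]; have Ld : 0 < L ^+ d by rewrite exprn_gt0.
rewrite ler_pdivlMr // ler_pdivrMl // mulrC.
apply/ler_addgt0Pr => e e0; pose del := e / ((size xi)%:R + 1).
have s1 : 0 < (size xi)%:R + 1 :> R by rewrite ltr_wpDl ?ler0n.
have del0 : 0 < del by rewrite divr_gt0.
have bxi : boxcover (\big[setU/set0]_(y <- xi) eball y 1) (\sum_(y <- xi) (nu R d + del)).
  apply: (boxcover_bigsetU d0) => y _.
  have [v Bv] := compact_boxcover d0 (compact_eball (c := y) (rho := 1)).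
  by have := boxcover_lebR Bv del0; rewrite lebR_eball // expr1n mul1r.
have sub : box 0 (0 + const_mx L) `<=` \big[setU/set0]_(y <- xi) eball y 1.
  by rewrite add0r -bigcup_seq => x /cov[y yxi xy]; exists y.
have := cube_le_boxcover L0 (boxcoverS sub bxi).
have -> : \sum_(y <- xi) (nu R d + del) = (size xi)%:R * (nu R d + del).
  by rewrite big_const_seq count_predT iter_addr_0 mulr_natl.
rewrite mulrDr => /le_trans; apply; rewrite lerD2l /del.
by rewrite mulrA ler_pdivrMr // mulrC ler_wpM2l ?lerDl // ltW.
Qed.

Lemma body_gt0 Om : convex_body Om -> 0 < lebR Om.
Proof.
move=> [cpO [_ [x0 /interior_eball[r r0 rO]]]]; have [v Ov] := compact_boxcover d0 cpO.
apply: lt_le_trans (lebRS Ov rO).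
by rewrite lebR_eball // mulr_gt0 ?exprn_gt0 ?nu_gt0.
Qed.

Let p : R := 2 / d%:R.

Let dR : 0 < d%:R :> R. Proof. by rewrite ltr0n. Qed.

Lemma root_powers (X : R) : 0 <= X ->
  (X `^ d%:R^-1) ^+ d = X /\ (X `^ d%:R^-1) ^+ 2 = X `^ p.
Proof.
move=> X0; split; rewrite -powR_mulrn ?powR_ge0 // -powRrM.
  by rewrite mulVf ?gt_eqF // powRr1.
by rewrite mulrC.
Qed.

Lemma pexp_bounds : 0 < p <= 2.
Proof.
by rewrite divr_gt0 //= ler_pdivrMr // ler_peMr // ler1n.
Qed.

Lemma radius_small (X h1 : R) : 0 < X -> 0 < h1 ->
  exists2 n0, (0 < n0)%N & forall n, (n0 <= n)%N ->
   0 < (X / n%:R) `^ d%:R^-1 < h1.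
Proof.
move=> X0 h10; have h1d : 0 < h1 ^+ d by rewrite exprn_gt0.
exists (Num.truncn (X / h1 ^+ d)).+1 => // n nn.
have n0 : 0 < n%:R :> R by rewrite ltr0n (leq_trans _ nn).
have Xn : 0 < X / n%:R by rewrite divr_gt0.
rewrite powR_gt0 //=.
rewrite -(@ltr_pXn2r _ d) ?nnegrE ?powR_ge0 ?(ltW h10) //.
rewrite (root_powers (ltW Xn)).1 ltr_pdivrMr // mulrC -ltr_pdivrMr //.
by apply: lt_le_trans (truncnS_gt _) _; rewrite ler_nat.
Qed.

Section Limit.
Variables (Om : set 'rV[R]_d) (q : R).
Hypothesis bO : convex_body Om.

Let A := kappa R d * lebR Om.
Let l := 4^-1 * A `^ p.

Let A0 : 0 < A. Proof. by rewrite mulr_gt0 ?kappa_gt0 ?body_gt0. Qed.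

Let l0 : 0 < l. Proof. by rewrite mulr_gt0 // powR_gt0. Qed.

Lemma small_radius (s : R) : 0 < s ->
  exists2 h2 : R, 0 < h2 & forall h, 0 < h < h2 -> `|q| * (h ^+ 2 / 4) <= s.
Proof.
move=> s0; have q1 : 0 < `|q| + 1 by rewrite ltr_wpDl.
exists (Num.min 1 (s / (`|q| + 1))); first by rewrite lt_min ltr01 divr_gt0.
move=> h /andP[h0]; rewrite lt_min ltr_pdivlMr // => /andP[h1 hs].
have hh : h ^+ 2 <= h by rewrite expr2 ler_piMr // ltW.
have := ler_wpM2l (normr_ge0 q) hh; have := mulr_ge0 (normr_ge0 q) (ltW h0).
have := sqr_ge0 h; lra.
Qed.

Lemma R_n_upper (s : R) : 0 < s <= 1 / 2 -> exists n0, forall n, (n0 <= n)%N ->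
  ((n%:R `^ p)%:E * R_n q Om n <= (l * (1 + 8 * s))%:E)%E.
Proof.
move=> /andP[s0 s1]; have As0 : 0 < A * s / 2 by rewrite divr_gt0 // mulr_gt0.
have [h1 h10 hN] := node_cover_exists d0 bO As0.
have [h2 h20 hq] := small_radius s0.
have s1' : 0 < 1 + s by lra.
have X0 : 0 < A * (1 + s) by rewrite mulr_gt0.
have hm0 : 0 < Num.min h1 h2 by rewrite lt_min h10.
(* The radius satisfies [h ^+ d = A * (1 + s) / n]; as a covering exists with
   [size * h ^+ d <= A + A * s / 2], it uses at most [n] nodes. *)
have [n0 n00 hn] := radius_small X0 hm0.
exists n0 => n nn; have /andP[] := hn n nn; set h := _ `^ _ => h0.
rewrite lt_min => /andP[hh1 hh2].
have np : 0 < n%:R :> R by rewrite ltr0n (leq_trans n00 nn).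
have Xn : 0 <= A * (1 + s) / n%:R by rewrite divr_ge0 // ltW.
have [hd h2E] := root_powers Xn; rewrite -/h in hd h2E.
have h01 : 0 < h < h1 by rewrite h0.
have h02 : 0 < h < h2 by rewrite h0.
have [xi nc sz] := hN h h01; have tq := hq h h02.
have xin : (size xi <= n)%N.
  rewrite -(ler_nat R); move: sz; rewrite hd -/A => sz.
  have k1 : (size xi)%:R * (A * (1 + s) / n%:R) <= A * (1 + s).
    by apply: le_trans sz _; rewrite mulrDr mulr1 lerD2l ler_pdivrMr //; have := mulr_gt0 A0 s0; lra.
  move: k1; rewrite mulrA ler_pdivrMr // mulrC ler_pM2l //.
have qB : `|q| * (h ^+ 2 / 4) < 1 by lra.
have RB : (R_n q Om n <= (h ^+ 2 / 4 / (1 - `|q| * (h ^+ 2 / 4)))%:E)%E.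
  apply: le_trans (R_xi_le bO nc (ltW h0) qB); apply: ereal_inf_lbound; exists xi => //.
  by split => // y yxi; rewrite inE; apply: interior_subset; case: nc => + _ _; apply.
have nP : 0 <= n%:R `^ p by exact: powR_ge0.
apply: le_trans (lee_wpmul2l _ RB) _; first by rewrite lee_fin.
rewrite -EFinM lee_fin.
set t := `|q| * _ in tq qB *; have t0 : 0 <= t by rewrite mulr_ge0 // divr_ge0 // sqr_ge0.
have E : n%:R `^ p * (h ^+ 2 / 4 / (1 - t)) = l * ((1 + s) `^ p / (1 - t)).
  rewrite h2E /l powRM ?invr_ge0 ?(ltW np) ?(ltW X0) // powRM ?(ltW A0) ?(ltW s1') //.
  have -> : (n%:R^-1) `^ p = (n%:R `^ p)^-1 by rewrite -powR_inv1 ?ltW // powRAC powR_inv1.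
  by field; rewrite !gt_eqF ?powR_gt0 ?subr_gt0.
rewrite E ler_wpM2l ?(ltW l0) // ler_pdivrMr ?subr_gt0 //.
have /andP[p0 p2] := pexp_bounds.
have k1 : (1 + s) `^ p <= (1 + s) ^+ 2.
  by rewrite -powR_mulrn ?(ltW s1') //; apply: ler_powR => //; lra.
apply: le_trans k1 _.
(* The constant 8 is a convenient one for which [(1 + s)^2 <= (1 + 8 s)(1 - s)] on
   [0 < s <= 1/2]. *)
apply: (@le_trans _ _ ((1 + 8 * s) * (1 - s))); last by rewrite ler_wpM2l //; lra.
have : s * s <= s * (1 / 2) by rewrite ler_wpM2l // ltW.
rewrite expr2; lra.
Qed.

Lemma R_n_lower (s : R) : 0 < s <= 1 / 2 -> exists n0, forall n, (n0 <= n)%N ->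
  ((l * (1 - 3 * s))%:E <= (n%:R `^ p)%:E * R_n q Om n)%E.
Proof.
move=> /andP[s0 s1]; have As0 : 0 < A * s / 2 by rewrite divr_gt0 // mulr_gt0.
have [h1 h10 hN] := covers_size_ge d0 bO As0.
have [h2 h20 hq] := small_radius s0.
have s1' : 0 < 1 - s by lra.
have X0 : 0 < A * (1 - s) by rewrite mulr_gt0.
have hm0 : 0 < Num.min h1 h2 by rewrite lt_min h10.
have [n0 n00 hn] := radius_small X0 hm0.
exists n0 => n nn; have /andP[] := hn n nn; set h := _ `^ _ => h0.
rewrite lt_min => /andP[hh1 hh2].
have np : 0 < n%:R :> R by rewrite ltr0n (leq_trans n00 nn).
have Xn : 0 <= A * (1 - s) / n%:R by rewrite divr_ge0 // ltW.
have [hd h2E] := root_powers Xn; rewrite -/h in hd h2E.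
have h01 : 0 < h < h1 by rewrite h0.
have h02 : 0 < h < h2 by rewrite h0.
have tq := hq h h02.
have RB : ((h ^+ 2 / 4 / (1 + `|q| * (h ^+ 2 / 4)))%:E <= R_n q Om n)%E.
  apply: le_ereal_inf_tmp => _ [xi [xin _] <-].
  have [c [Oc far]] : exists c, Om c /\ forall y, y \in xi -> h < enorm (c - y).
    (* At most [n] nodes give [size * h ^+ d <= A * (1 - s)], less than the [A - A * s / 2] that a
       covering of [Om] requires. *)
    apply: contrapT => nc.
    have cov : covers Om h xi.
      move=> x Ox; apply: contrapT => nx; apply: nc; exists x; split => // y yxi.
      by rewrite ltNge; apply/negP => xy; apply: nx; exists y.
    have := hN h h01 xi cov; rewrite hd -/A => k1.
    have k2 : (size xi)%:R * (A * (1 - s) / n%:R) <= A * (1 - s).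
      rewrite mulrA ler_pdivrMr // mulrC ler_wpM2l ?(ltW X0) // ler_nat //.
    by have := mulr_gt0 A0 s0; lra.
  exact: (R_xi_ge q d0 h0 Oc far).
have nP : 0 <= n%:R `^ p by exact: powR_ge0.
apply: le_trans (_ : ((n%:R `^ p)%:E * (h ^+ 2 / 4 / (1 + `|q| * (h ^+ 2 / 4)))%:E <= _)%E); last first.
  by apply: lee_wpmul2l RB; rewrite lee_fin.
rewrite -EFinM lee_fin.
set t := `|q| * _ in tq *; have t0 : 0 <= t by rewrite mulr_ge0 // divr_ge0 // sqr_ge0.
have t1 : 0 < 1 + t by lra.
have E : n%:R `^ p * (h ^+ 2 / 4 / (1 + t)) = l * ((1 - s) `^ p / (1 + t)).
  rewrite h2E /l powRM ?invr_ge0 ?(ltW np) ?(ltW X0) // powRM ?(ltW A0) ?(ltW s1') //.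
  have -> : (n%:R^-1) `^ p = (n%:R `^ p)^-1 by rewrite -powR_inv1 ?ltW // powRAC powR_inv1.
  by field; rewrite !gt_eqF ?powR_gt0.
rewrite E ler_wpM2l ?(ltW l0) // ler_pdivlMr //.
have /andP[p0 p2] := pexp_bounds.
have k1 : (1 - s) ^+ 2 <= (1 - s) `^ p.
  by rewrite -powR_mulrn ?(ltW s1') //; apply: ger_powR => //; rewrite s1' /=; lra.
apply: le_trans k1.
have [k3|k3] := leP 0 (1 - 3 * s).
  apply: (@le_trans _ _ ((1 - 3 * s) * (1 + s))); first by rewrite ler_wpM2l //; lra.
  by have := mulr_gt0 s0 s0; rewrite expr2; lra.
apply: le_trans (sqr_ge0 _); rewrite mulr_le0_ge0 // ltW //.
Qed.

Lemma R_n_limit : ((fun n : nat => ((n%:R `^ p)%:E * R_n q Om n)%E) @ \oo --> l%:E)%E.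
Proof.
have key (e : R) : 0 < e -> \forall n \near \oo,
    ((l - e)%:E <= (n%:R `^ p)%:E * R_n q Om n <= (l + e)%:E)%E.
  move=> e0; pose s := Num.min (1 / 2) (e / (8 * l)).
  have s0 : 0 < s by rewrite lt_min !divr_gt0 // mulr_gt0.
  have s12 : 0 < s <= 1 / 2.
    by rewrite s0 /= /s; case: (leP (1 / 2) (e / (8 * l))) => // /ltW.
  have l8 : 0 < 8 * l by rewrite mulr_gt0.
  have se : l * (8 * s) <= e.
    have : s <= e / (8 * l).
      by rewrite /s; case: (leP (1 / 2) (e / (8 * l))).
    by rewrite ler_pdivlMr //; lra.
  have [n1 h1] := R_n_upper s12; have [n2 h2] := R_n_lower s12.
  exists (maxn n1 n2) => // n /=; rewrite geq_max => /andP[nn1 nn2].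
  have ls : 0 < l * s by rewrite mulr_gt0.
  apply/andP; split.
    by apply: le_trans (h2 n nn2); rewrite lee_fin; lra.
  by apply: le_trans (h1 n nn1) _; rewrite lee_fin; lra.
apply/fine_cvgP; split.
  apply: filterS (key 1 ltr01) => n /andP[a b].
  by apply: fin_real; rewrite (lt_le_trans (ltNyr _) a) (le_lt_trans b (ltry _)).
apply/cvgrPdist_le => e e0; apply: filterS (key e e0) => n /= /andP[a b].
have fx : ((n%:R `^ p)%:E * R_n q Om n)%E \is a fin_num.
  by apply: fin_real; rewrite (lt_le_trans (ltNyr _) a) (le_lt_trans b (ltry _)).
move: a b; rewrite -(fineK fx) !lee_fin => a b.
by rewrite ler_norml; apply/andP; split; lra.
Qed.

End Limit.
End Asymptotics.

Unset Implicit Arguments.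

Theorem theorem2 (R : realType) (d : nat) (Om : set 'rV[R]_d) (q : R) :
  (0 < d)%N -> convex_body Om ->
  ((fun n : nat => ((n%:R `^ (2 / d%:R))%:E * R_n q Om n)%E) @ \oo -->
   ((4^-1 * ((fine (Theta R d) * fine (leb_outer Om)) / nu R d) `^ (2 / d%:R))%:E)%E).
Proof.
(* [ThetaE] shows that the density is finite, so [fine] loses nothing, and [nu] cancels. *)
move=> d0 bO; rewrite (ThetaE R d0) /=.
have -> : nu R d * kappa R d * fine (leb_outer Om) / nu R d = kappa R d * lebR Om.
  by rewrite /lebR; field; rewrite gt_eqF // nu_gt0.
exact: R_n_limit.
Qed.
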